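(* There is a real number $B_4$ with $|B_4-2.60|\le 0.01$ such that for every $B$ with $0<B<B_4$ there exists a maximizer for $J_{B,1}$ in $L^2(\mathbb T)$, i.e. a function $u_0\in L^2(\mathbb T)$ with $\|u_0\|_{L^2}=1$ and $W_B(u_0)=J_{B,1}$.
   Context: $\mathbb T=\mathbb R/(2\pi\mathbb Z)$. $L^2(\mathbb T)$ is the space of complex-valued, measurable, $2\pi$-periodic functions that are square-integrable on $[0,2\pi]$, with $\|u\|_{L^2}^2=\int_{\mathbb T}|u(x)|^2\,dx$. Fourier coefficients: $\hat u(n)=\frac1{2\pi}\int_{\mathbb T}e^{-inx}u(x)\,dx$, $n\in\mathbb Z$. For $t\in\mathbb R$, $T_t:L^2(\mathbb T)\to L^2(\mathbb T)$ is defined by $\widehat{T_tu}(n)=e^{-in^2t}\hat u(n)$. For $B>0$, $W_B(u)=\int_0^B\int_{\mathbb T}|T_tu(x)|^4\,dx\,dt$, and $J_{B,1}=\sup\{W_B(u):u\in L^2(\mathbb T),\ \|u\|_{L^2}=1\}$. *)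

(* Defs.v *)
From HB Require Import structures.
From mathcomp Require Import all_boot all_order all_algebra.
From mathcomp Require Import all_classical all_reals all_analysis.
From mathcomp Require Import complex.
Set Implicit Arguments.
Unset Strict Implicit.
Unset Printing Implicit Defensive.
Import Order.TTheory GRing.Theory Num.Theory.
Import numFieldNormedType.Exports.
Import Normc.
Local Open Scope classical_set_scope.
Local Open Scope ring_scope.
Local Open Scope complex_scope.

(* Functions on the torus R / (2 pi Z) are represented by 2 pi-periodic
   functions on R; integrals over the torus are integrals over [0, 2 pi]. *)
Definition torus (R : realType) : set R := `[0, pi *+ 2].
Arguments torus R : clear implicits.

Definition cmeasurable (R : realType) (u : R -> R[i]) : Prop :=
  measurable_fun setT (fun x => complex.Re (u x)) /\
  measurable_fun setT (fun x => complex.Im (u x)).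

Definition L2 (R : realType) : set (R -> R[i]) :=
  [set u | [/\ cmeasurable u, periodic u (pi *+ 2) &
    (\int[lebesgue_measure]_(x in torus R) (normc (u x) ^+ 2)%:E < +oo)%E]].

Definition L2norm (R : realType) (u : R -> R[i]) : R :=
  Num.sqrt (\int[lebesgue_measure]_(x in torus R) (normc (u x) ^+ 2)).

Definition cintegral (R : realType) (D : set R) (f : R -> R[i]) : R[i] :=
  (\int[lebesgue_measure]_(x in D) complex.Re (f x)) +i*
  (\int[lebesgue_measure]_(x in D) complex.Im (f x)).

(* cis y = exp (i y) *)
Definition cis (R : realType) (y : R) : R[i] := cos y +i* sin y.

Definition fourier (R : realType) (u : R -> R[i]) (n : int) : R[i] :=
  ((pi *+ 2)^-1)%:C * cintegral (torus R) (fun x => cis (- (n%:~R * x)) * u x).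

(* [schrodinger t u] is a representative of the L^2-class T_t u, which is
   determined by its Fourier coefficients; for u in L^2 one exists by
   Riesz-Fischer, so the default value 0 is not used. The quantities below do
   not depend on the representative chosen for each t. *)
Definition schrodinger (R : realType) (t : R) (u : R -> R[i]) : R -> R[i] :=
  xget (fun=> 0) [set v | L2 v /\
    forall n : int, fourier v n = cis (- (n%:~R ^+ 2 * t)) * fourier u n].

Definition W (R : realType) (B : R) (u : R -> R[i]) : \bar R :=
  (\int[lebesgue_measure]_(t in `[0%R, B])
     \int[lebesgue_measure]_(x in torus R)
       (normc (schrodinger t u x) ^+ 4)%:E)%E.

Definition J1 (R : realType) (B : R) : \bar R :=
  ereal_sup [set W B u | u in [set u : R -> R[i] | L2 u /\ L2norm u = 1]].

(* Main.v *)
(* Write the space-time integral of |T_t u|^4 as 2 pi B times a quartic form wq in the Fourier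
   coefficients a = (a_n), with kernel the time average of e^{-i w t} at w = n1^2+n2^2-n3^2-n4^2.
   On the resonant set w = 0 the form is 2 m^2 - sum |a_n|^4, where m is the l^2 mass, and off it
   w = +-2pq with p = n3-n1, q = n4-n1 nonzero, so the kernel is at most 1/(B|pq|); in particular
   distant or spread-out frequency blocks barely interact and the form then is at most 2 m^2.
   Hence, if j = sup_{m=1} wq > 2, maximizing sequences are compact up to a Galilean shift: a
   vanishing sequence has limit value at most 2, and for masses al, be split into two distant
   blocks the gain is only 4 al be < 2 j al be, which forces al be -> 0.
   That j > 2 is seen from the chirps a_n = e^{-i n^2 s}, 0 <= n < 14: their excess over 2 has the
   sign of G(s+B) - G(s) for an explicit trigonometric sum G, positive for a suitable s by a
   certified numerical check on [1.295, 2.59] and then, halving the time window, for all smaller B.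
   The passage to L^2 functions uses almost everywhere convergence of a fast subsequence of the
   Fourier partial sums together with Fatou's lemma, in space and in time. *)
Require Import Defs.
From HB Require Import structures.
From Stdlib Require Import ZArith.
From mathcomp Require Import all_boot all_order all_algebra.
From mathcomp Require Import all_classical all_reals all_analysis.
From mathcomp Require Import complex measurable_realfun.
From mathcomp Require Import lra ring zify ssrZ.
Set Implicit Arguments.
Unset Strict Implicit.
Unset Printing Implicit Defensive.
Import Order.TTheory GRing.Theory Num.Theory.
Import numFieldNormedType.Exports.
Import Normc.
Local Open Scope classical_set_scope.
Local Open Scope ring_scope.
Local Open Scope complex_scope.

(** [schrodinger t u] is selected separately for each [t], and measurability in [t] of its
    fourth-power integral is not immediate. The question is bypassed: [W] is only compared, from
    above and below, with integrals of measurable functions built from trigonometric polynomials, by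
    monotonicity alone. The supremum j runs over finitely supported coefficients, where every
    identity is a finite sum. The limit of a maximizing sequence is first known only to have mass at
    most 1; since wq <= j m^2, its energy can come arbitrarily close to j on finite windows only if
    no mass was lost. A chirp is a Dirichlet kernel carried by the flow to time s, so testing with
    it amounts to moving the time window from [0, B] to [s, s + B]. This is why the excess is an
    increment of one function G, and why the shift s is a free parameter. *)

Section Sums.
Variable R : realFieldType.
Implicit Types (s : seq int) (m n p q : int) (D K : nat).

Lemma ler_sum_subset (I : eqType) (s t : seq I) (F : I -> R) :
  uniq s -> {subset s <= t} -> (forall i, 0 <= F i) ->
  \sum_(i <- s) F i <= \sum_(i <- t) F i.
Proof.
elim: s t => [|a s IH] t /=; first by move=> _ _ F0; rewrite big_nil sumr_ge0.
move=> /andP[as_ us] st F0; rewrite big_cons.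
have at_ : a \in t by apply: st; rewrite mem_head.
rewrite (perm_big _ (perm_to_rem at_)) /= big_cons lerD2l; apply: IH => //.
move=> x xs; have := st x; rewrite inE xs orbT => /(_ isT) xt.
have := perm_mem (perm_to_rem at_) x; rewrite xt inE => /esym/orP[/eqP xa|//].
by move: as_; rewrite -xa xs.
Qed.

(** The cutoff [D] has two uses: [D = 1] removes the pole at 0, and a large [D] keeps a tail whose
    sum is of order 1 / D. *)
Definition invsq D n : R := if (D <= `|n|)%N then (n%:~R ^+ 2)^-1 else 0.

Lemma invsq_ge0 D n : 0 <= invsq D n.
Proof. by rewrite /invsq; case: ifP => // _; rewrite invr_ge0 sqr_ge0. Qed.

Lemma invsqN D n : invsq D (- n) = invsq D n.
Proof. by rewrite /invsq abszN rmorphN sqrrN. Qed.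

Lemma sum_invsq_nat D K : (0 < D)%N ->
  \sum_(k < K) invsq D k%:Z <= 2 / D%:R.
Proof.
move=> D0; have D0' : 0 < D%:R :> R by rewrite ltr0n.
(* Telescoping: 1 / K^2 <= 2 / K - 2 / (K + 1) for K >= 1, so the partial sums stay below 2 / D - 2
   / K. *)
suff H : \sum_(k < K) invsq D k%:Z <=
    if (D <= K)%N then 2 / D%:R - 2 / K%:R else 0.
  apply: le_trans H _; case: ifP => [DK|_]; last by rewrite divr_ge0.
  by rewrite gerBl divr_ge0.
elim: K => [|K IH]; first by rewrite big_ord0 leqNgt D0.
rewrite big_ord_recr /=; apply: le_trans (lerD IH (lexx _)) _; rewrite /invsq /=.
have [DK|KD] := leqP D K.
  rewrite (leqW DK).
  have K0 : 0 < K%:R :> R by rewrite ltr0n (leq_trans D0).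
  have K1 : 1 <= K%:R :> R by rewrite ler1n (leq_trans D0).
  rewrite -[K%:~R]/(K%:R) -[K.+1%:R]natr1.
  rewrite -subr_ge0.
  have -> : 2 / D%:R - 2 / (K%:R + 1) - (2 / D%:R - 2 / K%:R + (K%:R ^+ 2)^-1) =
    (K%:R - 1) / (K%:R ^+ 2 * (K%:R + 1)) :> R.
    by field; rewrite !gt_eqF//; lra.
  by rewrite divr_ge0 ?subr_ge0// mulr_ge0 ?sqr_ge0//; lra.
rewrite addr0 ; case: ifP => // DK1.
have -> : D = K.+1 by apply/eqP; rewrite eqn_leq DK1 KD.
by rewrite subrr.
Qed.

Lemma sum_invsq D s m : (0 < D)%N -> uniq s ->
  \sum_(n <- s) invsq D (n - m) <= 4 / D%:R.
Proof.
move=> D0 us; rewrite -(big_map (fun n => n - m) xpredT (fun n => invsq D n)).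
set t := map _ _; have ut : uniq t by rewrite map_inj_uniq // => x y /addIr.
have [K tK] : exists K, forall n, n \in t -> (`|n| < K)%N.
  exists (\sum_(n <- t) `|n|%N).+1 => n nt.
  by rewrite ltnS (perm_big _ (perm_to_rem nt)) /= big_cons leq_addr.
set l := [seq k%:Z | k <- iota 0 K].
(* The values n - m lie among the naturals below [K] and their negatives; each half costs at most 2
   / D. *)
apply: (@le_trans _ _ (\sum_(n <- l ++ map -%R l) invsq D n)).
  apply: ler_sum_subset => // [n nt|n]; last exact: invsq_ge0.
  have nK := tK _ nt; rewrite mem_cat.
  have [n0|n0] := lerP 0 n.
    apply/orP; left; apply/mapP; exists `|n|%N; last by rewrite gez0_abs.
    by rewrite mem_iota.
  apply/orP; right; apply/mapP; exists (- n); last by rewrite opprK.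
  by apply/mapP; exists `|n|%N; [rewrite mem_iota | rewrite ltz0_abs].
rewrite big_cat /= big_map big_map big_map.
have H : \sum_(j <- iota 0 K) invsq D j <= 2 / D%:R.
  by have := sum_invsq_nat K D0; rewrite -(big_mkord xpredT (fun k : nat => invsq D k%:Z)) /index_iota subn0.
under [X in _ + X]eq_bigr do rewrite invsqN.
have -> : 4 / D%:R = 2 / D%:R + 2 / D%:R :> R by rewrite -mulrDl -natrD.
exact: lerD.
Qed.

Definition invmul p q : R :=
  if (p == 0) || (q == 0) then 0 else (`|p%:~R| * `|q%:~R|)^-1.

Lemma invmul_ge0 p q : 0 <= invmul p q.
Proof. by rewrite /invmul; case: ifP => // _; rewrite invr_ge0 mulr_ge0. Qed.

Lemma invmulC p q : invmul p q = invmul q p.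
Proof. by rewrite /invmul orbC mulrC. Qed.

Lemma invmulNr p q : invmul p (- q) = invmul p q.
Proof. by rewrite /invmul oppr_eq0 rmorphN normrN. Qed.

Lemma invmulN p q : invmul (- p) q = invmul p q.
Proof. by rewrite invmulC invmulNr invmulC. Qed.

(** Expand (l |q| - |p|)^2 >= 0 and divide by l p^2 q^2. The weight [l] trades the small tail sum
    over [p] against the full sum over [q]. *)
Lemma invmul_le (l : R) D p q : 0 < l -> (0 < D)%N -> (D <= `|p|)%N ->
  2 * invmul p q <= l * invsq D p + l^-1 * invsq 1 q.
Proof.
move=> l0 D0 Dp; rewrite /invmul /invsq Dp absz_gt0.
have p0 : p != 0 by rewrite -absz_gt0 (leq_trans D0).
rewrite (negPf p0) /=; have [->|q0] /= := eqVneq q 0.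
  by rewrite !mulr0 addr0 mulr_ge0 ?ltW// invr_gt0 exprn_even_gt0 ?intr_eq0.
rewrite -[_%:~R ^+ 2]real_normK ?num_real// -[q%:~R ^+ 2]real_normK ?num_real//.
set x := `|p%:~R|; set y := `|q%:~R|.
have x0 : 0 < x by rewrite normr_gt0 intr_eq0.
have y0 : 0 < y by rewrite normr_gt0 intr_eq0.
rewrite -subr_ge0.
have -> : l / x ^+ 2 + l^-1 / y ^+ 2 - 2 / (x * y) = (l * y - x) ^+ 2 / (l * (x * y) ^+ 2).
  by field; rewrite !gt_eqF.
by rewrite divr_ge0 ?sqr_ge0// mulr_ge0 ?sqr_ge0// ltW.
Qed.

Definition far D p q := (D <= `|p|)%N || (D <= `|q|)%N.

Lemma sum_invmul s m1 m2 : uniq s ->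
  \sum_(n <- s) invmul (n - m1) (n - m2) <= 4.
Proof.
move=> us; rewrite -(@ler_pM2l _ 2)// mulr_sumr.
apply: (@le_trans _ _ (\sum_(n <- s) (invsq 1 (n - m1) + invsq 1 (n - m2)))).
  apply: ler_sum => n _; have [->|nm] := eqVneq n m1.
    by rewrite {1}/invmul subrr eqxx mulr0 addr_ge0 ?invsq_ge0.
  have := @invmul_le 1 1 (n - m1) (n - m2) ltr01 isT.
  by rewrite invr1 !mul1r; apply; rewrite absz_gt0 subr_eq0.
rewrite big_split /=; have := sum_invsq m1 (ltn0Sn 0) us; have := sum_invsq m2 (ltn0Sn 0) us.
lra.
Qed.

(** With cutoff E^2 and weight E, the tail costs E * 4 / E^2 and the full sum E^-1 * 4. Both equal 4
    / E, which is why the cutoff is a square. *)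
Lemma sum_invmul_far E s m1 m2 : (0 < E)%N -> uniq s ->
  \sum_(n <- s) (if far (E ^ 2) (n - m1) (n - m2) then invmul (n - m1) (n - m2) else 0)
    <= 8 / E%:R.
Proof.
move=> E0 us; have E0' : 0 < E%:R :> R by rewrite ltr0n.
have D0 : (0 < E ^ 2)%N by rewrite expn_gt0 E0.
rewrite -(@ler_pM2l _ 2)// mulr_sumr.
apply: (@le_trans _ _ (\sum_(n <- s) (
    (E%:R * invsq (E ^ 2) (n - m1) + E%:R^-1 * invsq 1 (n - m2)) +
    (E%:R * invsq (E ^ 2) (n - m2) + E%:R^-1 * invsq 1 (n - m1))))).
  have nn k k' : 0 <= E%:R * invsq (E ^ 2) k + E%:R^-1 * invsq 1 k'.
    by rewrite addr_ge0// mulr_ge0 ?invsq_ge0 ?invr_ge0 ?ltW.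
  apply: ler_sum => n _; rewrite /far; case: ifP => [/orP[H|H]|_].
  - by apply: le_trans (invmul_le _ E0' D0 H) _; rewrite lerDl.
  - by rewrite invmulC; apply: le_trans (invmul_le _ E0' D0 H) _; rewrite lerDr.
  - by rewrite mulr0 addr_ge0.
rewrite !big_split /= -!mulr_sumr.
have a1 := sum_invsq m1 (ltn0Sn 0) us; have a2 := sum_invsq m2 (ltn0Sn 0) us.
have b1 := sum_invsq m1 D0 us; have b2 := sum_invsq m2 D0 us.
have -> : 2 * (8 / E%:R) =
   (E%:R * (4 / (E ^ 2)%:R) + E%:R^-1 * (4 / 1%:R)) + (E%:R * (4 / (E ^ 2)%:R) + E%:R^-1 * (4 / 1%:R)) :> R.
  by rewrite natrX; field; rewrite gt_eqF.
have i0 : 0 < E%:R^-1 :> R by rewrite invr_gt0.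
by rewrite !lerD// ler_pM2l.
Qed.

End Sums.

(** * The quartic form *)

(** The constraint n1 + n2 = n3 + n4 is what integrating the fourth power of a trigonometric
    polynomial in x leaves behind. *)
Definition quad (V : nmodType) (s : seq int) (F : int -> int -> int -> int -> V) : V :=
  \sum_(n1 <- s) \sum_(n2 <- s) \sum_(n3 <- s) \sum_(n4 <- s | n1 + n2 == n3 + n4) F n1 n2 n3 n4.

Lemma eq_quad (V : nmodType) (s : seq int) (F G : int -> int -> int -> int -> V) :
  (forall n1 n2 n3 n4, n1 \in s -> n2 \in s -> n3 \in s -> n4 \in s ->
    n1 + n2 = n3 + n4 -> F n1 n2 n3 n4 = G n1 n2 n3 n4) -> quad s F = quad s G.
Proof.
move=> FG; rewrite /quad; apply: eq_big_seq => n1 s1; apply: eq_big_seq => n2 s2.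
apply: eq_big_seq => n3 s3; rewrite big_seq_cond [RHS]big_seq_cond.
by apply: eq_bigr => n4 /andP[s4 /eqP e]; apply: FG.
Qed.

Lemma quadD (V : nmodType) (s : seq int) (F G : int -> int -> int -> int -> V) :
  quad s (fun n1 n2 n3 n4 => F n1 n2 n3 n4 + G n1 n2 n3 n4) = quad s F + quad s G.
Proof.
rewrite /quad -big_split /=; apply: eq_bigr => n1 _; rewrite -big_split /=.
apply: eq_bigr => n2 _; rewrite -big_split /=; apply: eq_bigr => n3 _.
by rewrite big_split.
Qed.

Lemma quadN (V : zmodType) (s : seq int) (F : int -> int -> int -> int -> V) :
  quad s (fun n1 n2 n3 n4 => - F n1 n2 n3 n4) = - quad s F.
Proof.
rewrite /quad -sumrN; apply: eq_bigr => n1 _; rewrite -sumrN.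
apply: eq_bigr => n2 _; rewrite -sumrN; apply: eq_bigr => n3 _.
by rewrite sumrN.
Qed.

Lemma quadZ (R : pzRingType) (s : seq int) (c : R) (F : int -> int -> int -> int -> R) :
  quad s (fun n1 n2 n3 n4 => c * F n1 n2 n3 n4) = c * quad s F.
Proof.
rewrite /quad mulr_sumr; apply: eq_bigr => n1 _; rewrite mulr_sumr.
apply: eq_bigr => n2 _; rewrite mulr_sumr; apply: eq_bigr => n3 _.
by rewrite mulr_sumr.
Qed.

Lemma quad_swap (V : nmodType) (s : seq int) (F : int -> int -> int -> int -> V) :
  quad s F = quad s (fun n1 n2 n3 n4 => F n3 n4 n1 n2).
Proof.
rewrite /quad; transitivity (\sum_(n1 <- s) \sum_(n2 <- s) \sum_(n3 <- s) \sum_(n4 <- s)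
   if n1 + n2 == n3 + n4 then F n1 n2 n3 n4 else 0).
  by do 3 (apply: eq_bigr => ? _); rewrite big_mkcond.
transitivity (\sum_(n3 <- s) \sum_(n1 <- s) \sum_(n2 <- s)  \sum_(n4 <- s)
   if n1 + n2 == n3 + n4 then F n1 n2 n3 n4 else 0).
  by rewrite [RHS]exchange_big /=; apply: eq_bigr => n1 _; rewrite exchange_big.
apply: eq_bigr => n3 _.
transitivity (\sum_(n1 <- s) \sum_(n4 <- s) \sum_(n2 <- s)
   if n1 + n2 == n3 + n4 then F n1 n2 n3 n4 else 0).
  by apply: eq_bigr => n1 _; rewrite exchange_big.
rewrite exchange_big /=; apply: eq_bigr => n4 _; apply: eq_bigr => n1 _.
by rewrite [RHS]big_mkcond; apply: eq_bigr => n2 _; rewrite eq_sym.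
Qed.

Lemma quad_map_addr (V : nmodType) (s : seq int) (c : int) (F : int -> int -> int -> int -> V) :
  quad [seq n + c | n <- s] F =
  quad s (fun n1 n2 n3 n4 => F (n1 + c) (n2 + c) (n3 + c) (n4 + c)).
Proof.
rewrite /quad !big_map; apply: eq_bigr => n1 _; rewrite !big_map; apply: eq_bigr => n2 _.
rewrite !big_map; apply: eq_bigr => n3 _; rewrite !big_map; apply: eq_bigl => n4.
by rewrite !(addrACA _ c) (inj_eq (addIr _)).
Qed.

Section Quad.
Variable R : realFieldType.
Implicit Types (s : seq int) (m n p q : int) (D K E : nat) (x : int -> R).

Lemma ler_quad s (F G : int -> int -> int -> int -> R) :
  (forall n1 n2 n3 n4, n1 \in s -> n2 \in s -> n3 \in s -> n4 \in s ->
    n1 + n2 = n3 + n4 -> F n1 n2 n3 n4 <= G n1 n2 n3 n4) -> quad s F <= quad s G.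
Proof.
move=> FG; rewrite /quad big_seq [leRHS]big_seq; apply: ler_sum => n1 s1.
rewrite big_seq [leRHS]big_seq; apply: ler_sum => n2 s2.
rewrite big_seq [leRHS]big_seq; apply: ler_sum => n3 s3.
rewrite big_seq_cond [leRHS]big_seq_cond.
by apply: ler_sum => n4 /andP[s4 /eqP e]; apply: FG.
Qed.

Lemma sum_pred_le1 s n (c : R) : uniq s -> 0 <= c ->
  \sum_(k <- s | k == n) c <= c.
Proof.
move=> us c0; rewrite big_const_seq.
rewrite (_ : iter _ _ _ = c *+ count_mem n s); last first.
  by elim: (count_mem n s) => [|j IH] //=; rewrite IH mulrS.
by rewrite count_uniq_mem//; case: (n \in s); rewrite ?mulr1n ?mulr0n.
Qed.

Definition mass s x := \sum_(n <- s) x n ^+ 2.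

Lemma mass_ge0 s x : 0 <= mass s x.
Proof. by apply: sumr_ge0 => i _; rewrite sqr_ge0. Qed.

Lemma massM s x y : \sum_(n1 <- s) \sum_(n2 <- s) (x n1 * y n2) ^+ 2 = mass s x * mass s y.
Proof.
rewrite /mass big_distrl /=; apply: eq_bigr => n1 _; rewrite big_distrr /=.
by apply: eq_bigr => n2 _; rewrite exprMn.
Qed.

Section Weight.
Variables (k : int -> int -> R) (C : R) (s : seq int).
Hypothesis k0 : forall p q, 0 <= k p q.
Hypothesis kNl : forall p q, k (- p) q = k p q.
Hypothesis kNr : forall p q, k p (- q) = k p q.
Hypothesis us : uniq s.

(** A Schur test: with n1, n2, n3 fixed, n4 is determined and n4 - n1 = -(n3 - n2), so the sum over
    n3 is the two-point sum of [k] around n1 and n2. *)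
Lemma quad_pair (f : int -> int -> R) : (forall n1 n2, 0 <= f n1 n2) ->
  (forall m1 m2, f m1 m2 != 0 -> \sum_(n <- s) k (n - m1) (n - m2) <= C) ->
  quad s (fun n1 n2 n3 n4 => f n1 n2 * k (n3 - n1) (n4 - n1)) <=
  C * \sum_(n1 <- s) \sum_(n2 <- s) f n1 n2.
Proof.
move=> f0 kC; rewrite mulr_sumr; apply: ler_sum => n1 _; rewrite mulr_sumr; apply: ler_sum => n2 _.
have [->|fn0] := eqVneq (f n1 n2) 0.
  by rewrite mulr0 big1// => n3 _; rewrite big1// => n4 _; rewrite mul0r.
rewrite mulrC; apply: le_trans (ler_wpM2l (f0 n1 n2) (kC n1 n2 fn0)); rewrite mulr_sumr.
apply: ler_sum => n3 _.
rewrite (eq_bigl (fun n4 => n4 == n1 + n2 - n3)); last first.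
  by move=> n4; rewrite [in RHS]eq_sym subr_eq [n4 + n3]addrC.
rewrite (eq_bigr (fun=> f n1 n2 * k (n3 - n1) (n3 - n2))); last first.
  move=> n4 /eqP->; rewrite -[in RHS]kNr; congr (_ * k _ _); ring.
by apply: sum_pred_le1 => //; rewrite mulr_ge0.
Qed.

(** On the constraint set n2 - n3 = n4 - n1, so exchanging the two pairs only changes the sign of
    one argument of [k]. *)
Lemma quad_pair34 (f : int -> int -> R) : (forall n1 n2, 0 <= f n1 n2) ->
  (forall m1 m2, f m1 m2 != 0 -> \sum_(n <- s) k (n - m1) (n - m2) <= C) ->
  quad s (fun n1 n2 n3 n4 => f n3 n4 * k (n3 - n1) (n4 - n1)) <=
  C * \sum_(n1 <- s) \sum_(n2 <- s) f n1 n2.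
Proof.
move=> f0 kC; rewrite quad_swap; apply: le_trans (quad_pair f0 kC).
apply: ler_quad => n1 n2 n3 n4 _ _ _ _ e.
rewrite -kNl opprB (_ : n2 - n3 = n4 - n1)//; lia.
Qed.

End Weight.

Definition prod4 x n1 n2 n3 n4 := x n1 * x n2 * x n3 * x n4.

Lemma prod4_amgm (l : R) x n1 n2 n3 n4 : 0 < l ->
  2 * prod4 x n1 n2 n3 n4 <= l^-1 * (x n1 * x n2) ^+ 2 + l * (x n3 * x n4) ^+ 2.
Proof.
move=> l0; rewrite /prod4 -mulrA -subr_ge0; set u := x n1 * x n2; set v := x n3 * x n4.
have -> : l^-1 * u ^+ 2 + l * v ^+ 2 - 2 * (u * v) = (u - l * v) ^+ 2 / l.
  by field; rewrite gt_eqF.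
by rewrite divr_ge0 ?sqr_ge0// ltW.
Qed.

Section Weight2.
Variables (k : int -> int -> R) (C : R) (s : seq int).
Hypothesis k0 : forall p q, 0 <= k p q.
Hypothesis kNl : forall p q, k (- p) q = k p q.
Hypothesis kNr : forall p q, k p (- q) = k p q.
Hypothesis kS : forall p q, k p q = k q p.
Hypothesis us : uniq s.
Hypothesis kC : forall m1 m2, \sum_(n <- s) k (n - m1) (n - m2) <= C.
Variable x : int -> R.
Hypothesis x0 : forall n, 0 <= x n.

Lemma quad_prod4_le :
  quad s (fun n1 n2 n3 n4 => prod4 x n1 n2 n3 n4 * k (n3 - n1) (n4 - n1)) <=
  C * mass s x ^+ 2.
Proof.
rewrite -(@ler_pM2l _ 2)// -quadZ.
have H1 := quad_pair k0 kNr us (fun n1 n2 => sqr_ge0 (x n1 * x n2)) (fun m1 m2 _ => kC m1 m2).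
have H2 := quad_pair34 k0 kNl kNr us (fun n1 n2 => sqr_ge0 (x n1 * x n2)) (fun m1 m2 _ => kC m1 m2).
rewrite massM in H1 H2.
apply: le_trans (_ : C * (mass s x * mass s x) + C * (mass s x * mass s x) <= _); last first.
  by rewrite expr2 mulrDl mul1r.
apply: le_trans (lerD H1 H2); rewrite -quadD; apply: ler_quad => n1 n2 n3 n4 _ _ _ _ e.
rewrite mulrA -mulrDl; apply: ler_wpM2r => //.
by have := prod4_amgm x n1 n2 n3 n4 (@ltr01 R); rewrite invr1 !mul1r.
Qed.

(** AM-GM between slots (1, 2) and (3, 4). Restricting slot 1 to [S] brings in the mass on [S],
    multiplied by l^-1; when that mass is of order l^2 the whole bound is of order l. *)
Lemma quad_slot (S : pred int) (l : R) : 0 < l ->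
  quad s (fun n1 n2 n3 n4 => (if S n1 then prod4 x n1 n2 n3 n4 else 0)
                               * k (n3 - n1) (n4 - n1)) <=
  C / 2 * (l^-1 * (mass s (fun n => if S n then x n else 0) * mass s x) + l * mass s x ^+ 2).
Proof.
move=> l0; rewrite -(@ler_pM2l _ 2)// -quadZ.
set y := fun n => if S n then x n else 0.
have H1 := quad_pair k0 kNr us (fun n1 n2 => sqr_ge0 (y n1 * x n2)) (fun m1 m2 _ => kC m1 m2).
have H2 := quad_pair34 k0 kNl kNr us (fun n1 n2 => sqr_ge0 (x n1 * x n2)) (fun m1 m2 _ => kC m1 m2).
rewrite !massM in H1 H2.
have -> : 2 * (C / 2 * (l^-1 * (mass s y * mass s x) + l * mass s x ^+ 2)) =
  l^-1 * (C * (mass s y * mass s x)) + l * (C * (mass s x * mass s x)) by field; rewrite gt_eqF.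
have li : 0 < l^-1 by rewrite invr_gt0.
have {}H1 := ler_wpM2l (ltW li) H1; have {}H2 := ler_wpM2l (ltW l0) H2; rewrite -!quadZ in H1 H2.
apply: le_trans (lerD H1 H2); rewrite -quadD; apply: ler_quad => n1 n2 n3 n4 _ _ _ _ e.
rewrite (mulrA 2) (mulrA l^-1) (mulrA l) -mulrDl; apply: ler_wpM2r => //; rewrite /y; case: ifP => _.
  exact: prod4_amgm.
by rewrite mulr0 addr_ge0// mulr_ge0 ?sqr_ge0// ltW.
Qed.

(** A union bound over the four slots: each slot is carried to the first one by a symmetry of the
    constraint set, and these symmetries preserve [k]. *)
Lemma quad_shell (S : pred int) (l : R) : 0 < l ->
  quad s (fun n1 n2 n3 n4 => (if [|| S n1, S n2, S n3 | S n4] then prod4 x n1 n2 n3 n4 else 0)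
                               * k (n3 - n1) (n4 - n1)) <=
  2 * C * (l^-1 * (mass s (fun n => if S n then x n else 0) * mass s x) + l * mass s x ^+ 2).
Proof.
move=> l0; have H := quad_slot S l0.
set F := fun n1 n2 n3 n4 => (if S n1 then prod4 x n1 n2 n3 n4 else 0) * k (n3 - n1) (n4 - n1).
rewrite -/F in H; set Z := (X in 2 * C * X); rewrite -/Z in H.
have -> : 2 * C * Z = C / 2 * Z + C / 2 * Z + (C / 2 * Z + C / 2 * Z) by field.
have flip : quad s (fun n1 n2 n3 n4 => F n2 n1 n3 n4) = quad s F.
  rewrite /quad exchange_big /=; do 3 (apply: eq_bigr => ? _); apply: eq_bigl => ?.
  by rewrite addrC.
have H' : quad s (fun n1 n2 n3 n4 => F n2 n1 n3 n4) <= C / 2 * Z by rewrite flip.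
have H3 : quad s (fun n1 n2 n3 n4 => F n3 n4 n1 n2) <= C / 2 * Z by rewrite -quad_swap.
have H4 : quad s (fun n1 n2 n3 n4 => F n4 n3 n1 n2) <= C / 2 * Z.
  by rewrite -(quad_swap s (fun n1 n2 n3 n4 => F n2 n1 n3 n4)).
apply: le_trans (lerD (lerD H H') (lerD H3 H4)); rewrite -!quadD.
apply: ler_quad => n1 n2 n3 n4 _ _ _ _ e; rewrite /F.
have P0 : 0 <= prod4 x n1 n2 n3 n4 by rewrite /prod4 !mulr_ge0.
have -> : prod4 x n2 n1 n3 n4 = prod4 x n1 n2 n3 n4 by rewrite /prod4; ring.
have -> : prod4 x n3 n4 n1 n2 = prod4 x n1 n2 n3 n4 by rewrite /prod4; ring.
have -> : prod4 x n4 n3 n1 n2 = prod4 x n1 n2 n3 n4 by rewrite /prod4; ring.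
have -> : k (n3 - n2) (n4 - n2) = k (n3 - n1) (n4 - n1).
  by rewrite -kNl -kNr !opprB kS; congr k; lia.
have -> : k (n1 - n3) (n2 - n3) = k (n3 - n1) (n4 - n1).
  by rewrite -kNl !opprB; congr k; lia.
have -> : k (n1 - n4) (n2 - n4) = k (n3 - n1) (n4 - n1).
  by rewrite -kNl !opprB kS; congr k; lia.
rewrite -!mulrDl; apply: ler_wpM2r => //; move: P0; set P := prod4 _ _ _ _ _.
by case: (S n1); case: (S n2); case: (S n3); case: (S n4) => /=; lra.
Qed.

End Weight2.
End Quad.

Section NormcFacts.
Variable R : rcfType.
Implicit Types z w : R[i].

Lemma normc_ge0 z : 0 <= normc z.
Proof. by case: z => a b; rewrite /normc sqrtr_ge0. Qed.

Lemma normc_conj z : normc z^* = normc z.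
Proof. by case: z => a b; rewrite /normc /= sqrrN. Qed.

Lemma sqr_normc_ReIm z : normc z ^+ 2 = complex.Re z ^+ 2 + complex.Im z ^+ 2.
Proof. by case: z => a b; rewrite /normc sqr_sqrtr// addr_ge0 ?sqr_ge0. Qed.

Lemma abs_Re_le z : `|complex.Re z| <= normc z.
Proof.
rewrite -ler_sqr ?nnegrE ?normc_ge0// sqr_normc_ReIm real_normK ?num_real//.
by rewrite lerDl sqr_ge0.
Qed.

Lemma abs_Im_le z : `|complex.Im z| <= normc z.
Proof.
rewrite -ler_sqr ?nnegrE ?normc_ge0// sqr_normc_ReIm real_normK ?num_real//.
by rewrite lerDr sqr_ge0.
Qed.

Lemma Re_mulJ z : complex.Re (z * z^*) = normc z ^+ 2.
Proof. by rewrite sqr_normc_ReIm; case: z => a b /=; ring. Qed.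

End NormcFacts.

Section QuadDiag.
Variables (V : nmodType) (s : seq int).
Hypothesis us : uniq s.

Lemma sum_pred1_seq n (F : int -> V) : n \in s -> \sum_(k <- s | k == n) F k = F n.
Proof.
move=> ns; rewrite big_mkcond (bigD1_seq n)//= eqxx big1 ?addr0// => k /negPf kn.
by rewrite kn.
Qed.

Lemma quad_diag3 (F : int -> int -> V) :
  quad s (fun n1 n2 n3 n4 => if n3 == n1 then F n1 n2 else 0) =
  \sum_(n1 <- s) \sum_(n2 <- s) F n1 n2.
Proof.
apply: eq_big_seq => n1 s1; apply: eq_big_seq => n2 s2.
rewrite (bigD1_seq n1)//= eqxx [X in _ + X]big1 ?addr0; last first.
  by move=> n3 /negPf ->; rewrite big1.
under eq_bigl do rewrite (inj_eq (addrI n1)) eq_sym.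
exact: sum_pred1_seq.
Qed.

Lemma quad_diag34 (F : int -> V) :
  quad s (fun n1 n2 n3 n4 => if (n3 == n1) && (n4 == n1) then F n1 else 0) =
  \sum_(n1 <- s) F n1.
Proof.
transitivity (quad s (fun n1 n2 n3 n4 => if n3 == n1 then (if n2 == n1 then F n1 else 0) else 0)).
  apply: eq_quad => n1 n2 n3 n4 _ _ _ _ e; case: eqVneq => //= e3.
  by rewrite -(inj_eq (addrI n3)) -e -e3 [n3 + n2 == _](inj_eq (addrI n3)).
rewrite quad_diag3; apply: eq_big_seq => n1 s1.
by rewrite -big_mkcond /=; exact: sum_pred1_seq.
Qed.

Lemma quad_flip34 (F : int -> int -> int -> int -> V) :
  quad s F = quad s (fun n1 n2 n3 n4 => F n1 n2 n4 n3).
Proof.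
rewrite /quad; do 2 (apply: eq_bigr => ? _).
under eq_bigr do rewrite big_mkcond; rewrite exchange_big /=.
by apply: eq_bigr => n4 _; rewrite [RHS]big_mkcond; apply: eq_bigr => n3 _; rewrite [n3 + _]addrC.
Qed.

End QuadDiag.

(** * Energy estimates: resonant part, spread-out sequences, distant blocks *)

Section Energy.
Variable R : rcfType.
Variable K : int -> R[i].
Variable b : R.
Hypothesis K0 : K 0 = 1.
Hypothesis b0 : 0 < b.
Hypothesis Kb : forall p q : int, p != 0 -> q != 0 -> normc (K (2 * (p * q))) <= b * invmul R p q.

Implicit Types (s : seq int) (a : int -> R[i]).

Definition qterm a n1 n2 n3 n4 : R :=
  complex.Re (a n1 * a n2 * (a n3 * a n4)^* * K (n1 ^+ 2 + n2 ^+ 2 - n3 ^+ 2 - n4 ^+ 2)).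

Definition wq s a := quad s (qterm a).

Definition nres s a := quad s (fun n1 n2 n3 n4 =>
  if (n3 == n1) || (n4 == n1) then 0 else qterm a n1 n2 n3 n4).

Definition md a n : R := normc (a n).
Definition mass4 s a : R := \sum_(n <- s) md a n ^+ 4.

Lemma md_ge0 a n : 0 <= md a n. Proof. exact: normc_ge0. Qed.

(** On the constraint set n1^2 + n2^2 - n3^2 - n4^2 = 2 (n3 - n1) (n4 - n1), so resonance means n3 =
    n1 or n4 = n1. Each case contributes the squared mass; inclusion-exclusion removes the overlap,
    where all four frequencies agree. *)
Lemma wqE s a : uniq s -> wq s a = 2 * mass s (md a) ^+ 2 - mass4 s a + nres s a.
Proof using K0.
clear b b0 Kb; move=> us.
pose c n1 n2 := (md a n1 * md a n2) ^+ 2.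
have e1 : quad s (fun n1 n2 n3 n4 => if n3 == n1 then c n1 n2 else 0) = mass s (md a) ^+ 2.
  by rewrite quad_diag3// expr2 -massM.
have e2 : quad s (fun n1 n2 n3 n4 => if n4 == n1 then c n1 n2 else 0) = mass s (md a) ^+ 2.
  by rewrite quad_flip34.
have e3 : quad s (fun n1 n2 n3 n4 => if (n3 == n1) && (n4 == n1) then c n1 n1 else 0) = mass4 s a.
  by rewrite (quad_diag34 us (fun n => c n n)); apply: eq_bigr => n _; rewrite /c -expr2 -exprM.
rewrite mulr_natl mulr2n -{1}e1 -e2 -e3 -quadN -!quadD; apply: eq_quad => n1 n2 n3 n4 _ _ _ _ e.
rewrite /qterm.
have [E3|N3] := eqVneq n3 n1; have [E4|N4] := eqVneq n4 n1 => /=.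
- have E2 : n2 = n1 by lia.
  by rewrite E2 E3 E4 /c addrK subrr K0 mulr1 Re_mulJ normcM addr0 addrK.
- have E2 : n2 = n4 by lia.
  have -> : n1 ^+ 2 + n2 ^+ 2 - n3 ^+ 2 - n4 ^+ 2 = 0 by rewrite E2 E3; ring.
  by rewrite K0 -E2 E3 mulr1 Re_mulJ normcM subr0 !addr0.
- have E2 : n2 = n3 by lia.
  have -> : n1 ^+ 2 + n2 ^+ 2 - n3 ^+ 2 - n4 ^+ 2 = 0 by rewrite E2 E4; ring.
  rewrite K0 -E2 E4 mulr1 [a n2 * a n1]mulrC Re_mulJ normcM subr0 addr0 add0r//.
- by rewrite subr0 !add0r.
Qed.

Lemma qterm_le a n1 n2 n3 n4 : n1 + n2 = n3 + n4 -> n3 != n1 -> n4 != n1 ->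
  `|qterm a n1 n2 n3 n4| <= b * (prod4 (md a) n1 n2 n3 n4 * invmul R (n3 - n1) (n4 - n1)).
Proof.
move=> e N3 N4; apply: le_trans (abs_Re_le _) _; rewrite !normcM normc_conj normcM.
have -> : n1 ^+ 2 + n2 ^+ 2 - n3 ^+ 2 - n4 ^+ 2 = 2 * ((n3 - n1) * (n4 - n1)).
  have -> : n2 = n3 + n4 - n1 by lia.
  ring.
set k := normc (K _); rewrite (_ : _ * k = prod4 (md a) n1 n2 n3 n4 * k); last first.
  by rewrite /prod4 /md !mulrA.
by rewrite mulrCA ler_wpM2l ?Kb ?subr_eq0// /prod4 !mulr_ge0 ?md_ge0.
Qed.

Let k0 p q : 0 <= invmul R p q := invmul_ge0 R p q.
Let kNl p q : invmul R (- p) q = invmul R p q := invmulN R p q.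
Let kNr p q : invmul R p (- q) = invmul R p q := invmulNr R p q.
Let kS p q : invmul R p q = invmul R q p := invmulC R p q.

Let offd a n1 n2 n3 n4 : R := if (n3 == n1) || (n4 == n1) then 0 else qterm a n1 n2 n3 n4.

Let P0 a n1 n2 n3 n4 : 0 <= prod4 (md a) n1 n2 n3 n4.
Proof. by rewrite /prod4 !mulr_ge0 ?md_ge0. Qed.

Lemma offd_le a n1 n2 n3 n4 : n1 + n2 = n3 + n4 ->
  `|offd a n1 n2 n3 n4| <= b * (prod4 (md a) n1 n2 n3 n4 * invmul R (n3 - n1) (n4 - n1)).
Proof.
move=> e; rewrite /offd; case: eqVneq => [|n3n1] /=.
  by rewrite normr0 mulr_ge0 ?(ltW b0)// mulr_ge0.
case: eqVneq => [|n4n1] /=; first by rewrite normr0 mulr_ge0 ?(ltW b0)// mulr_ge0.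
exact: qterm_le.
Qed.

Lemma nres_le s a : uniq s -> nres s a <= b * (4 * mass s (md a) ^+ 2).
Proof.
move=> us; have H := quad_prod4_le k0 kNl kNr us (fun m1 m2 => sum_invmul R m1 m2 us) (md a).
apply: le_trans (ler_wpM2l (ltW b0) H); rewrite -quadZ.
by apply: ler_quad => n1 n2 n3 n4 _ _ _ _ e; apply: le_trans (ler_norm _) (offd_le _ e).
Qed.

Lemma mass4_ge0 s a : 0 <= mass4 s a.
Proof. by apply: sumr_ge0 => n _; rewrite exprn_even_ge0. Qed.

Lemma wq_le s a : uniq s -> wq s a <= (2 + 4 * b) * mass s (md a) ^+ 2.
Proof.
move=> us; rewrite wqE//; have := nres_le a us; have := mass4_ge0 s a.
rewrite !mulrDl; lra.
Qed.

Let kfar D p q : R := if far D p q then invmul R p q else 0.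
Let kfar0 D p q : 0 <= kfar D p q. Proof. by rewrite /kfar; case: ifP. Qed.
Let kfarNl D p q : kfar D (- p) q = kfar D p q. Proof. by rewrite /kfar /far abszN kNl. Qed.
Let kfarNr D p q : kfar D p (- q) = kfar D p q. Proof. by rewrite /kfar /far abszN kNr. Qed.

(** Either a difference n3 - n1 or n4 - n1 has size at least E^2, and the far sum gives 8 / E; or
    |n1 - n2| and |n3 - n4| are both below 2 E^2, and the pair sums live on a strip around the
    diagonal, where one of the two squared factors is at most eta^2. *)
Lemma nres_vanish s a (E : nat) (eta : R) : uniq s -> (0 < E)%N ->
  (forall n, n \in s -> md a n <= eta) ->
  nres s a <= b * (8 / E%:R * mass s (md a) ^+ 2
    + 4 * (eta ^+ 2 * (1 + 16 * (E ^ 4)%:R) * mass s (md a))).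
Proof.
move=> us E0 aeta; have D0 : (0 < E ^ 2)%N by rewrite expn_gt0 E0.
have H := quad_prod4_le (@kfar0 (E ^ 2)%N) (@kfarNl (E ^ 2)%N) (@kfarNr (E ^ 2)%N) us
  (fun m1 m2 => sum_invmul_far R m1 m2 E0 us) (md a).
pose K2 := (2 * E ^ 2)%N.
pose f n1 n2 := if (`|n1 - n2| < K2)%N then (md a n1 * md a n2) ^+ 2 else 0.
have f0 n1 n2 : 0 <= f n1 n2 by rewrite /f; case: ifP => // _; rewrite sqr_ge0.
have H1 := quad_pair k0 kNr us f0 (fun m1 m2 _ => sum_invmul R m1 m2 us).
have H2 := quad_pair34 k0 kNl kNr us f0 (fun m1 m2 _ => sum_invmul R m1 m2 us).
have Hf : \sum_(n1 <- s) \sum_(n2 <- s) f n1 n2 <= eta ^+ 2 * (1 + 16 * (E ^ 4)%:R) * mass s (md a).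
  rewrite mulr_sumr big_seq [leRHS]big_seq; apply: ler_sum => n1 s1.
  (* A crude count of the strip: n2 = n1 gives the 1, and for 0 < |n2 - n1| < [K2] one has 1 <= K2^2
     / (n2 - n1)^2, whose sum is at most 4 K2^2 = 16 E^4. *)
  apply: (@le_trans _ _ (\sum_(n2 <- s) (md a n1 ^+ 2 * eta ^+ 2) *
      ((if n2 == n1 then 1 else 0) + K2%:R ^+ 2 * invsq R 1 (n2 - n1)))).
    rewrite big_seq [leRHS]big_seq; apply: ler_sum => n2 s2; rewrite /f exprMn.
    have k20 : 0 <= (if n2 == n1 then 1 else 0) + K2%:R ^+ 2 * invsq R 1 (n2 - n1).
      by rewrite addr_ge0 ?mulr_ge0 ?sqr_ge0 ?invsq_ge0//; case: ifP.
    have me2 : md a n2 ^+ 2 <= eta ^+ 2 by rewrite lerXn2r ?nnegrE ?md_ge0 ?aeta// (le_trans (md_ge0 a n2)) ?aeta.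
    case: ifP => nn; last by rewrite mulr_ge0// mulr_ge0 ?sqr_ge0.
    apply: (@le_trans _ _ (md a n1 ^+ 2 * eta ^+ 2)); first by rewrite ler_wpM2l ?sqr_ge0.
    apply: ler_peMr; first by rewrite mulr_ge0 ?sqr_ge0.
    have [_|n21] := eqVneq n2 n1.
      by rewrite lerDl mulr_ge0 ?sqr_ge0 ?invsq_ge0.
    rewrite add0r /invsq absz_gt0 subr_eq0 n21 ler_pdivlMr ?exprn_even_gt0 ?intr_eq0 ?subr_eq0//.
    rewrite mul1r (pmulrn 1 K2) -!rmorphXn /= ler_int.
    by clear -nn; nia.
  rewrite -mulr_sumr big_split /= -mulr_sumr.
  have h1 := sum_invsq R n1 (ltn0Sn 0) us.
  rewrite -big_mkcond /= sum_pred1_seq//.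
  rewrite [leRHS]mulrC -mulrA ler_wpM2l ?sqr_ge0// ler_wpM2l ?sqr_ge0// lerD2l.
  apply: le_trans (ler_wpM2l (sqr_ge0 _) h1) _; rewrite /K2 natrM !natrX; lra.
apply: (@le_trans _ _ (b * (quad s (fun n1 n2 n3 n4 => prod4 (md a) n1 n2 n3 n4 * kfar (E ^ 2) (n3 - n1) (n4 - n1))
  + (1/2) * (quad s (fun n1 n2 n3 n4 => f n1 n2 * invmul R (n3 - n1) (n4 - n1)) +
     quad s (fun n1 n2 n3 n4 => f n3 n4 * invmul R (n3 - n1) (n4 - n1)))))); last first.
  rewrite ler_wpM2l ?(ltW b0)// lerD//; lra.
rewrite -quadD -quadZ -quadD -quadZ; apply: ler_quad => n1 n2 n3 n4 _ _ _ _ e.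
apply: le_trans (ler_norm _) (le_trans (offd_le _ e) _); rewrite ler_wpM2l ?(ltW b0)//.
rewrite /kfar; case: ifP => ff.
  by rewrite lerDl mulr_ge0 ?divr_ge0// addr_ge0// mulr_ge0.
rewrite mulr0 add0r -mulrDl mulrA ler_wpM2r//.
have g1 : (`|n1 - n2| < K2)%N by move: ff; rewrite /far /K2; lia.
have g2 : (`|n3 - n4| < K2)%N by move: ff; rewrite /far /K2; lia.
rewrite /f g1 g2; have := prod4_amgm (md a) n1 n2 n3 n4 (@ltr01 R); rewrite invr1; lra.
Qed.

Definition low (M : nat) (n : int) := (`|n| <= M)%N.
Definition high (L : nat) (n : int) := (L < `|n|)%N.
Definition cut (S : pred int) a n : R[i] := if S n then a n else 0.

Lemma md_cut S a n : md (cut S a) n = if S n then md a n else 0.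
Proof. by rewrite /md /cut; case: ifP => // _; rewrite normc0. Qed.

Lemma qterm_cut S a n1 n2 n3 n4 : qterm (cut S a) n1 n2 n3 n4 =
  if [&& S n1, S n2, S n3 & S n4] then qterm a n1 n2 n3 n4 else 0.
Proof.
rewrite /qterm /cut; case: (S n1); cbv iota; last by rewrite !mul0r.
case: (S n2); cbv iota; last by rewrite mulr0 !mul0r.
case: (S n3); cbv iota; last by rewrite mul0r rmorph0 mulr0 mul0r.
by case: (S n4); cbv iota; rewrite // mulr0 rmorph0 mulr0 mul0r.
Qed.

(** A quadruple that avoids the shell but mixes low and high frequencies is far: a low and a high
    frequency differ by more than L - M >= E^2, and since n3 - n1 = n2 - n4, any mixture makes n3 -
    n1 or n4 - n1 such a difference. What remains is all low, all high, or meets the shell. *)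
Lemma nres_split s a (M L E : nat) (l : R) : uniq s -> (0 < E)%N -> 0 < l ->
  (3 * M + E ^ 2 <= L)%N ->
  nres s a <= nres s (cut (low M) a) + nres s (cut (high L) a) +
    b * (8 * (l^-1 * (mass s (md (cut (fun n => ~~ low M n && ~~ high L n) a)) * mass s (md a))
         + l * mass s (md a) ^+ 2) + 8 / E%:R * mass s (md a) ^+ 2).
Proof.
move=> us E0 l0 ML.
have H := quad_prod4_le (@kfar0 (E ^ 2)%N) (@kfarNl (E ^ 2)%N) (@kfarNr (E ^ 2)%N) us
  (fun m1 m2 => sum_invmul_far R m1 m2 E0 us) (md a).
set S := fun n => ~~ low M n && ~~ high L n.
have H2 := quad_shell k0 kNl kNr kS us (fun m1 m2 => sum_invmul R m1 m2 us) (md_ge0 a) S l0.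
have -> : mass s (md (cut S a)) = mass s (fun n => if S n then md a n else 0).
  by apply: eq_bigr => n _; rewrite md_cut.
have e8 : 8 = 2 * 4 :> R by rewrite -natrM.
rewrite e8 in H *.
apply: le_trans (lerD (lexx (nres s (cut (low M) a) + nres s (cut (high L) a)))
  (ler_wpM2l (ltW b0) (lerD H2 H))).
rewrite -[X in b * X]quadD -quadZ /nres -!quadD; apply: ler_quad => n1 n2 n3 n4 _ _ _ _ e.
rewrite !qterm_cut.
have O := le_trans (ler_norm _) (offd_le a e); rewrite /offd in O.
set T := prod4 _ _ _ _ _ in O *; have T0 : 0 <= T := P0 a n1 n2 n3 n4.
have w0 := k0 (n3 - n1) (n4 - n1); set w := invmul _ _ _ in O w0 *.
have fa0 := @kfar0 (E ^ 2)%N (n3 - n1) (n4 - n1).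
have rhs0 : 0 <= b * ((if [|| S n1, S n2, S n3 | S n4] then T else 0) * w + T * kfar (E ^ 2) (n3 - n1) (n4 - n1)).
  by rewrite mulr_ge0 ?(ltW b0)// addr_ge0// mulr_ge0//; case: ifP.
case: ifP O => [_ _|dd O]; first by rewrite !add0r.
case: ifP => [lo|nlo].
  case: ifP => [hi|_]; first by clear -lo hi ML; move: lo hi; rewrite /low /high; lia.
  by rewrite addr0 lerDl.
case: ifP => [hi|nhi]; first by rewrite add0r lerDl.
rewrite !add0r; apply: le_trans O _; rewrite ler_wpM2l ?(ltW b0)//.
case: ifP => sh; first by rewrite lerDl mulr_ge0.
rewrite mul0r add0r /kfar; case: ifP => // fa; exfalso.
by clear -nlo nhi sh fa e dd ML; move: nlo nhi sh fa; rewrite /S /low /high /far; lia.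
Qed.

End Energy.

Lemma eq_sum_supp (V : nmodType) (I : eqType) (s t : seq I) (F : I -> V) :
  uniq s -> uniq t ->
  (forall i, i \notin s -> F i = 0) -> (forall i, i \notin t -> F i = 0) ->
  \sum_(i <- s) F i = \sum_(i <- t) F i.
Proof.
move=> us ut Fs Ft.
have H r : uniq r -> (forall i, i \notin r -> F i = 0) -> forall r', uniq r' ->
   (forall i, i \notin r' -> F i = 0) -> \sum_(i <- r) F i = \sum_(i <- r | i \in r') F i.
  move=> ur _ r' _ F'; rewrite (bigID (mem r')) /= [X in _ + X]big1 ?addr0//.
rewrite (H s us Fs t ut Ft) (H t ut Ft s us Fs) -big_filter -[RHS]big_filter.
apply: perm_big; apply: uniq_perm; rewrite ?filter_uniq// => i.
by rewrite !mem_filter andbC.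
Qed.

Lemma eq_quad_supp (V : nmodType) (s t : seq int) (F : int -> int -> int -> int -> V) :
  uniq s -> uniq t ->
  (forall n1 n2 n3 n4, ~~ [&& n1 \in s, n2 \in s, n3 \in s & n4 \in s] -> F n1 n2 n3 n4 = 0) ->
  (forall n1 n2 n3 n4, ~~ [&& n1 \in t, n2 \in t, n3 \in t & n4 \in t] -> F n1 n2 n3 n4 = 0) ->
  quad s F = quad t F.
Proof.
move=> us ut Fs Ft; rewrite /quad.
have key (r : seq int) :
  (forall n1 n2 n3 n4, ~~ [&& n1 \in r, n2 \in r, n3 \in r & n4 \in r] -> F n1 n2 n3 n4 = 0) ->
  forall n1, n1 \notin r -> forall a b c, [/\ F n1 a b c = 0, F a n1 b c = 0, F a b n1 c = 0 & F a b c n1 = 0].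
  by move=> Fr n1 n1r a b c; split; apply: Fr; rewrite (negPf n1r) ?andbF.
have ks := key s Fs; have kt := key t Ft.
rewrite (eq_sum_supp us ut); first last.
- by move=> i /kt H; rewrite big1// => x _; rewrite big1// => y _; rewrite big1// => z _; case: (H x y z).
- by move=> i /ks H; rewrite big1// => x _; rewrite big1// => y _; rewrite big1// => z _; case: (H x y z).
apply: eq_bigr => n1 _; rewrite (eq_sum_supp us ut); first last.
- by move=> i /kt H; rewrite big1// => x _; rewrite big1// => y _; case: (H n1 x y).
- by move=> i /ks H; rewrite big1// => x _; rewrite big1// => y _; case: (H n1 x y).
apply: eq_bigr => n2 _; rewrite (eq_sum_supp us ut); first last.
- by move=> i /kt H; rewrite big1// => x _; case: (H n1 n2 x).
- by move=> i /ks H; rewrite big1// => x _; case: (H n1 n2 x).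
apply: eq_bigr => n3 _; rewrite big_mkcond [RHS]big_mkcond; apply: eq_sum_supp => //.
- by move=> i /ks H; case: ifP => // _; case: (H n1 n2 n3).
- by move=> i /kt H; case: ifP => // _; case: (H n1 n2 n3).
Qed.

Section EnergyFacts.
Variable R : rcfType.
Implicit Types (s t : seq int) (a : int -> R[i]).

Lemma massZ s (c : R) a : mass s (md (fun n => c%:C * a n)) = c ^+ 2 * mass s (md a).
Proof.
rewrite /mass mulr_sumr; apply: eq_bigr => n _; rewrite /md normcM exprMn.
by rewrite [in LHS]sqr_normc_ReIm /= expr0n addr0.
Qed.

Lemma mass_supp s t a : uniq s -> uniq t ->
  (forall n, n \notin s -> a n = 0) -> (forall n, n \notin t -> a n = 0) ->
  mass s (md a) = mass t (md a).
Proof.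
move=> us ut as_ at_; apply: eq_sum_supp => // n; [move=> /as_|move=> /at_] => H.
  by rewrite /md H normc0 expr0n.
by rewrite /md H normc0 expr0n.
Qed.

Variable K : int -> R[i].

Lemma wqZ s (c : R) a : wq K s (fun n => c%:C * a n) = c ^+ 4 * wq K s a.
Proof.
rewrite /wq -quadZ; apply: eq_quad => n1 n2 n3 n4 _ _ _ _ _; rewrite /qterm.
set k := K _; have -> : (c%:C * a n1 * (c%:C * a n2) * (c%:C * a n3 * (c%:C * a n4))^* * k) =
   (c ^+ 4)%:C * (a n1 * a n2 * (a n3 * a n4)^* * k).
  have cc : Num.conj (c%:C : R[i]) = c%:C by rewrite -[LHS]/(conjc _) /= oppr0.
  have cM z w : Num.conj (z * w : R[i]) = Num.conj z * Num.conj w by exact: rmorphM.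
  by rewrite !cM cc rmorphXn; ring.
by case: (a n1 * _ * _ * _) => x y /=; rewrite mul0r subr0.
Qed.

(** Galilean invariance: a shift by [c] changes n1^2 + n2^2 - n3^2 - n4^2 by 2 c (n1 + n2 - n3 - n4)
    = 0. *)
Lemma wq_map_addr s c a : wq K [seq n + c | n <- s] a = wq K s (fun n => a (n + c)).
Proof.
rewrite /wq quad_map_addr; apply: eq_quad => n1 n2 n3 n4 _ _ _ _ e; rewrite /qterm.
congr (complex.Re (_ * K _)); have -> : n1 = n3 + n4 - n2 by lia.
ring.
Qed.

Lemma wq_supp s t a : uniq s -> uniq t ->
  (forall n, n \notin s -> a n = 0) -> (forall n, n \notin t -> a n = 0) ->
  wq K s a = wq K t a.
Proof.
move=> us ut as_ at_; apply: eq_quad_supp => // n1 n2 n3 n4; rewrite !negb_and.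
  by case/or4P => /as_; rewrite /qterm => ->; rewrite ?(mul0r, mulr0, rmorph0).
by case/or4P => /at_; rewrite /qterm => ->; rewrite ?(mul0r, mulr0, rmorph0).
Qed.

Lemma eq_wq s a a' : (forall n, n \in s -> a n = a' n) -> wq K s a = wq K s a'.
Proof.
move=> aa; apply: eq_quad => n1 n2 n3 n4 s1 s2 s3 s4 _.
by rewrite /qterm !aa.
Qed.

Variable b : R.
Hypothesis K0 : K 0 = 1.
Hypothesis b0 : 0 < b.
Hypothesis Kb : forall p q : int, p != 0 -> q != 0 -> normc (K (2 * (p * q))) <= b * invmul R p q.

Lemma mass_low_high s a M L : (M <= L)%N ->
  mass s (md a) = mass s (md (cut (low M) a)) + mass s (md (cut (high L) a)) +
   mass s (md (cut (fun n => ~~ low M n && ~~ high L n) a)).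
Proof.
move=> ML; rewrite /mass -!big_split /=; apply: eq_bigr => n _; rewrite !md_cut.
case lo : (low M n); case hi : (high L n) => /=; rewrite ?expr0n ?addr0 ?add0r//.
by clear -lo hi ML; move: lo hi; rewrite /low /high; lia.
Qed.

(** The blocks interact mainly through the resonant term: 2 (al + be + sg)^2 exceeds 2 al^2 + 2 be^2
    by 4 al be plus 2 sg (sg + 2 al + 2 be), which is at most 4 sg because the total mass is at most
    1. The sum [mass4] dominates its values on the two blocks. *)
Lemma wq_split s a (M L E : nat) (l : R) : uniq s -> (0 < E)%N -> 0 < l ->
  (3 * M + E ^ 2 <= L)%N -> mass s (md a) <= 1 ->
  let al := mass s (md (cut (low M) a)) in
  let be := mass s (md (cut (high L) a)) in
  let sg := mass s (md (cut (fun n => ~~ low M n && ~~ high L n) a)) in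
  is_true (wq K s a <= wq K s (cut (low M) a) + wq K s (cut (high L) a) + 4 * (al * be) + 4 * sg
    + b * (8 * (l^-1 * sg + l) + 8 / E%:R)).
Proof.
move=> us E0 l0 ML m1 al be sg.
have ML' : (M <= L)%N by lia.
have mE := mass_low_high s a ML'; rewrite -/al -/be -/sg in mE.
have al0 : 0 <= al := mass_ge0 _ _; have be0 : 0 <= be := mass_ge0 _ _; have sg0 : 0 <= sg := mass_ge0 _ _.
have m0 := mass_ge0 s (md a).
have N := nres_split b0 Kb a us E0 l0 ML; rewrite -/sg in N.
have N' : b * (8 * (l^-1 * (sg * mass s (md a)) + l * mass s (md a) ^+ 2) + 8 / E%:R * mass s (md a) ^+ 2)
  <= b * (8 * (l^-1 * sg + l) + 8 / E%:R).
  have m2 : mass s (md a) ^+ 2 <= 1 by rewrite expr_le1.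
  rewrite ler_wpM2l ?(ltW b0)// lerD ?ler_piMr ?divr_ge0//.
  rewrite ler_wpM2l// lerD ?ler_piMr ?(ltW l0)//.
  by rewrite ler_wpM2l ?invr_ge0 ?(ltW l0)// ler_piMr.
have M4 : mass4 s (cut (low M) a) + mass4 s (cut (high L) a) <= mass4 s a.
  rewrite -big_split /=; apply: ler_sum => n _; rewrite !md_cut.
  have x0 : 0 <= md a n ^+ 4 by rewrite exprn_ge0 ?md_ge0.
  case lo : (low M n); case hi : (high L n) => /=; rewrite ?expr0n ?addr0 ?add0r//.
  by clear -lo hi ML; move: lo hi; rewrite /low /high; lia.
rewrite !(wqE K0)// -/al -/be.
have Q : 2 * mass s (md a) ^+ 2 <= 2 * al ^+ 2 + 2 * be ^+ 2 + 4 * (al * be) + 4 * sg.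
  rewrite mE in m1 *.
  have : sg * (sg + 2 * al + 2 * be) <= sg * 2 by rewrite ler_wpM2l//; lra.
  lra.
lra.
Qed.

End EnergyFacts.

(** * Compactness of maximizing sequences *)

Definition window (M : nat) : seq int := [seq i%:Z - M%:Z | i <- iota 0 (2 * M).+1].

Lemma window_uniq M : uniq (window M).
Proof. by rewrite map_inj_uniq ?iota_uniq// => i j /addIr[]. Qed.

Lemma mem_window M n : (n \in window M) = (`|n| <= M)%N.
Proof.
apply/mapP/idP => [[k]|nM]; first by rewrite mem_iota => ? ->; lia.
exists (absz (n + M%:Z)); first by rewrite mem_iota; lia.
by lia.
Qed.

(** Along one ultrafilter every bounded sequence converges, so all coefficients of a maximizing
    sequence converge at once; this takes the place of a diagonal extraction. *)
Lemma ultra_bounded_cvg (R : realType) (U : set_system nat) (f : nat -> R) (C : R) :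
  UltraFilter U -> (forall k, `|f k| <= C) -> exists l : R, f @ U --> l.
Proof.
move=> UU fC; have FF : ProperFilter (f @ U) by apply: fmap_proper_filter.
have := @segment_compact R (- C) C (f @ U) FF.
case; first by apply: (@filterE _ U) => k; rewrite /= in_itv /= -ler_norml.
move=> l [_ cl]; exists l => V Vl; rewrite /nbhs /=.
have [//|nV] := in_ultra_setVsetC (f @^-1` V) UU.
have [x [xn xV]] := cl (~` V) V nV Vl.
by case: xn.
Qed.

Section ComplexCvg.
Variables (R : realType) (U : set_system nat).
Hypothesis FU : Filter U.

Definition ccvg (u : nat -> R[i]) (l : R[i]) :=
  (fun k => complex.Re (u k)) @ U --> complex.Re l /\
  (fun k => complex.Im (u k)) @ U --> complex.Im l.

Lemma ccvg_cst c : ccvg (fun=> c) c.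
Proof. by split; exact: cvg_cst. Qed.

Lemma ccvgM u v l m : ccvg u l -> ccvg v m -> ccvg (fun k => u k * v k) (l * m).
Proof.
have ReM (z w : R[i]) : complex.Re (z * w) = complex.Re z * complex.Re w - complex.Im z * complex.Im w.
  by case: z w => ? ? [].
have ImM (z w : R[i]) : complex.Im (z * w) = complex.Re z * complex.Im w + complex.Im z * complex.Re w.
  by case: z w => ? ? [].
move=> [ur ui] [vr vi]; split.
  under eq_fun do rewrite ReM; rewrite ReM; apply: cvgB; exact: cvgM.
under eq_fun do rewrite ImM; rewrite ImM; apply: cvgD; exact: cvgM.
Qed.

Lemma ccvgJ u l : ccvg u l -> ccvg (fun k => Num.conj (u k)) (Num.conj l).
Proof.
move=> [ur ui]; have e (z : R[i]) : Num.conj z = complex.Re z +i* - complex.Im z by case: z.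
split; under eq_fun do rewrite e /=; rewrite e /=; [exact: ur | exact: cvgN].
Qed.

Lemma cvg_normc2 u l : ccvg u l -> (fun k => normc (u k) ^+ 2) @ U --> normc l ^+ 2.
Proof.
move=> [ur ui]; under eq_fun do rewrite sqr_normc_ReIm; rewrite sqr_normc_ReIm.
by apply: cvgD; rewrite expr2; under eq_fun do rewrite expr2; exact: cvgM.
Qed.

Lemma cvg_sum_seq (I : Type) (s : seq I) (P : pred I) (F : I -> nat -> R) (l : I -> R) :
  (forall i, F i @ U --> l i) ->
  (fun k => \sum_(i <- s | P i) F i k) @ U --> \sum_(i <- s | P i) l i.
Proof.
move=> Fl; elim: s => [|i s IH].
  under eq_fun do rewrite big_nil; rewrite big_nil; exact: cvg_cst.
under eq_fun do rewrite big_cons; rewrite big_cons; case: ifP => // _.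
exact: cvgD.
Qed.

Variables (K : int -> R[i]) (a : nat -> int -> R[i]) (al : int -> R[i]).
Hypothesis a_al : forall n, ccvg (fun k => a k n) (al n).

Lemma cvg_mass s : (fun k => mass s (md (a k))) @ U --> mass s (md al).
Proof. by apply: cvg_sum_seq => n; exact: cvg_normc2. Qed.

Lemma cvg_wq s : (fun k => wq K s (a k)) @ U --> wq K s al.
Proof.
apply: cvg_sum_seq => n1; apply: cvg_sum_seq => n2; apply: cvg_sum_seq => n3.
apply: cvg_sum_seq => n4; rewrite /qterm; set k := K _.
suff [] : ccvg (fun k0 => a k0 n1 * a k0 n2 * (a k0 n3 * a k0 n4)^* * k)
   (al n1 * al n2 * (al n3 * al n4)^* * k) by [].
apply: ccvgM; last exact: ccvg_cst.
apply: ccvgM; first exact: ccvgM.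
by apply: ccvgJ; exact: ccvgM.
Qed.

End ComplexCvg.

(* The bookkeeping of the splitting argument: [x], [y], [z] are the masses of the low block, the high
   block and the shell between them, [wA], [wB] the energies of the two blocks. *)
Lemma mass_concentration (R : realFieldType) (j b eta ep x y z w wA wB WA e t q : R) :
  let D := (2 * j - 4) * eta ^+ 2 in let cc := 9 + 32 * b in
  2 < j -> 0 < b -> 0 < eta -> 0 < ep -> ep <= 1 -> 0 <= z -> 0 <= y -> 0 <= x ->
  x + y + z = 1 -> z < 2 * ep ^+ 2 -> eta ^+ 2 <= x ->
  wA <= j * x ^+ 2 -> wB <= j * y ^+ 2 -> q <= 8 * ep ->
  w <= wA + wB + 4 * (x * y) + 4 * z + b * (8 * (ep^-1 * z + ep) + q) ->
  j - t < w -> t < ep -> wA < WA + ep ->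
  (cc + (j + 4) * (cc / D) + 1) * ep <= e -> j - e <= WA.
Proof.
move=> D cc j2 b0 eta0 ep0 ep1 z0 y0 x0 xyz1 hz xeta hA hB hq hw2 hw hk hWA epe.
have D0 : 0 < D by rewrite mulr_gt0 ?exprn_gt0//; lra.
have err : 4 * z + b * (8 * (ep^-1 * z + ep) + q) <= (8 + 32 * b) * ep.
  have z1 : ep^-1 * z <= 2 * ep.
    by rewrite mulrC ler_pdivrMr// -mulrA -expr2 ltW.
  have z2 : z <= 2 * ep.
    by apply: le_trans (ltW hz) _; rewrite ler_wpM2l// expr2 ler_piMl// ltW.
  have : b * (8 * (ep^-1 * z + ep) + q) <= b * (32 * ep).
    by rewrite ler_wpM2l ?(ltW b0)//; lra.
  lra.
have hxy : (2 * j - 4) * (x * y) <= cc * ep.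
  have sq : x ^+ 2 + y ^+ 2 <= 1 - 2 * (x * y).
    have : (x + y) ^+ 2 <= 1 by rewrite expr_le1// ?addr_ge0//; lra.
    lra.
  have : j * (x ^+ 2 + y ^+ 2) <= j * (1 - 2 * (x * y)).
    by rewrite ler_wpM2l//; move: j2; lra.
  rewrite /cc; lra.
have hy : y <= cc / D * ep.
  rewrite mulrAC ler_pdivlMr// /D mulrCA; apply: le_trans hxy.
  rewrite ler_wpM2l//; first by move: j2; lra.
  by rewrite [leRHS]mulrC ler_wpM2l.
have y1 : y <= 1 by lra.
have hy2 : j * y ^+ 2 + 4 * (x * y) <= (j + 4) * y.
  have a1 : j * y ^+ 2 <= j * y by rewrite ler_wpM2l// ?expr2 ?ler_piMl//; move: j2; lra.
  have a2 : x * y <= y by rewrite ler_piMl//; lra.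
  lra.
have hy3 : (j + 4) * y <= (j + 4) * (cc / D * ep).
  by rewrite ler_wpM2l//; move: j2; lra.
have : cc * ep + (j + 4) * (cc / D * ep) + ep <= e by move: epe; rewrite mulrDl mulrDl mul1r -(mulrA (j + 4)).
move: hy3; set X := (j + 4) * (cc / D * ep); rewrite /cc; lra.
Qed.

Section Maximizer.
Variables (R : realType) (K : int -> R[i]) (b : R).
Hypothesis K0 : K 0 = 1.
Hypothesis b0 : 0 < b.
Hypothesis Kb : forall p q : int, p != 0 -> q != 0 -> normc (K (2 * (p * q))) <= b * invmul R p q.

Definition wq_vals : set R := [set r | exists (s : seq int) (a : int -> R[i]), [/\ uniq s, mass s (md a) = 1 & r = wq K s a]].

Definition wq_sup : R := sup wq_vals.

Lemma has_sup_wq : has_sup wq_vals.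
Proof.
split.
  exists (wq K [:: 0] (fun=> 1)), [:: 0], (fun=> 1); split=> //.
  by rewrite /mass big_seq1 /md normc1 expr1n.
exists (2 + 4 * b) => r [s [a [us m1 ->]]].
by have := wq_le K0 b0 Kb a us; rewrite m1 expr1n mulr1.
Qed.

Lemma wq_le_sup s a : uniq s -> wq K s a <= wq_sup * mass s (md a) ^+ 2.
Proof.
move=> us; have m0 := mass_ge0 s (md a); set m := mass s (md a) in m0 *.
have [mE|mN] := eqVneq m 0.
  by have := wq_le K0 b0 Kb a us; rewrite -/m mE expr0n /= !mulr0.
have mp : 0 < m by rewrite lt_neqAle eq_sym mN.
pose c := (Num.sqrt m)^-1.
have c2 : c ^+ 2 = m^-1 by rewrite exprVn sqr_sqrtr.
have c4 : c ^+ 4 = m^-1 ^+ 2 by rewrite -c2 -exprM.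
have H : m^-1 ^+ 2 * wq K s a <= wq_sup.
  apply: sup_upper_bound; first exact: has_sup_wq.
  exists s, (fun n => c%:C * a n); split => //; last by rewrite wqZ c4.
  by rewrite massZ c2 mulVf.
by rewrite -ler_pdivrMr ?exprn_gt0// mulrC -exprVn.
Qed.

Hypothesis sup_gt2 : 2 < wq_sup.
Local Notation j := wq_sup.

(** Put d = (j - 2) / 2, so that (j + 2) / 2 = 2 + d. If all moduli are at most eta, the energy is
    at most 2 plus the bound of [nres_vanish]: [E] makes its far part at most d / 2, and then [eta2]
    makes its near part equal to d / 2. *)
Lemma near_max_peak : exists2 eta : R, 0 < eta & forall s a, uniq s -> mass s (md a) = 1 ->
  (j + 2) / 2 < wq K s a -> exists2 n, n \in s & eta < md a n.
Proof.
pose d := (j - 2) / 2; have d0 : 0 < d by rewrite /d divr_gt0 ?subr_gt0.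
pose E := (Num.truncn (16 * b / d)).+1.
have E0 : 16 * b / d < E%:R by rewrite /E truncnS_gt.
have hE : b * (8 / E%:R) <= d / 2.
  rewrite mulrA ler_pdivrMr; last by rewrite (lt_trans _ E0)// divr_gt0// mulr_gt0.
  by move: E0; rewrite ltr_pdivrMr//; lra.
pose C := 4 * (1 + 16 * (E ^ 4)%:R) : R.
have C0 : 0 < C by rewrite mulr_gt0// ltr_wpDr// mulr_ge0.
pose eta2 := d / (2 * b * C).
have e20 : 0 < eta2 by rewrite divr_gt0// !mulr_gt0.
exists (Num.sqrt eta2); first by rewrite sqrtr_gt0.
move=> s a us m1 big; apply: contrapT => H.
have aeta n : n \in s -> md a n <= Num.sqrt eta2.
  by move=> ns; rewrite leNgt; apply/negP => lt; apply: H; exists n.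
have := nres_vanish b0 Kb us (ltn0Sn _ : (0 < E)%N) aeta.
rewrite m1 expr1n !mulr1 sqr_sqrtr ?(ltW e20)//.
have -> : b * (8 / E%:R + 4 * (eta2 * (1 + 16 * (E ^ 4)%:R))) = b * (8 / E%:R) + d / 2.
  rewrite mulrDr; congr (_ + _); rewrite /eta2 /C; field.
  by rewrite !gt_eqF//; move: C0; rewrite /C; lra.
have := wqE K0 a us; rewrite m1; have := mass4_ge0 s a.
by move: big; rewrite /d; rewrite /d in hE; lra.
Qed.

Lemma maximizing_seq : exists2 eta : R, 0 < eta &
  forall k : nat, exists (s : seq int) (a : int -> R[i]),
   [/\ uniq s, (forall n, n \notin s -> a n = 0), mass s (md a) = 1,
       eta < md a 0 & j - k.+1%:R^-1 < wq K s a].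
Proof.
have [eta eta0 peak] := near_max_peak; exists eta => // k.
have e0 : 0 < Num.min (k.+1%:R^-1) ((j - 2) / 2).
  by rewrite lt_min invr_gt0 ltr0Sn divr_gt0 ?subr_gt0.
have [_ [s [a [us m1 ->]]] big] := sup_adherent e0 has_sup_wq.
have big1 : j - k.+1%:R^-1 < wq K s a.
  by apply: le_lt_trans big; rewrite lerB// ge_min lexx.
have big2 : (j + 2) / 2 < wq K s a.
  apply: le_lt_trans big.
  have : Num.min (k.+1%:R^-1) ((j - 2) / 2) <= (j - 2) / 2 by rewrite ge_min lexx orbT.
  rewrite -/wq_sup; lra.
have [n0 n0s pk] := peak s a us m1 big2.
pose t := [seq n + - n0 | n <- s].
pose a' n := if n \in t then a (n + n0) else 0.
have ut : uniq t by rewrite map_inj_uniq // => x y /addIr.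
have ea n : n \in t -> a' n = a (n + n0) by rewrite /a' => ->.
exists t, a'; split => //.
- by move=> n /negPf nt; rewrite /a' nt.
- rewrite -m1 /mass big_map big_seq [RHS]big_seq; apply: eq_bigr => n ns.
  by rewrite /md ea ?addrNK//; apply/mapP; exists n.
- by rewrite /md ea ?add0r//; apply/mapP; exists n0; rewrite ?subrr.
- rewrite (eq_wq K ea) wq_map_addr (@eq_wq _ _ _ _ a)// => n _.
  by rewrite addrNK.
Qed.

(** The limit sequence may have infinite support, so its mass and energy are only measured on finite
    sets. Stating mass at most 1 is enough: equality is recovered from the energy when the function
    is built. *)
Theorem wq_maximizer : exists al : int -> R[i],
  (forall s, uniq s -> mass s (md al) <= 1) /\
  (forall e : R, 0 < e -> exists M0, forall M, (M0 <= M)%N -> j - e <= wq K (window M) al).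
Proof.
have [eta eta0 seqk] := maximizing_seq.
have [s /choice[a sa]] := choice seqk.
have [U [UU Uoo]] := ultraFilterLemma (@eventually_filter : ProperFilter \oo).
have PU : ProperFilter U by exact: ultra_proper.
have FU : Filter U by apply: filter_filter.
have us k : uniq (s k) by have [] := sa k.
have as_ k n : n \notin s k -> a k n = 0 by have [_ + _ _ _] := sa k; apply.
have m1 k : mass (s k) (md (a k)) = 1 by have [] := sa k.
have a0 k : eta < md (a k) 0 by have [] := sa k.
have wk k : j - k.+1%:R^-1 < wq K (s k) (a k) by have [] := sa k.
have md1 k n : md (a k) n <= 1.
  have [ns|ns] := boolP (n \in s k); last by rewrite /md as_// normc0.
  rewrite -(@expr_le1 _ 2) ?md_ge0// -(m1 k) /mass (bigD1_seq n)//= lerDl.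
  by apply: sumr_ge0 => i _; rewrite sqr_ge0.
have lim_ex n : exists l, ccvg U (fun k => a k n) l.
  have [lr Hr] := @ultra_bounded_cvg R U (fun k => complex.Re (a k n)) 1 UU
    (fun k => le_trans (abs_Re_le _) (md1 k n)).
  have [li Hi] := @ultra_bounded_cvg R U (fun k => complex.Im (a k n)) 1 UU
    (fun k => le_trans (abs_Im_le _) (md1 k n)).
  by exists (lr +i* li).
have {lim_ex}[al a_al] := choice lim_ex.
have mlow k M : mass (s k) (md (cut (low M) (a k))) = mass (window M) (md (a k)).
  rewrite (@mass_supp _ _ (window M)) ?window_uniq//; first last.
  - by move=> n; rewrite mem_window /cut /low => /negPf->.
  - by move=> n ns; rewrite /cut; case: ifP => // _; exact: as_.
  rewrite /mass big_seq [RHS]big_seq; apply: eq_bigr => n.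
  by rewrite mem_window md_cut /low => ->.
have wlow k M : wq K (s k) (cut (low M) (a k)) = wq K (window M) (a k).
  rewrite (@wq_supp _ _ _ (window M)) ?window_uniq//; first last.
  - by move=> n; rewrite mem_window /cut /low => /negPf->.
  - by move=> n ns; rewrite /cut; case: ifP => // _; exact: as_.
  by apply: eq_wq => n; rewrite mem_window /cut /low => ->.
have mhl k M L : (M <= L)%N -> mass (window L) (md (a k)) = mass (window M) (md (a k)) +
    mass (s k) (md (cut (fun n => ~~ low M n && ~~ high L n) (a k))).
  move=> ML; rewrite -!mlow /mass -big_split /=; apply: eq_bigr => n _; rewrite !md_cut /low /high -leqNgt.
  have [nM|nM] := leqP `|n| M; first by rewrite (leq_trans nM ML) /= expr0n addr0.
  by rewrite expr0n add0r.
have mass_win1 L : mass (window L) (md al) <= 1.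
  apply: (cvgr_to_le (cvg_mass FU a_al (s:=window L))).
  apply: (@filterE _ U) => k; rewrite -(m1 k) -mlow; apply: ler_sum => n _; rewrite md_cut; case: ifP => // _.
  by rewrite expr0n sqr_ge0.
exists al; split.
  move=> t ut; pose L := (\sum_(n <- t) `|n|)%N.
  apply: le_trans (mass_win1 L); apply: ler_sum_subset => // n; last by rewrite sqr_ge0.
  by move=> nt; rewrite mem_window /L (big_rem n)//= leq_addr.
move=> e e0; pose D := (2 * j - 4) * eta ^+ 2.
have D0 : 0 < D by rewrite mulr_gt0 ?exprn_gt0//; move: sup_gt2; lra.
pose cc := 9 + 32 * b; have cc0 : 0 < cc by rewrite /cc; move: b0; lra.
pose C := cc + (j + 4) * (cc / D) + 1.
have C0 : 0 < C.
  rewrite /C ltr_wpDl// addr_ge0 ?(ltW cc0)// mulr_ge0 ?divr_ge0 ?(ltW cc0) ?(ltW D0)//.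
  by move: sup_gt2; lra.
pose ep := Num.min 1 (e / C).
have ep0 : 0 < ep by rewrite lt_min ltr01 divr_gt0.
have ep1 : ep <= 1 by rewrite ge_min lexx.
have epe : C * ep <= e by rewrite mulrC -ler_pdivlMr// ge_min lexx orbT.
pose S := [set mass (window M) (md al) | M in [set: nat]].
have supS : has_sup S.
  split; first by exists (mass (window 0) (md al)), 0%N.
  by exists 1 => _ [M _ <-].
(* Outside the window [M0] the limit has mass below ep^2, so the shell between any M >= M0 and L is
   light for [al]. As M and L are fixed before [k], it is then also light for [a k] with k taken
   along [U]. *)
have [_ [M0 _ <-] HM0] := sup_adherent (exprn_gt0 2 ep0) supS.
exists M0 => M M0M.
pose E := (Num.truncn ep^-1).+1.
have E0 : ep^-1 < E%:R by rewrite /E truncnS_gt.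
have hE : 8 / E%:R <= 8 * ep.
  rewrite ler_pdivrMr; last by rewrite (lt_trans _ E0)// invr_gt0.
  by rewrite -mulrA ler_peMr// mulrC -ler_pdivrMr// mul1r ltW.
pose L := (3 * M + E ^ 2)%N; have ML : (M <= L)%N by rewrite /L (leq_trans _ (leq_addr _ _))// leq_pmull.
have shell_al : mass (window L) (md al) - mass (window M) (md al) < 2 * ep ^+ 2.
  have h1 : mass (window L) (md al) <= sup S by apply: sup_upper_bound => //; exists L.
  have h2 : mass (window M0) (md al) <= mass (window M) (md al).
    apply: ler_sum_subset; [exact: window_uniq| |by move=> n; rewrite sqr_ge0].
    by move=> n; rewrite !mem_window => /leq_trans; apply.
  have : 0 < ep ^+ 2 by rewrite exprn_gt0.
  move: h1 h2 HM0; lra.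
have n1 : \forall k \near U, mass (window L) (md (a k)) - mass (window M) (md (a k)) < 2 * ep ^+ 2.
  have H : (fun k => mass (window L) (md (a k)) - mass (window M) (md (a k))) @ U -->
    mass (window L) (md al) - mass (window M) (md al) by apply: cvgB; exact: cvg_mass.
  exact: (@cvgr_lt _ _ _ FU _ _ H _ shell_al).
have n2 : \forall k \near U, wq K (window M) (a k) < wq K (window M) al + ep.
  have H : (fun k => wq K (window M) (a k)) @ U --> wq K (window M) al by exact: cvg_wq.
  by apply: (@cvgr_lt _ _ _ FU _ _ H); rewrite ltrDl.
have n3 : \forall k \near U, k.+1%:R^-1 < ep.
  apply: Uoo; exists E => // k /= Ek; rewrite invf_plt ?posrE ?ltr0Sn//.
  by rewrite (lt_le_trans E0)// ler_nat leqW.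
have [k [[h1 h2] h3]] := filter_ex (filterI (filterI n1 n2) n3).
rewrite (mhl k M L ML) addrAC subrr add0r in h1.
have E1 : (0 < E)%N by [].
have m1k : mass (s k) (md (a k)) <= 1 by rewrite m1.
have := wq_split (a := a k) K0 b0 Kb (us k) E1 ep0 (leqnn _ : (3 * M + E ^ 2 <= L)%N) m1k.
have mE := mass_low_high (s k) (a k) ML; rewrite m1 in mE.
have := wq_le_sup (cut (high L) (a k)) (us k); rewrite wlow.
have := wq_le_sup (a k) (window_uniq M); rewrite -mlow.
have : eta ^+ 2 <= mass (s k) (md (cut (low M) (a k))).
  rewrite mlow /mass (bigD1_seq 0) ?window_uniq ?mem_window//=.
  rewrite (le_trans _ (_ : md (a k) 0 ^+ 2 <= _))//.
    by rewrite lerXn2r ?nnegrE ?md_ge0 ?(ltW eta0) ?(ltW (a0 k)).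
  by rewrite lerDl sumr_ge0// => i0 _; rewrite sqr_ge0.
have := mass_ge0 (s k) (md (cut (low M) (a k))).
have := mass_ge0 (s k) (md (cut (high L) (a k))).
move: mE h1; set x := mass _ _; set y := mass _ _; set z := mass _ _.
have := mass_ge0 (s k) (md (cut (fun n => ~~ low M n && ~~ high L n) (a k))).
rewrite -/z; move: (wk k) h2 h3.
set w := wq K (s k) (a k); set wA := wq K (window M) (a k); set wB := wq K (s k) _.
set WA := wq K (window M) al.
move=> hw hWA hk z0 xyz1 hz y0 x0 xeta hA hB hw2; cbv zeta in hw2.
exact: (mass_concentration sup_gt2 b0 eta0 ep0 ep1 z0 y0 x0 (esym xyz1) hz xeta hA hB hE hw2 hw hk hWA epe).
Qed.

End Maximizer.

(** * Chirps *)

Section Cis.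
Variable R : realType.
Implicit Types (x y : R) (z w : R[i]).

Lemma cisD x y : cis (x + y) = cis x * cis y.
Proof.
apply/eqP; rewrite eq_complex /= cosD sinD; apply/andP; split; apply/eqP => //.
by rewrite addrC [cos x * _]mulrC.
Qed.

Lemma normc_cis x : normc (cis x) = 1.
Proof. by rewrite /normc /= cos2Dsin2 sqrtr1. Qed.

Lemma normc_sin_sub x y : x <= y -> `|sin y - sin x| <= y - x.
Proof.
move=> xy; have [c _ ->] := @MVT_segment R sin cos x y xy (fun t _ => is_derive_sin t)
  (continuous_subspaceT (@continuous_sin R)).
by rewrite normrM (ger0_norm (_ : 0 <= y - x)) ?subr_ge0// ler_piMl ?subr_ge0// cos_max.
Qed.

Lemma sin_lipschitz x y : `|sin x - sin y| <= `|x - y|.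
Proof.
have [xy|/ltW xy] := leP y x; last rewrite distrC [leRHS]distrC.
  by rewrite [leRHS]ger0_norm ?subr_ge0// normc_sin_sub.
by rewrite [leRHS]ger0_norm ?subr_ge0// normc_sin_sub.
Qed.

Lemma abs_sin_le x : `|sin x| <= `|x|.
Proof. by have := sin_lipschitz x 0; rewrite sin0 !subr0. Qed.

Lemma cos_ge x : 1 - x ^+ 2 / 2 <= cos x.
Proof.
have -> : cos x = 1 - 2 * sin (x / 2) ^+ 2.
  rewrite {1}(_ : x = (x / 2) *+ 2); last by rewrite -mulr_natr divfK.
  by rewrite cos_mulr2n cos2sin2; ring.
have : sin (x / 2) ^+ 2 <= (x / 2) ^+ 2.
  rewrite -[leLHS]real_normK ?num_real// -[leRHS]real_normK ?num_real//.
  by rewrite lerXn2r ?nnegrE ?normr_ge0 ?abs_sin_le.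
rewrite expr_div_n; lra.
Qed.

Lemma sin_sub_id (h : R) : 0 <= h -> `|sin h - h| <= h ^+ 3 / 2.
Proof.
move=> h0; have [c] := @MVT_segment R (@sin R) (@cos R) 0 h h0 (fun t _ => is_derive_sin t)
  (continuous_subspaceT (@continuous_sin R)).
rewrite in_itv /= sin0 !subr0 => /andP[c0 ch] ->.
rewrite -{2}[h]mul1r -mulrBl normrM (ger0_norm h0) distrC ger0_norm ?subr_ge0 ?cos_le1//.
have : 1 - cos c <= h ^+ 2 / 2.
  have := cos_ge c; have : c ^+ 2 <= h ^+ 2 by rewrite lerXn2r ?nnegrE.
  lra.
by move=> /(ler_wpM2r h0) /le_trans; apply; rewrite mulrAC -exprSr.
Qed.

End Cis.

Section Kernel.
Variable R : realType.
Implicit Types (B x s : R).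

(* [kern B w] is the mean over [0, B] of [cis (- (w * t))] *)
Definition kern B (w : int) : R[i] :=
  if w == 0 then 1 else
  (sin (w%:~R * B) / (w%:~R * B)) +i* (- ((1 - cos (w%:~R * B)) / (w%:~R * B))).

Lemma kern0 B : kern B 0 = 1. Proof. by rewrite /kern eqxx. Qed.

(** For w nonzero and y = w B the kernel is (e^{-iy} - 1) / (-iy), of modulus at most 2 / |y|; the 2
    cancels against w = 2 p q. *)
Lemma normc_kern_le B (p q : int) : 0 < B -> p != 0 -> q != 0 ->
  normc (kern B (2 * (p * q))) <= B^-1 * invmul R p q.
Proof.
move=> B0 p0 q0; have w0 : 2 * (p * q) != 0 :> int by rewrite !mulf_neq0.
have -> : invmul R p q = (`|p%:~R| * `|q%:~R|)^-1 by rewrite /invmul (negPf p0) (negPf q0).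
rewrite /kern (negPf w0).
set y := (2 * (p * q))%:~R * B.
have y0 : y != 0 by rewrite mulf_neq0 ?intr_eq0// gt_eqF.
have ny : `|y| = 2 * (`|p%:~R| * `|q%:~R|) * B.
  by rewrite /y !rmorphM /= !normrM (gtr0_norm B0) (@ger0_norm _ 2%:~R).
have -> : B^-1 * (`|p%:~R| * `|q%:~R|)^-1 = 2 / `|y|.
  rewrite ny; field; rewrite !normr_eq0 !intr_eq0 p0 q0 gt_eqF//.
rewrite -(@ler_pXn2r _ 2) ?nnegrE ?normc_ge0 ?divr_ge0//.
rewrite sqr_normc_ReIm /= sqrrN !expr_div_n -mulrDl real_normK ?num_real//.
rewrite ler_pM2r ?invr_gt0 ?exprn_even_gt0//.
have := cos2Dsin2 y; have := cos_geN1 y; have := cos_le1 y; lra.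
Qed.

Definition chirp s (n : int) : R[i] := cis (- (n%:~R ^+ 2 * s)).

Definition osc x (w : int) : R := sin (w%:~R * x) / w%:~R.

Lemma Re_cis_kern B s (w : int) : 0 < B -> w != 0 ->
  complex.Re (cis (- (w%:~R * s)) * kern B w) = B^-1 * (osc (s + B) w - osc s w).
Proof.
move=> B0 w0; rewrite /kern (negPf w0) /cis /osc /= cosN sinN (mulrDr _ s) sinD.
by field; rewrite intr_eq0 w0 gt_eqF.
Qed.

Lemma mass_chirp s t : mass t (md (chirp s)) = (size t)%:R.
Proof.
rewrite /mass; under eq_bigr do rewrite /md normc_cis expr1n.
by rewrite big_const_seq count_predT iter_addr_0.
Qed.

Lemma chirp_qterm B s n1 n2 n3 n4 :
  qterm (kern B) (chirp s) n1 n2 n3 n4 =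
  complex.Re (cis (- ((n1 ^+ 2 + n2 ^+ 2 - n3 ^+ 2 - n4 ^+ 2)%:~R * s)) *
     kern B (n1 ^+ 2 + n2 ^+ 2 - n3 ^+ 2 - n4 ^+ 2)).
Proof.
rewrite /qterm /chirp; congr (complex.Re (_ * _)).
have cj x : Num.conj (cis x) = cis (- x) by rewrite /cis cosN sinN.
rewrite -!cisD cj -cisD; congr cis; rewrite !rmorphB !rmorphD !rmorphXn /=; ring.
Qed.

Definition box : seq int := map Posz (iota 0 14).

(** Kept in [nat] so that it can be computed: with truncated subtraction, m - n + (n - m) is the
    distance from m to n. Dropping the signs is harmless because [osc] is even in its frequency. *)
Definition nonres_freqs : seq nat :=
  [seq (2 * ((n.2.1 - n.1.1 + (n.1.1 - n.2.1)) * (n.2.2 - n.1.1 + (n.1.1 - n.2.2))))%N |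
    n <- [seq (h, k) | h <- [seq (i, j) | i <- iota 0 14, j <- iota 0 14],
                       k <- [seq (i, j) | i <- iota 0 14, j <- iota 0 14]] &
    [&& n.1.1 + n.1.2 == n.2.1 + n.2.2, n.2.1 != n.1.1 & n.2.2 != n.1.1]%N].

Lemma osc_abs x (w : int) : osc x w = osc x `|w|%N.
Proof.
have [w0|w0] := lerP 0 w; first by rewrite gez0_abs.
by rewrite ltz0_abs// /osc rmorphN mulNr sinN invrN mulrNN.
Qed.

Lemma nonres_chirp B s : 0 < B ->
  nres (kern B) box (chirp s) = B^-1 * \sum_(w <- nonres_freqs) (osc (s + B) w - osc s w).
Proof.
move=> B0; rewrite mulr_sumr big_map big_filter big_mkcond !big_allpairs_dep.
rewrite [LHS]big_map; apply: eq_bigr => n1 _; rewrite [LHS]big_map; apply: eq_bigr => n2 _.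
rewrite big_allpairs_dep [LHS]big_map; apply: eq_bigr => n3 _.
rewrite [LHS]big_map [LHS]big_mkcond /=; apply: eq_bigr => n4 _ /=.
rewrite -!PoszD !eqz_nat; case: eqP => // e; rewrite andTb.
have [//|N3] := eqVneq n3 n1; have [//|N4] := eqVneq n4 n1 => /=.
have E : n1%:Z ^+ 2 + n2%:Z ^+ 2 - n3%:Z ^+ 2 - n4%:Z ^+ 2 = 2 * ((n3%:Z - n1%:Z) * (n4%:Z - n1%:Z)).
  have -> : n2%:Z = n3%:Z + n4%:Z - n1%:Z by clear -e; lia.
  ring.
have dist (i j : nat) : `|i%:Z - j%:Z|%N = (i - j + (j - i))%N by clear; lia.
rewrite chirp_qterm E Re_cis_kern//; last by rewrite !mulf_neq0 ?subr_eq0 ?eqz_nat.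
by rewrite osc_abs [osc s (_ * _)]osc_abs !abszM !dist.
Qed.

Definition prim x : R := \sum_(w <- nonres_freqs) osc x w - 14 * x.

(** The chirp has energy 2 * 14^2 - 14 + [nres], to be compared with j * 14^2; so j > 2 once [nres]
    exceeds 14. The linear term of [prim] encodes exactly this threshold. *)
Lemma wq_chirp_gt B s : 0 < B -> prim s < prim (s + B) -> 2 < wq_sup (kern B).
Proof.
move=> B0 H.
have ub : uniq box by [].
have := wq_le_sup (kern0 B) (_ : 0 < B^-1) (fun p q => @normc_kern_le B p q B0) (chirp s) ub.
rewrite invr_gt0 => /(_ B0).
rewrite (wqE (kern0 B))// mass_chirp nonres_chirp//.
have -> : mass4 box (chirp s) = 14.
  rewrite /mass4; under eq_bigr do rewrite /md normc_cis expr1n.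
  by rewrite big_const_seq count_predT iter_addr_0.
rewrite sumrB; move: H; rewrite /prim; set u := \sum_(w <- _) _; set v := \sum_(w <- _) _ => H.
have : 14 < B^-1 * (v - u).
  by rewrite mulrC ltr_pdivlMr//; lra.
rewrite (_ : (size box)%:R = 14 :> R)//; lra.
Qed.

End Kernel.

(** * Trigonometric polynomials *)

Section SegmentIntegrals.
Variable R : realType.
Notation mu := (@lebesgue_measure R).
Implicit Types (a b x : R) (f g : R -> R).

Lemma continuous_integrable_seg f a b : continuous f -> mu.-integrable `[a, b] (EFin \o f).
Proof.
move=> cf; apply: continuous_compact_integrable; first exact: segment_compact.
exact: continuous_subspaceT.
Qed.

Lemma integral_EFin_seg f a b : continuous f ->
  (\int[mu]_(x in `[a, b]) (f x)%:E = (\int[mu]_(x in `[a, b]) f x)%:E)%E.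
Proof.
move=> cf; rewrite /Rintegral fineK//; apply: integrable_fin_num => //.
exact: continuous_integrable_seg.
Qed.

Lemma continuous_sumf (I : Type) (s : seq I) (P : pred I) (F : I -> R -> R) :
  (forall i, continuous (F i)) -> continuous (fun x => \sum_(i <- s | P i) F i x).
Proof.
move=> cF x; rewrite /continuous_at; elim: s => [|i s IH].
  by under eq_fun do rewrite big_nil; rewrite big_nil; exact: cvg_cst.
under eq_fun do rewrite big_cons; rewrite big_cons; case: ifP => // _.
by apply: cvgD => //; exact: cF.
Qed.

Lemma Rintegral_sum_seg (I : Type) (s : seq I) (P : pred I) (F : I -> R -> R) a b :
  (forall i, continuous (F i)) ->
  \int[mu]_(x in `[a, b]) (\sum_(i <- s | P i) F i x) =
  \sum_(i <- s | P i) \int[mu]_(x in `[a, b]) F i x.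
Proof.
move=> cF; elim: s => [|i s IH].
  by under eq_Rintegral do rewrite big_nil; rewrite Rintegral_cst// mul0r big_nil.
under eq_Rintegral do rewrite big_cons; rewrite big_cons; case: ifP => // _.
rewrite RintegralD ?IH//; first exact: continuous_integrable_seg.
apply: continuous_integrable_seg; exact: continuous_sumf.
Qed.

Lemma fine_mu_seg a b : a <= b -> fine (mu `[a, b]) = b - a.
Proof. by move=> ab; rewrite lebesgue_measure_itv /= lte_fin; case: ltP => // ba; have -> : a = b; [apply/eqP; rewrite eq_le ab|rewrite subrr]. Qed.

Lemma continuous_osc (k c d : R) : continuous (fun x => c * cos (k * x) - d * sin (k * x)).
Proof.
move=> x; apply: cvgB; (apply: cvgM; first exact: cvg_cst).
  apply: continuous_comp; [exact: mulrl_continuous|exact: continuous_cos].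
apply: continuous_comp; [exact: mulrl_continuous|exact: continuous_sin].
Qed.

Lemma Rintegral_osc (k c d a b : R) : a < b -> k != 0 ->
  \int[mu]_(x in `[a, b]) (c * cos (k * x) - d * sin (k * x)) =
  (c * sin (k * b) + d * cos (k * b)) / k - (c * sin (k * a) + d * cos (k * a)) / k.
Proof.
move=> ab k0; pose F x := (c * sin (k * x) + d * cos (k * x)) / k.
have dF x : is_derive x 1 F (c * cos (k * x) - d * sin (k * x)).
  have d1 : is_derive x 1 (fun x => sin (k * x)) (k * cos (k * x)).
    apply: is_derive_eq; rewrite /GRing.scale /=; ring.
  have d2 : is_derive x 1 (fun x => cos (k * x)) (- (k * sin (k * x))).
    apply: is_derive_eq; rewrite /GRing.scale /=; ring.
  rewrite /F; apply: is_derive_eq; rewrite /GRing.scale /=; field.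
  done.
rewrite /Rintegral (@continuous_FTC2 _ _ F)//.
- by apply: continuous_subspaceT => x; exact: continuous_osc.
- split.
  + by move=> x _; exact: (ex_derive (is_derive := dF x)).
  + apply: cvg_at_right_filter; apply: differentiable_continuous; apply/derivable1_diffP; exact: (ex_derive (is_derive := dF a)).
  + apply: cvg_at_left_filter; apply: differentiable_continuous; apply/derivable1_diffP; exact: (ex_derive (is_derive := dF b)).
- by move=> x _; rewrite derive1E; exact: derive_val.
Qed.

End SegmentIntegrals.

Section TrigPoly.
Variable R : realType.
Notation mu := (@lebesgue_measure R).
Implicit Types (s : seq int) (a : int -> R[i]) (x t B : R) (z w : R[i]).

Lemma cReD z w : complex.Re (z + w) = complex.Re z + complex.Re w. Proof. by case: z w => ? ? []. Qed.
Lemma cImD z w : complex.Im (z + w) = complex.Im z + complex.Im w. Proof. by case: z w => ? ? []. Qed.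
Lemma cReN z : complex.Re (- z) = - complex.Re z. Proof. by case: z. Qed.
Lemma cImN z : complex.Im (- z) = - complex.Im z. Proof. by case: z. Qed.
Lemma cReM z w : complex.Re (z * w) = complex.Re z * complex.Re w - complex.Im z * complex.Im w.
Proof. by case: z w => ? ? []. Qed.
Lemma cImM z w : complex.Im (z * w) = complex.Re z * complex.Im w + complex.Im z * complex.Re w.
Proof. by case: z w => ? ? []. Qed.
Lemma cReJ z : complex.Re (Num.conj z) = complex.Re z. Proof. by case: z. Qed.
Lemma cImJ z : complex.Im (Num.conj z) = - complex.Im z. Proof. by case: z. Qed.

Lemma Re_realM (c : R) z : complex.Re (c%:C * z) = c * complex.Re z.
Proof. by rewrite cReM /= mul0r subr0. Qed.

Lemma Re_sum (I : Type) (s : seq I) (P : pred I) (F : I -> R[i]) :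
  complex.Re (\sum_(i <- s | P i) F i) = \sum_(i <- s | P i) complex.Re (F i).
Proof. by elim/big_rec2: _ => // i y z _ <-; rewrite cReD. Qed.

Lemma Im_sum (I : Type) (s : seq I) (P : pred I) (F : I -> R[i]) :
  complex.Im (\sum_(i <- s | P i) F i) = \sum_(i <- s | P i) complex.Im (F i).
Proof. by elim/big_rec2: _ => // i y z _ <-; rewrite cImD. Qed.

Lemma Re_mul_cis z x : complex.Re (z * cis x) = complex.Re z * cos x - complex.Im z * sin x.
Proof. by rewrite cReM. Qed.

Lemma conj_cis x : Num.conj (cis x) = cis (- x) :> R[i].
Proof. by rewrite /cis cosN sinN. Qed.

Lemma continuous_Re_mul_cis z (k : R) : continuous (fun x => complex.Re (z * cis (k * x))).
Proof.
rewrite (_ : (fun x => _) = fun x => complex.Re z * cos (k * x) - complex.Im z * sin (k * x)).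
  exact: continuous_osc.
by apply/funext => x; rewrite Re_mul_cis.
Qed.

Lemma continuous_Re_mul_cisN z (k : R) : continuous (fun x => complex.Re (z * cis (- (k * x)))).
Proof.
rewrite (_ : (fun x => _) = fun x => complex.Re (z * cis (- k * x))).
  exact: continuous_Re_mul_cis.
by apply/funext => x; rewrite mulNr.
Qed.

Lemma continuous_Im_mul_cis z (k : R) : continuous (fun x => complex.Im (z * cis (k * x))).
Proof.
rewrite (_ : (fun x => _) = fun x => complex.Im z * cos (k * x) - (- complex.Re z) * sin (k * x)).
  exact: continuous_osc.
by apply/funext => x; rewrite cImM /=; ring.
Qed.

Lemma pi2_gt0 : 0 < (pi : R) *+ 2. Proof. by rewrite mulrn_wgt0// pi_gt0. Qed.

Lemma cos_intM2pi (n : int) x : cos (x + n%:~R * (pi *+ 2)) = cos x /\ sin (x + n%:~R * (pi *+ 2)) = sin x.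
Proof.
have H (k : nat) (y : R) : cos (y + k%:R * (pi *+ 2)) = cos y /\ sin (y + k%:R * (pi *+ 2)) = sin y.
  by rewrite mulr_natl; split; [exact: (periodicn (@cosD2pi R)) | exact: (periodicn (@sinD2pi R))].
case: n => k; first exact: H.
have [h1 h2] := H k.+1 (x + (Negz k)%:~R * (pi *+ 2)).
have e : x + (Negz k)%:~R * (pi *+ 2) + k.+1%:R * (pi *+ 2) = x.
  by rewrite NegzE rmorphN /= mulNr subrK.
by rewrite e in h1 h2.
Qed.

Lemma cis_periodic (n : int) x : cis (n%:~R * (x + pi *+ 2)) = cis (n%:~R * x) :> R[i].
Proof. by rewrite mulrDr /cis; have [-> ->] := cos_intM2pi n (n%:~R * x). Qed.

Lemma Rintegral_Re_cis_int z (k : int) :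
  \int[mu]_(x in torus R) complex.Re (z * cis (k%:~R * x)) = if k == 0 then pi *+ 2 * complex.Re z else 0.
Proof.
have p0 := pi2_gt0; rewrite /torus; case: eqVneq => [->|k0].
  under eq_Rintegral do rewrite mul0r /cis cos0 sin0 mulr1.
  by rewrite Rintegral_cst// fine_mu_seg ?(ltW p0)// subr0 mulrC.
under eq_Rintegral do rewrite Re_mul_cis.
rewrite Rintegral_osc ?intr_eq0//.
have [c s] := cos_intM2pi k 0; rewrite add0r in c s.
by rewrite c s mulr0 subrr.
Qed.

Lemma Rintegral_Re_cis_kern z (w : int) B : 0 < B ->
  \int[mu]_(t in `[0, B]) complex.Re (z * cis (- (w%:~R * t))) = B * complex.Re (z * kern B w).
Proof.
move=> B0; rewrite /kern; case: eqVneq => [->|w0].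
  under eq_Rintegral do rewrite mul0r oppr0 /cis cos0 sin0 mulr1.
  by rewrite Rintegral_cst// fine_mu_seg ?(ltW B0)// subr0 mulrC mulr1.
under eq_Rintegral do rewrite -mulNr Re_mul_cis.
rewrite Rintegral_osc ?oppr_eq0 ?intr_eq0// cReM /=.
rewrite mulr0 sin0 cos0 mulNr sinN cosN.
by field; rewrite ?oppr_eq0 intr_eq0 w0 gt_eqF.
Qed.

Definition tpoly s a x : R[i] := \sum_(n <- s) a n * cis (n%:~R * x).

Lemma continuous_Re_tpoly s a : continuous (fun x => complex.Re (tpoly s a x)).
Proof.
rewrite (_ : (fun x => _) = fun x => \sum_(n <- s) complex.Re (a n * cis (n%:~R * x))).
  by apply: continuous_sumf => n; exact: continuous_Re_mul_cis.
by apply/funext => x; rewrite Re_sum.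
Qed.

Lemma continuous_Im_tpoly s a : continuous (fun x => complex.Im (tpoly s a x)).
Proof.
rewrite (_ : (fun x => _) = fun x => \sum_(n <- s) complex.Im (a n * cis (n%:~R * x))).
  by apply: continuous_sumf => n; exact: continuous_Im_mul_cis.
by apply/funext => x; rewrite Im_sum.
Qed.

Lemma normc2_tpoly s a x : normc (tpoly s a x) ^+ 2 =
  \sum_(n <- s) \sum_(m <- s) complex.Re (a n * Num.conj (a m) * cis ((n - m)%:~R * x)).
Proof.
rewrite -Re_mulJ; have -> : Num.conj (tpoly s a x) = \sum_(m <- s) Num.conj (a m * cis (m%:~R * x)).
  by rewrite -rmorph_sum.
rewrite mulr_suml Re_sum; apply: eq_bigr => n _; rewrite mulr_sumr Re_sum; apply: eq_bigr => m _.
rewrite rmorphM /= conj_cis mulrACA -cisD; congr (complex.Re (_ * cis _)).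
by rewrite rmorphB; ring.
Qed.

Lemma Rintegral_normc2_tpoly s a : uniq s ->
  \int[mu]_(x in torus R) (normc (tpoly s a x) ^+ 2) = pi *+ 2 * mass s (md a).
Proof.
move=> us; under eq_Rintegral do rewrite normc2_tpoly.
rewrite [in LHS]/torus Rintegral_sum_seg; last first.
  by move=> n; apply: continuous_sumf => m; exact: continuous_Re_mul_cis.
rewrite /mass mulr_sumr; apply: eq_big_seq => n ns.
rewrite Rintegral_sum_seg; last by move=> m; exact: continuous_Re_mul_cis.
under eq_bigr do rewrite -/(torus R) Rintegral_Re_cis_int subr_eq0 eq_sym.
by rewrite -big_mkcond sum_pred1_seq//= Re_mulJ.
Qed.

Lemma normc4_tpoly s a x : normc (tpoly s a x) ^+ 4 =
  \sum_(n1 <- s) \sum_(n2 <- s) \sum_(n3 <- s) \sum_(n4 <- s)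
    complex.Re (a n1 * a n2 * (a n3 * a n4)^* * cis ((n1 + n2 - n3 - n4)%:~R * x)).
Proof.
rewrite (_ : 4 = 2 * 2)%N// exprM; set T := tpoly s a x.
have -> : (normc T ^+ 2) ^+ 2 = complex.Re (T * T * (Num.conj T * Num.conj T)).
  by rewrite -rmorphM Re_mulJ normcM expr2.
have cT : Num.conj T = \sum_(m <- s) Num.conj (a m * cis (m%:~R * x)).
  by rewrite -rmorph_sum.
rewrite cT /T /tpoly mulr_suml mulr_suml Re_sum; apply: eq_bigr => n1 _.
rewrite mulr_sumr mulr_suml Re_sum; apply: eq_bigr => n2 _.
rewrite mulr_suml mulr_sumr Re_sum; apply: eq_bigr => n3 _.
rewrite !mulr_sumr Re_sum; apply: eq_bigr => n4 _.
rewrite !rmorphM /= !conj_cis; congr complex.Re.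
have -> : (n1 + n2 - n3 - n4)%:~R * x = n1%:~R * x + n2%:~R * x + (- (n3%:~R * x) + - (n4%:~R * x)) :> R.
  by rewrite !rmorphB rmorphD; ring.
rewrite !cisD; ring.
Qed.

Lemma Rintegral_normc4_tpoly s a :
  \int[mu]_(x in torus R) (normc (tpoly s a x) ^+ 4) =
  pi *+ 2 * quad s (fun n1 n2 n3 n4 => complex.Re (a n1 * a n2 * (a n3 * a n4)^* )).
Proof.
under eq_Rintegral do rewrite normc4_tpoly.
rewrite [in LHS]/torus /quad mulr_sumr Rintegral_sum_seg; last first.
  by move=> n; do 3 (apply: continuous_sumf => ?); exact: continuous_Re_mul_cis.
apply: eq_bigr => n1 _; rewrite mulr_sumr Rintegral_sum_seg; last first.
  by move=> n; do 2 (apply: continuous_sumf => ?); exact: continuous_Re_mul_cis.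
apply: eq_bigr => n2 _; rewrite mulr_sumr Rintegral_sum_seg; last first.
  by move=> n; apply: continuous_sumf => ?; exact: continuous_Re_mul_cis.
apply: eq_bigr => n3 _; rewrite mulr_sumr Rintegral_sum_seg; last first.
  by move=> n; exact: continuous_Re_mul_cis.
rewrite [RHS]big_mkcond; apply: eq_bigr => n4 _.
by rewrite -/(torus R) Rintegral_Re_cis_int -addrA -opprD subr_eq0.
Qed.

Definition evolve t a (n : int) : R[i] := cis (- (n%:~R ^+ 2 * t)) * a n.

Definition l4 s a t : R := \int[mu]_(x in torus R) (normc (tpoly s (evolve t a) x) ^+ 4).

Lemma l4E s a t : l4 s a t = pi *+ 2 * quad s (fun n1 n2 n3 n4 =>
  complex.Re (a n1 * a n2 * (a n3 * a n4)^* * cis (- ((n1 ^+ 2 + n2 ^+ 2 - n3 ^+ 2 - n4 ^+ 2)%:~R * t)))).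
Proof.
rewrite /l4 Rintegral_normc4_tpoly; congr (_ * _); apply: eq_quad => n1 n2 n3 n4 _ _ _ _ _.
rewrite /evolve !rmorphM /= !conj_cis; congr complex.Re.
have -> : - ((n1 ^+ 2 + n2 ^+ 2 - n3 ^+ 2 - n4 ^+ 2)%:~R * t) =
  - (n1%:~R ^+ 2 * t) + - (n2%:~R ^+ 2 * t) + (- - (n3%:~R ^+ 2 * t) + - - (n4%:~R ^+ 2 * t)) :> R.
  by rewrite !rmorphB rmorphD !rmorphXn /=; ring.
rewrite !cisD; ring.
Qed.

Lemma continuous_l4 s a : continuous (l4 s a).
Proof.
rewrite (_ : l4 s a = fun t => \sum_(n1 <- s) \sum_(n2 <- s) \sum_(n3 <- s) \sum_(n4 <- s | n1 + n2 == n3 + n4)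
   complex.Re ((pi *+ 2)%:C * (a n1 * a n2 * (a n3 * a n4)^* ) * cis (- (n1 ^+ 2 + n2 ^+ 2 - n3 ^+ 2 - n4 ^+ 2)%:~R * t))).
  by do 4 (apply: continuous_sumf => ?); exact: continuous_Re_mul_cis.
apply/funext => t; rewrite l4E -quadZ /quad; do 4 (apply: eq_bigr => ? _).
by rewrite -[in RHS]mulrA Re_realM mulNr.
Qed.

Lemma Rintegral_l4 s a B : 0 < B ->
  \int[mu]_(t in `[0, B]) l4 s a t = pi *+ 2 * B * wq (kern B) s a.
Proof.
move=> B0; under eq_Rintegral do rewrite l4E -quadZ /quad.
have cR (z : R[i]) (w : int) : continuous (fun t => pi *+ 2 * complex.Re (z * cis (- (w%:~R * t)))).
  move=> t; apply: cvgM; first exact: cvg_cst.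
  exact: continuous_Re_mul_cisN.
rewrite /wq -quadZ /quad Rintegral_sum_seg; last first.
  by move=> n; do 3 (apply: continuous_sumf => ?); exact: cR.
apply: eq_bigr => n1 _; rewrite Rintegral_sum_seg; last first.
  by move=> n; do 2 (apply: continuous_sumf => ?); exact: cR.
apply: eq_bigr => n2 _; rewrite Rintegral_sum_seg; last first.
  by move=> n; apply: continuous_sumf => ?; exact: cR.
apply: eq_bigr => n3 _; rewrite Rintegral_sum_seg; last by move=> n; exact: cR.
apply: eq_bigr => n4 _; rewrite RintegralZl//; last first.
  by apply: continuous_integrable_seg => t; exact: continuous_Re_mul_cisN.
by rewrite Rintegral_Re_cis_kern// mulrA.
Qed.

End TrigPoly.

(** * Fourier coefficients of square-integrable functions *)

Section SquareIntegrable.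
Variable R : realType.
Notation mu := (@lebesgue_measure R).
Notation D := (torus R).
Implicit Types (s : seq int) (a c : int -> R[i]) (u v : R -> R[i]) (x : R) (z : R[i]).

Lemma measurable_torus : measurable D. Proof. exact: measurable_itv. Qed.
Hint Resolve measurable_torus : core.

Lemma measurable_normc2 u : cmeasurable u -> measurable_fun setT (fun x => normc (u x) ^+ 2).
Proof.
move=> [mr mi]; under eq_fun do rewrite sqr_normc_ReIm.
by apply: measurable_funD; apply: measurable_funX.
Qed.

Lemma measurable_normc4 u : cmeasurable u -> measurable_fun setT (fun x => normc (u x) ^+ 4).
Proof.
move=> /measurable_normc2 m; under eq_fun do rewrite (exprM _ 2 2).
exact: measurable_funX.
Qed.

Lemma cmeasurableB u v : cmeasurable u -> cmeasurable v -> cmeasurable (fun x => u x - v x).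
Proof.
move=> [ur ui] [vr vi]; split.
  by under eq_fun do rewrite cReD cReN; exact: measurable_funB.
by under eq_fun do rewrite cImD cImN; exact: measurable_funB.
Qed.

Lemma cmeasurableM u v : cmeasurable u -> cmeasurable v -> cmeasurable (fun x => u x * v x).
Proof.
move=> [ur ui] [vr vi]; split.
  by under eq_fun do rewrite cReM; apply: measurable_funB; exact: measurable_funM.
by under eq_fun do rewrite cImM; apply: measurable_funD; exact: measurable_funM.
Qed.

Lemma cmeasurable_tpoly s a : cmeasurable (tpoly s a).
Proof.
split; apply: continuous_measurable_fun; first exact: continuous_Re_tpoly.
exact: continuous_Im_tpoly.
Qed.

Lemma cmeasurable_cis (k : int) z : cmeasurable (fun x => z * cis (- (k%:~R * x))).
Proof.
have := cmeasurable_tpoly [:: - k] (fun=> z); rewrite (_ : tpoly _ _ = fun x => z * cis (- (k%:~R * x)))//.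
by apply/funext => x; rewrite /tpoly big_seq1 rmorphN mulNr.
Qed.

Lemma L2_measurable u : L2 u -> cmeasurable u. Proof. by case. Qed.

Lemma integrable_normc2 u : L2 u -> mu.-integrable D (fun x => (normc (u x) ^+ 2)%:E).
Proof.
move=> [mu_ _ fu]; apply/integrableP; split.
  by apply/measurable_EFinP; apply: measurable_funTS; exact: measurable_normc2.
rewrite (_ : (fun x => _) = fun x => (normc (u x) ^+ 2)%:E)//.
by apply/funext => x /=; rewrite ger0_norm ?sqr_ge0.
Qed.

Lemma L2norm_sqr u : L2norm u ^+ 2 = \int[mu]_(x in D) (normc (u x) ^+ 2).
Proof. by rewrite sqr_sqrtr// Rintegral_ge0// => x _; rewrite sqr_ge0. Qed.

Lemma normc2B_le z1 z2 : normc (z1 - z2 : R[i]) ^+ 2 <= 2 * normc z1 ^+ 2 + 2 * normc z2 ^+ 2.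
Proof.
rewrite !sqr_normc_ReIm cReD cReN cImD cImN.
set a := complex.Re z1; set b := complex.Re z2; set c := complex.Im z1; set d := complex.Im z2.
rewrite -subr_ge0.
have -> : 2 * (a ^+ 2 + c ^+ 2) + 2 * (b ^+ 2 + d ^+ 2) - ((a - b) ^+ 2 + (c - d) ^+ 2) = (a + b) ^+ 2 + (c + d) ^+ 2 by ring.
by rewrite addr_ge0 ?sqr_ge0.
Qed.

Lemma integrable_le_normc2 (f : R -> R) u (c : R) : L2 u -> measurable_fun setT f ->
  (forall x, `|f x| <= c + normc (u x) ^+ 2) -> mu.-integrable D (EFin \o f).
Proof.
move=> Lu mf fle; have c0 : mu.-integrable D (fun x => (c + normc (u x) ^+ 2)%:E).
  rewrite (_ : (fun x => _) = (EFin \o cst c) \+ (fun x => (normc (u x) ^+ 2)%:E))//.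
  apply: integrableD => //; last exact: integrable_normc2.
  by apply: continuous_integrable_seg => x; exact: cvg_cst.
apply: le_integrable c0 => //; first by apply/measurable_EFinP; exact: measurable_funTS.
move=> x _ /=; rewrite lee_fin; apply: le_trans (fle x) _; exact: ler_norm.
Qed.

Lemma normc_le_1Dsqr z : normc z <= 1 + normc z ^+ 2.
Proof. have := sqr_ge0 (normc z - 1); have := normc_ge0 z; rewrite sqrrB; lra. Qed.

(** Since |z| |u| <= (1 + |z|^2) (1 + |u|^2), dividing by 1 + |z|^2 leaves a function dominated by 1
    + |u|^2. *)
Lemma integrable_Re_cis u (k : int) z : L2 u ->
  mu.-integrable D (EFin \o (fun x => complex.Re (z * cis (- (k%:~R * x)) * u x))).
Proof.
move=> Lu; have [m _] := cmeasurableM (cmeasurable_cis k z) (L2_measurable Lu).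
have -> : (fun x => complex.Re (z * cis (- (k%:~R * x)) * u x)) =
   (fun x => (normc z ^+ 2 + 1) * ((normc z ^+ 2 + 1)^-1 * complex.Re (z * cis (- (k%:~R * x)) * u x))).
  by apply/funext => x; rewrite mulrA divff ?mul1r// gt_eqF// ltr_wpDl ?sqr_ge0.
rewrite (_ : EFin \o _ = (fun x => (normc z ^+ 2 + 1)%:E *
   ((normc z ^+ 2 + 1)^-1 * complex.Re (z * cis (- (k%:~R * x)) * u x))%:E)%E); last first.
  by apply/funext => x /=; rewrite EFinM.
apply: integrableZl => //; apply: (integrable_le_normc2 (c := 1) Lu).
  by apply: measurable_funM => //; exact: measurable_cst.
move=> x; have p0 : 0 < normc z ^+ 2 + 1 by rewrite ltr_wpDl ?sqr_ge0.
rewrite normrM gtr0_norm ?invr_gt0// mulrC ler_pdivrMr//.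
apply: le_trans (abs_Re_le _) _; rewrite !normcM normc_cis mulr1 mulrC.
have := normc_le_1Dsqr z; have := normc_le_1Dsqr (u x).
by move=> h1 h2; apply: ler_pM; rewrite ?normc_ge0//; rewrite addrC.
Qed.

Lemma Rintegral_Re_mul (f : R -> R[i]) z :
  mu.-integrable D (EFin \o (fun x => complex.Re (f x))) ->
  mu.-integrable D (EFin \o (fun x => complex.Im (f x))) ->
  \int[mu]_(x in D) complex.Re (z * f x) = complex.Re (z * cintegral D f).
Proof.
move=> fr fi; under eq_Rintegral do rewrite cReM.
rewrite RintegralB//.
- by rewrite !RintegralZl// cReM.
- rewrite (_ : EFin \o _ = (fun x => (complex.Re z)%:E * (complex.Re (f x))%:E)%E); first exact: integrableZl.
  by apply/funext => x /=; rewrite EFinM.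
- rewrite (_ : EFin \o _ = (fun x => (complex.Im z)%:E * (complex.Im (f x))%:E)%E); first exact: integrableZl.
  by apply/funext => x /=; rewrite EFinM.
Qed.

Lemma integrable_Im_cis u (k : int) z : L2 u ->
  mu.-integrable D (EFin \o (fun x => complex.Im (z * cis (- (k%:~R * x)) * u x))).
Proof.
move=> Lu; have := integrable_Re_cis k (- 'i * z) Lu.
rewrite (_ : (fun x => complex.Re _) = (fun x => complex.Im (z * cis (- (k%:~R * x)) * u x)))//.
apply/funext => x; rewrite -!mulrA; case: (z * _) => p q /=; ring.
Qed.

(** Identities between Fourier coefficients are proved for the real parts of all multiples by [z],
    which determine a complex number by [eq_complex_Re]; all integrals then stay real. *)
Lemma Re_fourier u (n : int) z : L2 u ->
  \int[mu]_(x in D) complex.Re (z * (cis (- (n%:~R * x)) * u x)) = pi *+ 2 * complex.Re (z * fourier u n).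
Proof.
move=> Lu; rewrite Rintegral_Re_mul; last first.
- have := integrable_Im_cis n 1 Lu; by under eq_fun do rewrite mul1r.
- have := integrable_Re_cis n 1 Lu; by under eq_fun do rewrite mul1r.
by rewrite /fourier mulrCA Re_realM mulrA divff ?mul1r// gt_eqF// pi2_gt0.
Qed.

Lemma eq_complex_Re z1 z2 : (forall z, complex.Re (z * z1) = complex.Re (z * z2) :> R) -> z1 = z2 :> R[i].
Proof.
move=> H; have := H 1; rewrite !mul1r => e1; have := H 'i.
case: z1 z2 {H} e1 => [p q] [p' q'] /= -> ; rewrite !mul0r !mul1r !add0r => /oppr_inj ->//.
Qed.

Lemma fourierB u v n : L2 u -> L2 v -> L2 (fun x => u x - v x) ->
  fourier (fun x => u x - v x) n = fourier u n - fourier v n.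
Proof.
move=> Lu Lv Luv; apply: eq_complex_Re => z.
have p0 := pi2_gt0 R; apply: (mulfI (lt0r_neq0 p0)).
rewrite -Re_fourier// mulrBr cReD cReN mulrBr -!Re_fourier//.
have iu := integrable_Re_cis n z Lu; have iv := integrable_Re_cis n z Lv.
under eq_Rintegral do rewrite mulrBr mulrBr cReD cReN !mulrA.
rewrite RintegralB//; congr (_ - _); apply: eq_Rintegral => x _; by rewrite mulrA.
Qed.

Lemma L2_tpoly s a : L2 (tpoly s a).
Proof.
split; first exact: cmeasurable_tpoly.
  by move=> x; apply: eq_bigr => n _; rewrite cis_periodic.
rewrite integral_EFin_seg ?ltry//.
under eq_fun do rewrite normc2_tpoly.
by do 2 (apply: continuous_sumf => ?); exact: continuous_Re_mul_cis.
Qed.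

Lemma L2B u v : L2 u -> L2 v -> L2 (fun x => u x - v x).
Proof.
move=> Lu Lv; have m := cmeasurableB (L2_measurable Lu) (L2_measurable Lv).
split => //; first by move=> x; case: Lu => _ -> _; case: Lv => _ -> _.
have iu := integrable_normc2 Lu; have iv := integrable_normc2 Lv.
have i2 : mu.-integrable D (fun x => 2%:E * (normc (u x) ^+ 2)%:E + 2%:E * (normc (v x) ^+ 2)%:E)%E.
  by apply: integrableD => //; exact: integrableZl.
have : mu.-integrable D (fun x => (normc (u x - v x) ^+ 2)%:E).
  apply: le_integrable i2 => //.
    by apply/measurable_EFinP; apply: measurable_funTS; exact: (measurable_normc2 m).
  move=> x _; rewrite -!EFinM -EFinD lee_fin ger0_norm ?sqr_ge0//.
  by apply: le_trans (normc2B_le _ _) _; exact: ler_norm.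
by move=> /integrable_lty; apply.
Qed.

Lemma fourier_tpoly s a n : uniq s -> n \in s -> fourier (tpoly s a) n = a n.
Proof.
move=> us ns; apply: eq_complex_Re => z.
have p0 := pi2_gt0 R; apply: (mulfI (lt0r_neq0 p0)).
rewrite -Re_fourier; last exact: L2_tpoly.
have e x : complex.Re (z * (cis (- (n%:~R * x)) * tpoly s a x)) =
   \sum_(m <- s) complex.Re (z * a m * cis ((m - n)%:~R * x)).
  rewrite !mulr_sumr Re_sum; apply: eq_bigr => m _.
  rewrite (_ : (m - n)%:~R * x = m%:~R * x + - (n%:~R * x)); last by rewrite rmorphB; ring.
  by rewrite cisD; congr complex.Re; ring.
under eq_Rintegral do rewrite e.
rewrite Rintegral_sum_seg; last by move=> m; exact: continuous_Re_mul_cis.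
under eq_bigr do rewrite -/(torus R) Rintegral_Re_cis_int subr_eq0.
by rewrite -big_mkcond sum_pred1_seq.
Qed.

Lemma Rintegral_normc2B_tpoly u s a : L2 u -> uniq s ->
  \int[mu]_(x in D) (normc (u x - tpoly s a x) ^+ 2) =
  \int[mu]_(x in D) (normc (u x) ^+ 2)
    - pi *+ 2 * (2 * \sum_(n <- s) complex.Re (Num.conj (a n) * fourier u n))
    + pi *+ 2 * mass s (md a).
Proof.
move=> Lu us.
have e x : normc (u x - tpoly s a x) ^+ 2 = normc (u x) ^+ 2
   - 2 * \sum_(n <- s) complex.Re (Num.conj (a n) * cis (- (n%:~R * x)) * u x)
   + normc (tpoly s a x) ^+ 2.
  have -> : \sum_(n <- s) complex.Re (Num.conj (a n) * cis (- (n%:~R * x)) * u x) =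
     complex.Re (Num.conj (tpoly s a x) * u x).
    rewrite /tpoly rmorph_sum mulr_suml Re_sum; apply: eq_bigr => n _.
    by rewrite rmorphM /= conj_cis.
  rewrite !sqr_normc_ReIm cReD cImD cReN cImN cReM cReJ cImJ; ring.
under eq_Rintegral do rewrite e.
have i1 := integrable_normc2 Lu.
have i3 := integrable_normc2 (L2_tpoly s a).
have i0 n : mu.-integrable D (EFin \o (fun x => complex.Re (Num.conj (a n) * cis (- (n%:~R * x)) * u x))).
  exact: integrable_Re_cis.
have i2 : mu.-integrable D (EFin \o (fun x => \sum_(n <- s) complex.Re (Num.conj (a n) * cis (- (n%:~R * x)) * u x))).
  rewrite (_ : EFin \o _ = fun x => (\sum_(n <- s) (complex.Re (Num.conj (a n) * cis (- (n%:~R * x)) * u x))%:E)%E).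
    by apply: integrable_sum => // k _; exact: i0.
  by apply/funext => x /=; rewrite sumEFin.
have i2' : mu.-integrable D (EFin \o (fun x => 2 * \sum_(n <- s) complex.Re (Num.conj (a n) * cis (- (n%:~R * x)) * u x))).
  rewrite (_ : EFin \o _ = fun x => (2%:E * (\sum_(n <- s) complex.Re (Num.conj (a n) * cis (- (n%:~R * x)) * u x))%:E)%E).
    exact: integrableZl.
  by apply/funext => x /=; rewrite EFinM.
have i12 : mu.-integrable D (EFin \o (fun x => normc (u x) ^+ 2 -
    2 * \sum_(n <- s) complex.Re (Num.conj (a n) * cis (- (n%:~R * x)) * u x))).
  rewrite (_ : EFin \o _ = (fun x => (normc (u x) ^+ 2)%:E -
     (2 * \sum_(n <- s) complex.Re (Num.conj (a n) * cis (- (n%:~R * x)) * u x))%:E)%E).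
    exact: integrableB.
  by apply/funext => x /=; rewrite EFinB.
rewrite RintegralD// RintegralB// RintegralZl// Rintegral_normc2_tpoly//.
congr (_ - _ + _); rewrite mulrCA; congr (_ * _).
have S (r : seq int) : \int[mu]_(x in D) (\sum_(n <- r) complex.Re (Num.conj (a n) * cis (- (n%:~R * x)) * u x)) =
   \sum_(n <- r) \int[mu]_(x in D) complex.Re (Num.conj (a n) * cis (- (n%:~R * x)) * u x).
  elim: r => [|n r IH].
    by under eq_Rintegral do rewrite big_nil; rewrite Rintegral_cst// mul0r big_nil.
  under eq_Rintegral do rewrite big_cons.
  rewrite big_cons -IH RintegralD//.
  rewrite (_ : EFin \o _ = fun x => (\sum_(n <- r) (complex.Re (Num.conj (a n) * cis (- (n%:~R * x)) * u x))%:E)%E).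
    by apply: integrable_sum => // k _; exact: i0.
  by apply/funext => x /=; rewrite sumEFin.
rewrite S mulr_sumr; apply: eq_bigr => n _; rewrite -Re_fourier//.
by apply: eq_Rintegral => x _; rewrite mulrA.
Qed.

Lemma bessel u s : L2 u -> uniq s ->
  pi *+ 2 * mass s (md (fourier u)) <= \int[mu]_(x in D) (normc (u x) ^+ 2).
Proof.
move=> Lu us; have := Rintegral_normc2B_tpoly (fourier u) Lu us.
have e : \sum_(n <- s) complex.Re (Num.conj (fourier u n) * fourier u n) = mass s (md (fourier u)).
  by apply: eq_bigr => n _; rewrite mulrC Re_mulJ.
rewrite e => H.
have : 0 <= \int[mu]_(x in D) (normc (u x - tpoly s (fourier u) x) ^+ 2).
  by apply: Rintegral_ge0 => x _; rewrite sqr_ge0.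
rewrite H; lra.
Qed.

End SquareIntegrable.

(** * Riesz-Fischer *)

Lemma limn_einf_le (R : realType) (u : (\bar R)^nat) (C : \bar R) k0 :
  (forall k, (k0 <= k)%N -> (u k <= C)%E) -> (limn_einf u <= C)%E.
Proof.
move=> uC; rewrite limn_einf_lim; apply: lime_le; first exact: is_cvg_einfs.
apply: nearW => n; apply: le_trans (uC (maxn n k0) (leq_maxr _ _)).
by apply: ereal_inf_lbound; exists (maxn n k0) => //=; exact: leq_maxl.
Qed.

Lemma limn_einf_EFin (R : realType) (f : R^nat) (l : R) : f @ \oo --> l ->
  limn_einf (fun k => (f k)%:E) = l%:E.
Proof.
move=> fl; have fl' : (fun k => (f k)%:E) @ \oo --> l%:E by apply: cvg_EFin; [exact: nearW|exact: fl].
by have [] := cvg_limn_einf_sup fl'.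
Qed.

Lemma abs_summable_cvg (R : realType) (d : R^nat) :
  (\sum_(k <oo) `|d k|%:E < +oo)%E -> cvgn (series d).
Proof.
move=> dfin; apply: (@normed_cvg R R^o).
have nd : nondecreasing_seq (fun n => \sum_(0 <= k < n) `|d k|).
  by apply: (@nondecreasing_series _ _ xpredT 0 _) => n _ _; exact: normr_ge0.
apply: (nondecreasing_is_cvgn nd).
have d0 : (0 <= \sum_(k <oo) `|d k|%:E)%E by apply: nneseries_ge0 => n _ _; rewrite lee_fin.
exists (fine (\sum_(k <oo) `|d k|%:E)%E) => _ [n _ <-].
rewrite -lee_fin fineK ?ge0_fin_numE// /series /= -sumEFin.
by apply: (@nneseries_lim_ge R _ xpredT 0 n) => k _ _; rewrite lee_fin.
Qed.

Lemma ae_sub (R : realType) (P Q : R -> Prop) : {ae @lebesgue_measure R, forall x, P x} ->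
  (forall x, P x -> Q x) -> {ae @lebesgue_measure R, forall x, Q x}.
Proof.
by move=> h PQ; move: h; apply: filterS; first exact: (ae_filter_ringOfSetsType (@lebesgue_measure R)).
Qed.

Lemma ae_and (R : realType) (P Q : R -> Prop) : {ae @lebesgue_measure R, forall x, P x} ->
  {ae @lebesgue_measure R, forall x, Q x} -> {ae @lebesgue_measure R, forall x, P x /\ Q x}.
Proof.
by move=> h1 h2; apply: filterI => //; exact: (ae_filter_ringOfSetsType (@lebesgue_measure R)).
Qed.

Section RieszFischer.
Variable R : realType.
Notation mu := (@lebesgue_measure R).
Notation D := (torus R).
Implicit Types (s : seq int) (a c : int -> R[i]) (u v : R -> R[i]) (x : R) (z : R[i]).

Let mD : measurable D := @measurable_torus R.

Definition ae_lim (q : nat -> R -> R[i]) v := {ae mu, forall x, D x ->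
  (fun k => complex.Re (q k x)) @ \oo --> complex.Re (v x) /\
  (fun k => complex.Im (q k x)) @ \oo --> complex.Im (v x)}.

Lemma ae_limB q v u : ae_lim q v -> ae_lim (fun k x => q k x - u x) (fun x => v x - u x).
Proof.
move/ae_sub; apply => x H Dx; have [hr hi] := H Dx; split.
  by under eq_fun do rewrite cReD cReN; rewrite cReD cReN; apply: cvgB => //; exact: cvg_cst.
by under eq_fun do rewrite cImD cImN; rewrite cImD cImN; apply: cvgB => //; exact: cvg_cst.
Qed.

Lemma measurable_normcX u r : cmeasurable u -> measurable_fun D (fun x => ((normc (u x) ^+ 2) ^+ r)%:E).
Proof.
move=> mu_; apply/measurable_EFinP; apply: measurable_funTS; apply: measurable_funX.
exact: measurable_normc2.
Qed.

(** The exponent on the squared modulus covers both uses: r = 1 for L^2 bounds and r = 2 for the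
    fourth power. *)
Lemma fatou_normc q v r : (forall k, cmeasurable (q k)) -> cmeasurable v -> ae_lim q v ->
  (\int[mu]_(x in D) ((normc (v x) ^+ 2) ^+ r)%:E <=
   limn_einf (fun k => \int[mu]_(x in D) ((normc (q k x) ^+ 2) ^+ r)%:E))%E.
Proof.
move=> mq mv qv.
have nn u x : (0 <= ((normc (u x) ^+ 2) ^+ r)%:E)%E by rewrite lee_fin exprn_ge0 ?sqr_ge0.
apply: le_trans (@fatou _ _ R mu D mD (fun k x => ((normc (q k x) ^+ 2) ^+ r)%:E) _ _).
- apply: ae_ge0_le_integral => //.
  + exact: measurable_normcX.
  + move=> x _; rewrite limn_einf_lim; apply: lime_ge; first exact: is_cvg_einfs.
    by apply: nearW => n; apply: le_ereal_inf_tmp => _ [k _ <-].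
  + have := @measurable_fun_limn_esup _ _ R D (fun k x => (- ((normc (q k x) ^+ 2) ^+ r)%:E)%E).
    move=> /(_ _) h; apply: measurableT_comp => //; apply: h => k.
    by apply: measurableT_comp => //; exact: measurable_normcX.
  + apply: (ae_sub qv) => x H Dx; have [hr hi] := H Dx.
    rewrite (@limn_einf_EFin R (fun k => (normc (q k x) ^+ 2) ^+ r) ((normc (v x) ^+ 2) ^+ r))//.
    have h2 : (fun k => normc (q k x) ^+ 2) @ \oo --> normc (v x) ^+ 2 by exact: cvg_normc2.
    elim: r {nn} => [|r IH]; first by under eq_fun do rewrite expr0; rewrite expr0; exact: cvg_cst.
    by under eq_fun do rewrite exprS; rewrite exprS; exact: cvgM.
- by move=> k; exact: measurable_normcX.
- by move=> k x _; exact: nn.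
Qed.

(** Squared tails of size 4^-k make successive partial sums differ by a multiple of 2^-k in L^2,
    which is summable. *)
Lemma fast_tails a (C : R) : (forall s, uniq s -> mass s (md a) <= C) ->
  exists N : nat -> nat, [/\ (forall k, (k <= N k)%N), (forall k, (N k <= N k.+1)%N) &
    forall k s, uniq s -> (forall n, n \in s -> (N k < `|n|)%N) -> mass s (md a) <= (4 ^+ k)^-1].
Proof.
move=> aC; pose S := [set mass (window M) (md a) | M in [set: nat]].
have supS : has_sup S.
  split; first by exists (mass (window 0) (md a)), 0%N.
  by exists C => _ [M _ <-]; exact/aC/window_uniq.
have H k : exists M, forall s, uniq s -> (forall n, n \in s -> (M < `|n|)%N) -> mass s (md a) <= (4 ^+ k)^-1.
  have e0 : 0 < (4 ^+ k)^-1 :> R by rewrite invr_gt0 exprn_gt0.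
  have [_ [M _ <-] HM] := sup_adherent e0 supS; exists M => s us sM.
  pose L := (M + \sum_(n <- s) `|n|)%N.
  have h1 : mass (window M ++ s) (md a) <= mass (window L) (md a).
    apply: ler_sum_subset => [||n]; last by rewrite sqr_ge0.
      rewrite cat_uniq window_uniq us andbT /=; apply/hasPn => n /sM.
      by rewrite mem_window -ltnNge.
    move=> n; rewrite mem_cat !mem_window /L => /orP[nM|ns]; first exact: leq_trans (leq_addr _ _).
    by rewrite (big_rem n)//= addnCA leq_addr.
  have h2 : mass (window L) (md a) <= sup S by apply: sup_upper_bound => //; exists L.
  have e : mass (window M ++ s) (md a) = mass (window M) (md a) + mass s (md a) by rewrite /mass big_cat.
  rewrite -(lerD2l (mass (window M) (md a))) -e (le_trans h1)// (le_trans h2)//.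
  by rewrite -lerBlDr ltW.
(* Cumulative sums of the (M i).+1 are nondecreasing and dominate both k and M k. *)
have [M HM] := choice H; exists (fun k => \sum_(i < k.+1) (M i).+1)%N; split => k.
- elim: k => [//|k IH]; rewrite big_ord_recr /=.
  by apply: leq_trans (leq_add IH (ltn0Sn _)); rewrite addn1.
- by rewrite [leqRHS]big_ord_recr leq_addr.
- move=> s us sN; apply: HM => // n /sN; apply: leq_ltn_trans.
  by rewrite big_ord_recr /= (leq_trans (leqnSn _))// leq_addl.
Qed.

Section Limit.
Variables (a : int -> R[i]) (N : nat -> nat) (C : R).
Hypothesis aC : forall s, uniq s -> mass s (md a) <= C.
Hypothesis Nge : forall k, (k <= N k)%N.
Hypothesis Nmono : forall k, (N k <= N k.+1)%N.
Hypothesis tail : forall k s, uniq s -> (forall n, n \in s -> (N k < `|n|)%N) ->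
  mass s (md a) <= (4 ^+ k)^-1.

Definition partial k := tpoly (window (N k)) a.
Definition shell j k := [seq n <- window (N k) | (N j < `|n|)%N].

Lemma N_le j k : (j <= k)%N -> (N j <= N k)%N.
Proof.
elim: k => [|k IH]; first by rewrite leqn0 => /eqP ->.
by rewrite leq_eqVlt => /predU1P[->//|/IH h]; exact: leq_trans h (Nmono k).
Qed.

Lemma partialB j k x : (j <= k)%N -> partial k x - partial j x = tpoly (shell j k) a x.
Proof.
move=> jk; rewrite /partial /tpoly /shell big_filter (bigID (fun n : int => (N j < `|n|)%N) predT) /=.
rewrite -addrA [X in _ + X](_ : _ = 0) ?addr0//; apply/eqP; rewrite subr_eq0; apply/eqP.
rewrite -big_filter; apply: perm_big; apply: uniq_perm.
- by rewrite filter_uniq// window_uniq.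
- exact: window_uniq.
- move=> n; rewrite mem_filter !mem_window -leqNgt andb_idr// => nj.
  exact: leq_trans nj (N_le jk).
Qed.

Lemma shell_uniq j k : uniq (shell j k). Proof. by rewrite filter_uniq// window_uniq. Qed.

Lemma mass_shell j k : mass (shell j k) (md a) <= (4 ^+ j)^-1.
Proof. by apply: tail; [exact: shell_uniq | move=> n; rewrite mem_filter => /andP[]]. Qed.

(** The inequality |d| <= (2^k |d|^2 + 2^-k) / 2 turns the shell mass 4^-k into an L^1 bound 2 pi
    2^-k. The increments then have a finite summed integral, hence are absolutely summable almost
    everywhere. [f] stands for the real or the imaginary part. *)
Lemma partial_cvg_ae (f : R[i] -> R) : (forall z, `|f z| <= normc z) ->
  (forall z w, f (z - w) = f z - f w) -> (forall s c, continuous (fun x => f (tpoly s c x))) ->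
  {ae mu, forall x, D x -> cvgn (fun k => f (partial k x))}.
Proof.
move=> f1 fB fc.
pose d k x := f (partial k.+1 x) - f (partial k x).
have dE k x : d k x = f (tpoly (shell k k.+1) a x) by rewrite /d -fB partialB.
have md_ k : measurable_fun D (fun x => `|d k x|%:E).
  apply/measurable_EFinP; apply: measurable_funTS; apply: measurableT_comp => //.
  by apply: continuous_measurable_fun; rewrite (funext (dE k)); exact: fc.
have int_d k : (\int[mu]_(x in D) `|d k x|%:E <= (pi *+ 2 / 2 ^+ k)%:E)%E.
  have p0 : 0 < 2 ^+ k :> R by rewrite exprn_gt0.
  apply: (@le_trans _ _ (\int[mu]_(x in D) ((2 ^+ k * normc (tpoly (shell k k.+1) a x) ^+ 2 + (2 ^+ k)^-1) / 2)%:E)%E).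
    apply: ge0_le_integral => //; first exact: md_.
    - apply/measurable_EFinP; apply: measurable_funTS.
      apply: measurable_funM => //; apply: measurable_funD => //; apply: measurable_funM => //.
      by apply: measurable_normc2; exact: cmeasurable_tpoly.
    - move=> x _; rewrite lee_fin dE; apply: le_trans (f1 _) _.
      set y := normc _; rewrite ler_pdivlMr// -subr_ge0.
      have -> : 2 ^+ k * y ^+ 2 + (2 ^+ k)^-1 - y * 2 = (2 ^+ k * y - 1) ^+ 2 / 2 ^+ k.
        by field; rewrite gt_eqF.
      by rewrite divr_ge0 ?sqr_ge0// ltW.
  have cn : continuous (fun x => normc (tpoly (shell k k.+1) a x) ^+ 2).
    under eq_fun do rewrite normc2_tpoly.
    by do 2 (apply: continuous_sumf => ?); exact: continuous_Re_mul_cis.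
  have c1 : continuous (fun x => 2 ^+ k * normc (tpoly (shell k k.+1) a x) ^+ 2 + (2 ^+ k)^-1).
    by move=> x; apply: cvgD; [apply: cvgM; [exact: cvg_cst|exact: cn]|exact: cvg_cst].
  rewrite integral_EFin_seg; last by move=> x; apply: cvgM; [exact: c1|exact: cvg_cst].
  rewrite lee_fin RintegralZr//; last first.
    exact: continuous_integrable_seg.
  rewrite RintegralD//; first last.
  - by apply: continuous_integrable_seg => x; exact: cvg_cst.
  - by apply: continuous_integrable_seg => x; apply: cvgM; [exact: cvg_cst|exact: cn].
  rewrite RintegralZl//; last exact: continuous_integrable_seg.
  rewrite -/(torus R) Rintegral_normc2_tpoly ?shell_uniq// Rintegral_cst// fine_mu_seg ?(ltW (pi2_gt0 R))// subr0.
  rewrite ler_pdivrMr//.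
  have m := mass_shell k k.+1.
  have : 2 ^+ k * (pi *+ 2 * mass (shell k k.+1) (md a)) <= pi *+ 2 / 2 ^+ k.
    rewrite mulrCA ler_pM2l ?pi2_gt0//; apply: le_trans (ler_wpM2l (ltW p0) m) _.
    have e4 : (4 : R) = 2 * 2 by rewrite -natrM.
    by rewrite e4 exprMn invfM mulrA divff ?mul1r// gt_eqF.
  rewrite mulrC [(2 ^+ k)^-1 * _]mulrC; lra.
have Sfin : (\int[mu]_(x in D) (\sum_(k <oo) `|d k x|%:E) < +oo)%E.
  rewrite integral_nneseries//.
  apply: (@le_lt_trans _ _ (\sum_(k <oo) (pi *+ 2 / 2 ^+ k)%:E)%E).
    by apply: lee_nneseries => [k _ _|k _]; [exact: integral_ge0 | exact: int_d].
  have h := @epsilon_trick0 R (pi *+ 2 * 2) xpredT (mulr_ge0 (ltW (pi2_gt0 R)) (ler0n _ 2)).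
  apply: le_lt_trans (ltry _); apply: le_trans h.
  apply: lee_nneseries => [k _ _|k _]; first by rewrite lee_fin divr_ge0 ?exprn_ge0// ltW// pi2_gt0.
  by rewrite lee_fin natrX exprS invfM mulrA mulfK.
have mS : measurable_fun D (fun x => \sum_(k <oo) `|d k x|%:E)%E.
  by apply: ge0_emeasurable_sum => // k x _ _; rewrite lee_fin.
have iS : mu.-integrable D (fun x => \sum_(k <oo) `|d k x|%:E)%E.
  apply/integrableP; split => //; apply: le_lt_trans Sfin.
  apply: ge0_le_integral => //.
  - exact: measurableT_comp.
  - by move=> x _; rewrite gee0_abs// nneseries_ge0// => k _ _; rewrite lee_fin.
have := @integrable_ae _ _ R mu D mD _ iS; move/ae_sub; apply => x H Dx.
have := abs_summable_cvg (_ : (\sum_(k <oo) `|d k x|%:E < +oo)%E).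
move=> /(_ _)/cvg_ex[|l dl].
  by rewrite ltey_eq H.
apply/cvg_ex; exists (f (partial 0 x) + l).
rewrite (_ : (fun k => _) = (fun k => f (partial 0 x) + series (d ^~ x) k)).
  by apply: cvgD => //; exact: cvg_cst.
apply/funext => k; rewrite /series /= telescope_sumr// addrC subrK//.
Qed.

Lemma partial_periodic k x : partial k (x + pi *+ 2) = partial k x.
Proof. by apply: eq_bigr => n _; rewrite cis_periodic. Qed.

Lemma fine_limn_esup (q : nat -> R) (l : R) : q @ \oo --> l -> fine (limn_esup (fun k => (q k)%:E)) = l.
Proof.
move=> ql; have ql' : (fun k => (q k)%:E) @ \oo --> l%:E by apply: cvg_EFin; [exact: nearW|exact: ql].
by have [_ ->] := cvg_limn_einf_sup ql'.
Qed.

(** The upper limit exists at every point, also where the partial sums diverge, so the function is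
    measurable and exactly periodic. *)
Definition plimit x : R[i] :=
  fine (limn_esup (fun k => (complex.Re (partial k x))%:E)) +i*
  fine (limn_esup (fun k => (complex.Im (partial k x))%:E)).

Lemma plimit_lim : ae_lim partial plimit.
Proof.
have hr := partial_cvg_ae (@abs_Re_le R) (fun z w => etrans (cReD z (- w)) (congr1 _ (cReN w))) (@continuous_Re_tpoly R).
have hi := partial_cvg_ae (@abs_Im_le R) (fun z w => etrans (cImD z (- w)) (congr1 _ (cImN w))) (@continuous_Im_tpoly R).
have := ae_and hr hi; move/ae_sub; apply => x [h1 h2] Dx.
have c1 := h1 Dx; have c2 := h2 Dx.
by split; rewrite /plimit /= ?(fine_limn_esup c1) ?(fine_limn_esup c2).
Qed.

Lemma cmeasurable_plimit : cmeasurable plimit.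
Proof.
by split; apply: measurableT_comp => //; apply: measurable_fun_limn_esup => k;
  apply/measurable_EFinP; have [] := cmeasurable_tpoly (window (N k)) a.
Qed.

Lemma fatou_partial v : cmeasurable v -> ae_lim partial v ->
  (\int[mu]_(x in D) (normc (v x) ^+ 2)%:E <= (pi *+ 2 * C)%:E)%E.
Proof.
move=> mv lv; under eq_integral do rewrite -(expr1 (normc _ ^+ 2)).
apply: le_trans (fatou_normc 1 (fun k => cmeasurable_tpoly _ _) mv lv) _.
apply: (limn_einf_le (k0 := 0)) => k _; under eq_integral do rewrite expr1.
rewrite integral_EFin_seg; last first.
  under eq_fun do rewrite normc2_tpoly.
  by do 2 (apply: continuous_sumf => ?); exact: continuous_Re_mul_cis.
rewrite -/(torus R) lee_fin Rintegral_normc2_tpoly ?window_uniq// ler_pM2l ?pi2_gt0//.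
exact/aC/window_uniq.
Qed.

Lemma fatou_partialB v j : cmeasurable v -> ae_lim partial v ->
  (\int[mu]_(x in D) (normc (v x - partial j x) ^+ 2)%:E <= (pi *+ 2 * (4 ^+ j)^-1)%:E)%E.
Proof.
move=> mv lv; under eq_integral do rewrite -(expr1 (normc _ ^+ 2)).
have mB u : cmeasurable u -> cmeasurable (fun x => u x - partial j x).
  by move=> mu_; apply: cmeasurableB => //; exact: cmeasurable_tpoly.
apply: le_trans (fatou_normc 1 (fun k => mB _ (cmeasurable_tpoly _ _)) (mB _ mv) (ae_limB (partial j) lv)) _.
apply: (limn_einf_le (k0 := j)) => k jk.
under eq_integral do rewrite expr1 -/(partial k _) partialB//.
rewrite integral_EFin_seg; last first.
  under eq_fun do rewrite normc2_tpoly.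
  by do 2 (apply: continuous_sumf => ?); exact: continuous_Re_mul_cis.
rewrite -/(torus R) lee_fin Rintegral_normc2_tpoly ?shell_uniq// ler_pM2l ?pi2_gt0//.
exact: mass_shell.
Qed.

Lemma L2_ae_lim v : cmeasurable v -> periodic v (pi *+ 2) -> ae_lim partial v -> L2 v.
Proof. by move=> mv pv lv; split => //; apply: le_lt_trans (fatou_partial mv lv) (ltry _). Qed.

(** Bessel's inequality for the single frequency n, applied to v minus its partial sum of index j >=
    |n|: the squared difference of the two coefficients is at most 4^-j for all such j. *)
Lemma fourier_ae_lim v n : L2 v -> ae_lim partial v -> fourier v n = a n.
Proof.
move=> Lv lv; have mv := L2_measurable Lv; apply/eqP; rewrite -subr_eq0.
apply/eqP/eq0_normc/eqP; apply: contraT => nz.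
have p : 0 < normc (fourier v n - a n) ^+ 2 by rewrite exprn_gt0// lt0r nz normc_ge0.
suff [j nj lj] : exists2 j, (`|n| <= j)%N & (4 ^+ j)^-1 < normc (fourier v n - a n) ^+ 2.
  have LB := L2B Lv (L2_tpoly (window (N j)) a).
  have := bessel LB (isT : uniq [:: n]); rewrite /mass big_seq1 /md fourierB//; last exact: L2_tpoly.
  rewrite fourier_tpoly ?window_uniq ?mem_window ?(leq_trans nj)//.
  have := fatou_partialB j mv lv; have := integrable_normc2 LB => /integrable_fin_num h.
  rewrite -[X in (X <= _)%E]fineK; last exact: h.
  rewrite lee_fin => h1 h2; have := le_trans h2 h1.
  by rewrite ler_pM2l ?pi2_gt0// leNgt lj.
pose e := normc (fourier v n - a n) ^+ 2.
exists (`|n| + Num.truncn e^-1).+1; first by rewrite leqW// leq_addr.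
rewrite invf_plt ?posrE//.
apply: lt_le_trans (truncnS_gt _) _.
rewrite -natrX ler_nat; apply: leq_trans (ltnW (ltn_expl _ (isT : (1 < 4)%N))).
by rewrite ltnS leq_addl.
Qed.

Lemma riesz_fischer : exists v, [/\ L2 v, (forall n, fourier v n = a n) & ae_lim partial v].
Proof.
have L : L2 plimit.
  apply: L2_ae_lim plimit_lim; first exact: cmeasurable_plimit.
  move=> x; rewrite /plimit; congr (fine (limn_esup _) +i* fine (limn_esup _));
  by apply/funext => k; rewrite partial_periodic.
by exists plimit; split; [|move=> n; exact: fourier_ae_lim plimit_lim|exact: plimit_lim].
Qed.

End Limit.
End RieszFischer.

(** * Completeness of the trigonometric system *)

Lemma bernoulli_lower (R : realFieldType) (t : R) m : 0 <= t <= 1 -> 1 - m%:R * t <= (1 - t) ^+ m.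
Proof.
move=> /andP[t0 t1]; elim: m => [|m IH]; first by rewrite mul0r subr0 expr0.
have mt : 0 <= (m%:R * t) * t by rewrite !mulr_ge0.
rewrite exprS; apply: le_trans (ler_wpM2l _ IH); last by rewrite subr_ge0.
rewrite -natr1; lra.
Qed.

Lemma bernoulli_upper (R : realFieldType) (t : R) m : 0 <= t <= 1 -> (1 - t) ^+ m * (1 + m%:R * t) <= 1.
Proof.
move=> /andP[t0 t1]; elim: m => [|m IH]; first by rewrite mul0r addr0 expr0 mul1r.
apply: le_trans IH; rewrite exprSr -mulrA ler_wpM2l ?exprn_ge0 ?subr_ge0//.
have mt : 0 <= (m%:R * t) * t by rewrite !mulr_ge0.
have tt : 0 <= t * t by rewrite mulr_ge0.
rewrite -natr1; lra.
Qed.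

(** The Brosowski-Deutsch polynomials from the elementary proof of the Stone-Weierstrass theorem: a
    step at 1/2. Bernoulli's inequality bounds them below by 1 - (2 z)^n and above by (2 z)^-n. *)
Definition bump (R : realType) n (z : R) := (1 - z ^+ n) ^+ (2 ^ n).

Section Bump.
Variable R : realType.
Implicit Types z : R.

Lemma bump_itv n z : 0 <= z <= 1 -> 0 <= bump n z <= 1.
Proof.
move=> /andP[z0 z1]; have h : 0 <= z ^+ n <= 1 by rewrite exprn_ge0 ?exprn_ile1.
by rewrite /bump exprn_ge0 ?exprn_ile1//; lra.
Qed.

Lemma bump_cvg1 z : 0 <= z < 2^-1 -> bump n z @[n --> \oo] --> (1 : R).
Proof.
move=> /andP[z0 z1]; have z2 : `|2 * z| < 1 by rewrite ger0_norm ?mulr_ge0//; lra.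
apply: (@squeeze_cvgr _ _ _ _ (fun n => 1 - (2 * z) ^+ n) (cst 1)).
- apply: nearW => n; have h : 0 <= z ^+ n <= 1 by rewrite exprn_ge0 ?exprn_ile1//; lra.
  have zb : 0 <= z <= 1 by lra.
  have /andP[_ ->] := bump_itv n zb; rewrite andbT.
  by have := bernoulli_lower (2 ^ n) h; rewrite natrX -exprMn.
- by rewrite -[X in _ --> X]subr0; apply: cvgB; [exact: cvg_cst|exact: cvg_expr].
- exact: cvg_cst.
Qed.

Lemma bump_cvg0 z : 2^-1 < z <= 1 -> bump n z @[n --> \oo] --> (0 : R).
Proof.
move=> /andP[z0 z1]; have z2 : 1 < 2 * z by lra.
have z3 : `|(2 * z)^-1| < 1 by rewrite ger0_norm ?invr_ge0 ?invf_lt1//; lra.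
apply: (@squeeze_cvgr _ _ _ _ (cst 0) (fun n => (2 * z)^-1 ^+ n)).
- apply: nearW => n; have zb : 0 <= z <= 1 by lra.
  have h : 0 <= z ^+ n <= 1 by rewrite exprn_ge0 ?exprn_ile1//; lra.
  have /andP[-> b1] := bump_itv n zb; rewrite /=.
  have := bernoulli_upper (2 ^ n) h; rewrite natrX -exprMn -/(bump n z) => b2.
  have p : 0 < (2 * z) ^+ n by rewrite exprn_gt0//; lra.
  rewrite exprVn -[leRHS]mul1r ler_pdivlMr//; apply: le_trans b2.
  by have /andP[b0 _] := bump_itv n zb; rewrite ler_wpM2l// lerDr.
- exact: cvg_cst.
- exact: cvg_expr.
Qed.

End Bump.

Section Completeness.
Variable R : realType.
Notation mu := (@lebesgue_measure R).
Notation D := (torus R).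
Implicit Types (f g : R -> R) (x : R) (z : R[i]).

Let mD : measurable D := @measurable_torus R.

Definition harmonic z (n : int) x := complex.Re (z * cis (n%:~R * x)).

Lemma measurable_harmonic z n : measurable_fun setT (harmonic z n).
Proof. by apply: continuous_measurable_fun; exact: continuous_Re_mul_cis. Qed.

Lemma harmonic_le z n x : `|harmonic z n x| <= normc z.
Proof. by apply: le_trans (abs_Re_le _) _; rewrite normcM normc_cis mulr1. Qed.

Lemma harmonicM z w m n x : harmonic z m x * harmonic w n x =
  2^-1 * harmonic (z * w) (m + n) x + 2^-1 * harmonic (z * Num.conj w) (m - n) x.
Proof.
rewrite /harmonic rmorphD rmorphB /= mulrDl mulrBl !cisD -conj_cis.
set p := cis _; set q := cis _.
by rewrite !(cReM, cImM, cReJ, cImJ); field.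
Qed.

(** Orthogonality of f g to every harmonic, rather than a vanishing integral of f g, is stable under
    multiplying g by harmonics; induction then reaches all powers of trigonometric polynomials. *)
Definition annihilates f g := [/\ measurable_fun setT g, exists C, forall x, `|g x| <= C &
  forall n z, \int[mu]_(x in D) (f x * (g x * harmonic z n x)) = 0].

Section Annihilator.
Variable f : R -> R.
Hypothesis mf : measurable_fun setT f.
Hypothesis fi : mu.-integrable D (EFin \o f).

Lemma integrable_mul_bounded g C : measurable_fun setT g -> (forall x, `|g x| <= C) ->
  mu.-integrable D (EFin \o (fun x => f x * g x)).
Proof.
move=> mg gC; have i2 : mu.-integrable D (fun x => C%:E * (f x)%:E)%E by exact: integrableZl.
apply: le_integrable i2 => //.
  by apply/measurable_EFinP; apply: measurable_funTS; exact: measurable_funM.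
move=> x _ /=; rewrite lee_fin !normrM mulrC ler_wpM2r//.
exact: le_trans (gC x) (ler_norm _).
Qed.

Lemma integrable_annihilates g n z : annihilates f g ->
  mu.-integrable D (EFin \o (fun x => f x * (g x * harmonic z n x))).
Proof.
move=> [mg [C gC] _]; apply: (@integrable_mul_bounded _ (C * normc z)).
  by apply: measurable_funM => //; exact: measurable_harmonic.
by move=> x; rewrite normrM ler_pM ?harmonic_le.
Qed.

Lemma annihilatesD g h : annihilates f g -> annihilates f h -> annihilates f (fun x => g x + h x).
Proof.
move=> ag ah; case: (ag) => mg [C gC] g0; case: (ah) => mh [C' hC] h0; split.
- exact: measurable_funD.
- by exists (C + C') => x; apply: le_trans (ler_normD _ _) _; exact: lerD.
- move=> n z; under eq_Rintegral do rewrite mulrDl mulrDr.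
  by rewrite RintegralD ?g0 ?h0 ?addr0//; exact: integrable_annihilates.
Qed.

Lemma annihilatesZ (c : R) g : annihilates f g -> annihilates f (fun x => c * g x).
Proof.
move=> ag; case: (ag) => mg [C gC] g0; split.
- by apply: measurable_funM => //; exact: measurable_cst.
- by exists (`|c| * C) => x; rewrite normrM ler_wpM2l.
- move=> n z; under eq_Rintegral do rewrite -mulrA mulrCA.
  by rewrite RintegralZl ?g0 ?mulr0//; exact: integrable_annihilates.
Qed.

Lemma annihilates_harmonic w m g : annihilates f g -> annihilates f (fun x => harmonic w m x * g x).
Proof.
move=> ag; case: (ag) => mg [C gC] g0; split.
- by apply: measurable_funM => //; exact: measurable_harmonic.
- by exists (normc w * C) => x; rewrite normrM ler_pM ?harmonic_le.
- move=> n z.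
  have e x : f x * (harmonic w m x * g x * harmonic z n x) =
     2^-1 * (f x * (g x * harmonic (w * z) (m + n) x)) + 2^-1 * (f x * (g x * harmonic (w * Num.conj z) (m - n) x)).
    by rewrite mulrAC harmonicM; ring.
  under eq_Rintegral do rewrite e.
  have ia k y := integrable_annihilates k y ag.
  have iz k y : mu.-integrable D (EFin \o (fun x => 2^-1 * (f x * (g x * harmonic y k x)))).
    rewrite (_ : EFin \o _ = (fun x => (2^-1)%:E * (f x * (g x * harmonic y k x))%:E)%E); first by apply: integrableZl => //; exact: ia.
    by apply/funext => x /=; rewrite EFinM.
  by rewrite RintegralD// !RintegralZl// !g0 mulr0 addr0.
Qed.

Hypothesis f_orth : forall n z, \int[mu]_(x in D) (f x * harmonic z n x) = 0.

Lemma annihilates1 : annihilates f (fun=> 1).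
Proof.
split; [exact: measurable_cst|by exists 1 => x; rewrite normr1|move=> n z].
by under eq_Rintegral do rewrite mul1r.
Qed.

(** A trigonometric polynomial of degree one with values in [0, 1], below 1/2 on (0, b) and above
    1/2 on (b, 2 pi). Composed with [bump] it tends to the indicator of the arc. *)
Definition arcfun b x := 2^-1 - 4^-1 * (sin (x / 2) * sin ((b - x) / 2)).

Lemma arcfunE b x : arcfun b x = (2^-1 + 8^-1 * cos (b / 2)) + harmonic (- (8^-1)%:C * cis (- (b / 2))) 1 x.
Proof.
rewrite /harmonic /arcfun mul1r -mulrA -cisD mulNr cReN Re_realM /=.
rewrite (_ : - (b / 2) + x = x / 2 - (b - x) / 2); last by field.
rewrite (_ : b / 2 = x / 2 + (b - x) / 2); last by field.
by rewrite cosB cosD; field.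
Qed.

Lemma arcfun_itv b x : 0 <= arcfun b x <= 1.
Proof.
have : `|sin (x / 2) * sin ((b - x) / 2)| <= 1 by rewrite normrM mulr_ile1 ?sin_max.
by rewrite ler_norml /arcfun => /andP[h1 h2]; lra.
Qed.

Lemma annihilates_arcM b g : annihilates f g -> annihilates f (fun x => arcfun b x * g x).
Proof.
move=> ag; have h := annihilatesD (annihilatesZ (2^-1 + 8^-1 * cos (b / 2)) ag)
  (annihilates_harmonic (- (8^-1)%:C * cis (- (b / 2))) 1 ag).
by under eq_fun do rewrite arcfunE mulrDl.
Qed.

Lemma annihilates_bumpM b n g : annihilates f g -> annihilates f (fun x => (1 - arcfun b x ^+ n) * g x).
Proof.
move=> ag; have h : annihilates f (fun x => arcfun b x ^+ n * g x).
  elim: n => [|n IH]; first by under eq_fun do rewrite expr0 mul1r.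
  by under eq_fun do rewrite exprS -mulrA; exact: annihilates_arcM.
have := annihilatesD ag (annihilatesZ (-1) h).
by under eq_fun do rewrite mulN1r -[X in X - _]mul1r -mulrBl.
Qed.

Lemma annihilates_bump b n : annihilates f (fun x => bump n (arcfun b x)).
Proof.
rewrite /bump; elim: (2 ^ n)%N => [|m IH]; first by under eq_fun do rewrite expr0; exact: annihilates1.
by under eq_fun do rewrite exprS; exact: annihilates_bumpM.
Qed.

Lemma Rintegral_bump b n : \int[mu]_(x in D) (f x * bump n (arcfun b x)) = 0.
Proof.
have [_ _ h] := annihilates_bump b n; rewrite -[RHS](h 0 1).
by apply: eq_Rintegral => x _; rewrite /harmonic mul0r mul1r /= cos0 mulr1.
Qed.

Lemma bump_arc_cvg b x : 0 <= b <= pi *+ 2 -> 0 < x < pi *+ 2 -> x != b ->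
  bump n (arcfun b x) @[n --> \oo] --> ((x \in `[0, b])%:R : R).
Proof.
move=> /andP[b0 b1] /andP[x0 x1] xb; have /andP[a0 a1] := arcfun_itv b x.
have s1 : 0 < sin (x / 2) by apply: sin_gt0_pi; move: x0 x1; rewrite mulr2n; lra.
rewrite in_itv /= (ltW x0) /=.
have [xlb|bx|e] := ltgtP x b; last by rewrite e eqxx in xb.
- have s2 : 0 < sin ((b - x) / 2) by apply: sin_gt0_pi; move: b1 x0 x1; rewrite mulr2n; lra.
  apply: bump_cvg1; rewrite a0 /= /arcfun.
  by have := mulr_gt0 s1 s2; lra.
- have s2 : 0 < sin ((x - b) / 2) by apply: sin_gt0_pi; move: b0 x0 x1; rewrite mulr2n; lra.
  apply: bump_cvg0; rewrite a1 andbT /arcfun.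
  rewrite (_ : (b - x) / 2 = - ((x - b) / 2)); last by field.
  by rewrite sinN; have := mulr_gt0 s1 s2; lra.
Qed.

Lemma Rintegral_initial_seg b : 0 <= b <= pi *+ 2 -> \int[mu]_(x in `[0, b]) f x = 0.
Proof.
move=> b01; pose q n x := (f x * bump n (arcfun b x))%:E.
pose l x := (f x * (x \in `[0, b])%:R)%:E.
have mbump n : measurable_fun setT (fun x => bump n (arcfun b x)) by case: (annihilates_bump b n).
have mq n : measurable_fun D (q n).
  by apply/measurable_EFinP; apply: measurable_funTS; exact: measurable_funM.
have ml : measurable_fun D l.
  apply/measurable_EFinP; apply: measurable_funTS; apply: measurable_funM => //.
  rewrite (_ : (fun x => _) = \1_`[0, b]%classic); first exact: measurable_indic.
  by apply/funext => x; rewrite indicE mem_setE.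
(* At 0, b and 2 pi [arcfun] equals 1/2, where the bumps do not tend to the indicator; these points
   form a null set. *)
have ql : {ae mu, forall x, D x -> q ^~ x @ \oo --> l x}.
  have n1 (c : R) : mu.-negligible [set c] by exists [set c]; split => //; exact: lebesgue_measure_set1.
  have n3 : mu.-negligible [set 0; b; pi *+ 2].
    by apply: negligibleU; [apply: negligibleU|]; exact: n1.
  apply: negligibleS n3 => x /= /not_implyP[Dx xl].
  apply: contrapT => nx; apply: xl; apply: cvg_EFin; first exact: nearW.
  apply: cvgM; first exact: cvg_cst.
  apply: bump_arc_cvg => //; last by apply/eqP => e; apply: nx; left; right.
  move: Dx; rewrite /torus /= in_itv /= => /andP[x0 x1].
  rewrite !lt_neqAle x0 x1 !andbT; apply/andP; split; apply/eqP => e; apply: nx.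
    by left; left.
  by right.
have fn : mu.-integrable D (fun x => `|f x|%:E) by exact: integrable_norm.
have qf : {ae mu, forall x n, D x -> (`|q n x| <= `|f x|%:E)%E}.
  apply: aeW => x n _; rewrite lee_fin normrM ler_piMr//.
  by rewrite ger0_norm; have /andP[h1 h2] := bump_itv n (arcfun_itv b x).
have [il _] := @dominated_convergence _ _ R mu D mD q l _ mq ml ql fn qf.
have -> : [sequence (\int[mu]_(x in D) q n x)%E]_n = cst (0 : \bar R)%E.
  apply/funext => n /=; rewrite -[LHS]fineK.
    by congr (_%:E); exact: Rintegral_bump.
  apply: integrable_fin_num => //; apply: (@integrable_mul_bounded _ 1) => // x.
  by rewrite ger0_norm; have /andP[] := bump_itv n (arcfun_itv b x).
move=> /(cvg_unique _) /(_ (cvg_cst _)) l0.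
have -> : `[0, b]%classic = D `&` `[0, b].
  apply/seteqP; split => x; rewrite /torus /= !in_itv /=; last by case.
  by move=> /andP[-> xb]; rewrite xb; case/andP: b01 => _ /(le_trans xb).
rewrite Rintegral_mkcondr /Rintegral.
rewrite (_ : integral _ _ _ = 0%E)//; apply: etrans (l0 (@ereal_hausdorff R)); apply: eq_integral => x _.
rewrite /l patchE mem_setE; case: ifP => _; by rewrite ?mulr1 ?mulr0.
Qed.

(** Extended by zero outside the torus, f has a primitive that vanishes identically; Lebesgue's
    differentiation theorem gives f = 0 almost everywhere. *)
Lemma ae_zero : {ae mu, forall x, D x -> f x = 0}.
Proof.
pose g := f \_ D.
have ig : mu.-integrable setT (EFin \o g).
  by move: fi; rewrite integrable_mkcond//= (restrict_EFin f).
have F0 y : \int[mu]_(t in `]-oo, y]) g t = 0.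
  rewrite -Rintegral_mkcondr; have [y0|y0] := ltP y 0.
    rewrite (_ : _ `&` _ = set0) ?Rintegral_set0//; apply/seteqP; split => x //=.
    by rewrite /torus /= !in_itv /= => -[xy /andP[x0 _]]; move: (le_lt_trans (le_trans x0 xy) y0); rewrite ltxx.
  have [y1|y1] := leP y (pi *+ 2).
    rewrite (_ : _ `&` _ = `[0, y]%classic) ?Rintegral_initial_seg ?y0//.
    apply/seteqP; split => x; rewrite /torus /= !in_itv /=; first by move=> [xy /andP[-> _]].
    by move=> /andP[-> xy]; rewrite (le_trans xy y1).
  rewrite (_ : _ `&` _ = `[0, pi *+ 2]%classic) ?Rintegral_initial_seg ?lexx ?ltW ?pi2_gt0//.
  apply/seteqP; split => x; rewrite /torus /= !in_itv /=; first by move=> [].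
  by move=> /andP[-> xy]; rewrite xy (le_trans xy (ltW y1)).
have igy y : mu.-integrable `]-oo, y] (EFin \o g) by apply: integrableS ig => //; exact: measurable_itv.
have /= := FTC1Ny igy (integrable_locally mD fi).
move/ae_sub; apply => x [_ e] Dx.
have : g x = 0.
  rewrite -e (_ : (fun x => _) = cst 0); last by apply/funext => y; exact: F0.
  exact: derive1_cst.
by rewrite /g patchE mem_set.
Qed.

End Annihilator.
(** The factor [c] treats real and imaginary parts together, through c = 1 and c = 'i. A real part
    times a harmonic of frequency n combines the coefficients of w at n and -n. *)
Lemma ae_Re_zero (c : R[i]) (w : R -> R[i]) : L2 w -> (forall n, fourier w n = 0) ->
  {ae mu, forall x, D x -> complex.Re (c * w x) = 0}.
Proof.
move=> Lw w0; have [mr mi] := L2_measurable Lw.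
have c0 n z : mu.-integrable D (EFin \o (fun x => complex.Re (z * (cis (- (n%:~R * x)) * w x)))).
  by have := integrable_Re_cis n z Lw; under eq_fun do rewrite -mulrA.
have i0 n z : \int[mu]_(x in D) complex.Re (z * (cis (- (n%:~R * x)) * w x)) = 0.
  by rewrite Re_fourier// w0 mulr0 /= mulr0.
apply: (ae_zero (f := fun x => complex.Re (c * w x))).
- by under eq_fun do rewrite cReM; apply: measurable_funB; apply: measurable_funM => //; exact: measurable_cst.
- have := c0 0 c; rewrite (_ : (fun x => complex.Re _) = (fun x => complex.Re (c * w x)))//.
  apply/funext => x; rewrite mul0r oppr0.
  by rewrite (_ : cis 0 = 1) ?mul1r// /cis cos0 sin0.
- move=> n z.
  have e x : complex.Re (c * w x) * harmonic z n x =
    2^-1 * complex.Re (c * z * (cis (- ((- n)%:~R * x)) * w x)) +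
    2^-1 * complex.Re (c * Num.conj z * (cis (- (n%:~R * x)) * w x)).
    rewrite /harmonic rmorphN mulNr opprK -conj_cis; set p := cis _.
    by rewrite !(cReM, cImM, cReJ, cImJ); field.
  under eq_Rintegral do rewrite e.
  have iz k y : mu.-integrable D (EFin \o (fun x => 2^-1 * complex.Re (y * (cis (- (k%:~R * x)) * w x)))).
    rewrite (_ : EFin \o _ = (fun x => (2^-1)%:E * (complex.Re (y * (cis (- (k%:~R * x)) * w x)))%:E)%E).
      by apply: integrableZl => //; exact: c0.
    by apply/funext => x /=; rewrite EFinM.
  rewrite RintegralD ?RintegralZl//.
  by rewrite !i0 mulr0 addr0.
Qed.

Lemma fourier_inj (u v : R -> R[i]) : L2 u -> L2 v -> (forall n, fourier u n = fourier v n) ->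
  {ae mu, forall x, D x -> u x = v x}.
Proof.
move=> Lu Lv uv; have Lw := L2B Lu Lv.
have w0 n : fourier (fun x => u x - v x) n = 0 by rewrite fourierB// uv subrr.
have := ae_and (ae_Re_zero 1 Lw w0) (ae_Re_zero 'i Lw w0).
move/ae_sub; apply => x [h1 h2] Dx; apply/eqP; rewrite -subr_eq0; apply/eqP.
apply: eq_complex_Re => z; rewrite mulr0 /=.
have := h1 Dx; have := h2 Dx; rewrite mul1r cReM mul0r mul1r sub0r => /eqP.
by rewrite oppr_eq0 => /eqP b a; rewrite cReM a b !mulr0 subrr.
Qed.

End Completeness.

(** * Time integrals along the evolution *)

(* No measurability is required: the integral of a nonnegative function is the
   supremum of the integrals of the simple functions below it. *)
Lemma ge0_le_integral_any d (T : measurableType d) (R : realType) (mu : {measure set T -> \bar R})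
  (D : set T) (f g : T -> \bar R) : (forall x, D x -> (0 <= f x)%E) ->
  (forall x, D x -> (f x <= g x)%E) -> (\int[mu]_(x in D) f x <= \int[mu]_(x in D) g x)%E.
Proof.
move=> f0 fg; have g0 x : D x -> (0 <= g x)%E by move=> Dx; apply: le_trans (fg x Dx); exact: f0.
rewrite !ge0_integralE//; apply: ereal_sup_le => _ [h hf <-]; exists h => // x.
apply: le_trans (hf x) _; rewrite !patchE; case: ifPn => // /set_mem; exact: fg.
Qed.

(** Young's inequality (p + q)^2 <= (1 + e) p^2 + (1 + e^-1) q^2, used twice. The constant in front
    of x^4 can be brought close to 1 at the expense of the one in front of y^4. *)
Lemma fourth_power_le (R : realFieldType) (e x y z : R) : 0 < e -> 0 <= z -> z <= x + y ->
  z ^+ 4 <= (1 + e) ^+ 3 * x ^+ 4 + (1 + e^-1) ^+ 3 * y ^+ 4.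
Proof.
move=> e0 z0 zxy.
have young (p q : R) : (p + q) ^+ 2 <= (1 + e) * p ^+ 2 + (1 + e^-1) * q ^+ 2.
  rewrite -subr_ge0 (_ : _ - _ = (e * p - q) ^+ 2 / e); last by field; rewrite gt_eqF.
  by rewrite divr_ge0 ?sqr_ge0// ltW.
have i0 : 0 < e^-1 by rewrite invr_gt0.
have h1 : z ^+ 2 <= (x + y) ^+ 2 by rewrite ler_sqr ?nnegrE// (le_trans z0).
have h2 : (z ^+ 2) ^+ 2 <= ((1 + e) * x ^+ 2 + (1 + e^-1) * y ^+ 2) ^+ 2.
  rewrite ler_sqr ?nnegrE ?sqr_ge0//; first exact: le_trans (young x y).
  by rewrite addr_ge0// mulr_ge0 ?sqr_ge0//; lra.
have := young ((1 + e) * x ^+ 2) ((1 + e^-1) * y ^+ 2).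
move/(le_trans h2) => h3; rewrite (_ : z ^+ 4 = (z ^+ 2) ^+ 2); last by rewrite -exprM.
by apply: le_trans h3 _; rewrite le_eqVlt; apply/orP; left; apply/eqP; set f := e^-1; ring.
Qed.

Section Minorant.
Variables (R : realFieldType) (k d x : R).
Hypotheses (k0 : 0 < k) (d0 : 0 < d).

(** The inequality x <= k f + d h solved for f: it yields a lower bound for f that is measurable
    whenever x and h are, whatever is known of f. *)
Definition minorant (h : \bar R) : \bar R := maxe 0%E ((k^-1)%:E * (x%:E - d%:E * h))%E.

Let dy : (d%:E * +oo = +oo)%E. Proof. by rewrite mulry gtr0_sg ?mul1e. Qed.
Let ky : ((k^-1)%:E * (x%:E - +oo) = -oo)%E.
Proof. by rewrite /= mulrNy gtr0_sg ?invr_gt0// mul1e. Qed.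

Lemma minorant_le (f h : \bar R) : (0 <= f)%E -> (0 <= h)%E -> (x%:E <= k%:E * f + d%:E * h)%E ->
  (minorant h <= f)%E.
Proof.
move=> f0 h0 xfh; rewrite /minorant ge_max f0 /=; move: f h f0 h0 xfh => [f| |] [h| |]//= f0 h0.
- rewrite -?EFinM -?EFinB -?EFinM -?EFinD !lee_fin => H.
  by rewrite ler_pdivrMl// lerBlDr.
- by move=> _; rewrite dy ky leNye.
- by move=> _; rewrite leey.
- by move=> _; rewrite leey.
Qed.

Lemma le_minorant (h : \bar R) : (0 <= h)%E -> (x%:E <= k%:E * minorant h + d%:E * h)%E.
Proof.
case: h => [h| |]//= h0.
- rewrite /minorant -?EFinM -?EFinB -?EFinM -EFin_max -?EFinM -?EFinD lee_fin -lerBlDr.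
  by rewrite -ler_pdivrMl// le_max lexx orbT.
- by rewrite /minorant dy ky maxeNy mule0 add0e leey.
Qed.

End Minorant.

Section TimeIntegrals.
Variable R : realType.
Notation mu := (@lebesgue_measure R).
Notation D := (torus R).
Implicit Types (s : seq int) (a c : int -> R[i]) (u v : R -> R[i]) (t x B : R).

Let mD : measurable D := @measurable_torus R.

Lemma ae_lim_shift (q : nat -> R -> R[i]) v M : ae_lim q v -> ae_lim (fun k => q (k + M)%N) v.
Proof.
move/ae_sub; apply => x h Dx; have [hr hi] := h Dx.
by split; [rewrite -(cvg_shiftn M) in hr|rewrite -(cvg_shiftn M) in hi].
Qed.

Lemma mass_evolve s a t : mass s (md (evolve t a)) = mass s (md a).
Proof. by apply: eq_bigr => n _; rewrite /md /evolve normcM normc_cis mul1r. Qed.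

Lemma integral_normc4_tpoly s a t :
  (\int[mu]_(x in D) ((normc (tpoly s (evolve t a) x) ^+ 2) ^+ 2)%:E)%E = (l4 s a t)%:E.
Proof.
under eq_integral do rewrite -exprM; rewrite integral_EFin_seg//.
under eq_fun do rewrite normc4_tpoly.
by do 4 (apply: continuous_sumf => ?); exact: continuous_Re_mul_cis.
Qed.

Lemma integral_l4 s a B : 0 < B ->
  (\int[mu]_(t in `[0%R, B]) (l4 s a t)%:E)%E = (pi *+ 2 * B * wq (kern B) s a)%:E.
Proof. by move=> B0; rewrite integral_EFin_seg ?Rintegral_l4//; exact: continuous_l4. Qed.

Lemma l4_ge0 s a t : 0 <= l4 s a t.
Proof. by apply: Rintegral_ge0 => x _; rewrite exprn_ge0// normc_ge0. Qed.

Lemma measurable_l4 s a (T : set R) : measurable_fun T (fun t => (l4 s a t)%:E).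
Proof.
by apply/measurable_EFinP; apply: measurable_funTS; apply: continuous_measurable_fun; exact: continuous_l4.
Qed.

(** A measurable function of [t] that dominates the fourth-power integral of the limit, by Fatou's
    lemma in x. *)
Definition einf_l4 (S : nat -> seq int) a t := limn_einf (fun k => (l4 (S k) a t)%:E).

Lemma einf_l4_ge0 S a t : (0 <= einf_l4 S a t)%E.
Proof.
rewrite /einf_l4 limn_einf_lim; apply: lime_ge; first exact: is_cvg_einfs.
by apply: nearW => n; apply: le_ereal_inf_tmp => _ [k _ <-]; rewrite lee_fin l4_ge0.
Qed.

Lemma measurable_einf_l4 S a (T : set R) : measurable_fun T (einf_l4 S a).
Proof.
rewrite /einf_l4 /limn_einf; apply: measurableT_comp => //.
apply: measurable_fun_limn_esup => k; apply: measurableT_comp => //; exact: measurable_l4.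
Qed.

Lemma integral_einf_l4_le S a B (C : R) k0 : 0 < B ->
  (forall k, (k0 <= k)%N -> wq (kern B) (S k) a <= C) ->
  (\int[mu]_(t in `[0%R, B]) einf_l4 S a t <= (pi *+ 2 * B * C)%:E)%E.
Proof.
move=> B0 SC; apply: (@le_trans _ _ (limn_einf (fun k => \int[mu]_(t in `[0%R, B]) (l4 (S k) a t)%:E))%E).
  apply: (@fatou _ _ R mu _ _ (fun k t => (l4 (S k) a t)%:E)) => //.
  - by move=> k; exact: measurable_l4.
  - by move=> k t _; rewrite lee_fin l4_ge0.
apply: (limn_einf_le (k0 := k0)) => k kk; rewrite integral_l4// lee_fin ler_wpM2l ?SC//.
by rewrite mulr_ge0// ltW// pi2_gt0.
Qed.

Section Evolution.
Variables (u : R -> R[i]) (a : int -> R[i]) (N : nat -> nat) (C : R).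
Hypothesis ua : forall n, fourier u n = a n.
Hypothesis aC : forall s, uniq s -> mass s (md a) <= C.
Hypothesis Nge : forall k, (k <= N k)%N.
Hypothesis Nmono : forall k, (N k <= N k.+1)%N.
Hypothesis tail : forall k s, uniq s -> (forall n, n \in s -> (N k < `|n|)%N) ->
  mass s (md a) <= (4 ^+ k)^-1.

(** Riesz-Fischer excludes the default value of [xget], and injectivity of the Fourier coefficients
    identifies the selected representative with the limit of the partial sums. The flow preserves
    moduli of coefficients, so one sequence [N] serves every t. *)
Lemma schrodinger_lim t : L2 (schrodinger t u) /\ ae_lim (partial (evolve t a) N) (schrodinger t u).
Proof.
have [v [Lv va lv]] : exists v, [/\ L2 v, (forall n, fourier v n = evolve t a n) &
    ae_lim (partial (evolve t a) N) v].
  apply: (@riesz_fischer R (evolve t a) N C) => // [s|k s] us; rewrite mass_evolve; first exact: aC.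
  exact: tail.
have [Ls sa] : L2 (schrodinger t u) /\
    forall n : int, fourier (schrodinger t u) n = cis (- (n%:~R ^+ 2 * t)) * fourier u n.
  by apply: (@xgetPex _ (fun=> 0) [set w | L2 w /\
    forall n : int, fourier w n = cis (- (n%:~R ^+ 2 * t)) * fourier u n]); exists v; split=> // n; rewrite va ua.
split => //; have vs : {ae mu, forall x, D x -> v x = schrodinger t u x}.
  by apply: fourier_inj => // n; rewrite va sa ua.
have := ae_and vs lv; move/ae_sub; apply => x [e h] Dx.
by rewrite -e//; exact: h.
Qed.

Definition fourth t := (\int[mu]_(x in D) (normc (schrodinger t u x) ^+ 4)%:E)%E.

Lemma fourth_ge0 t : (0 <= fourth t)%E.
Proof. by apply: integral_ge0 => x _; rewrite lee_fin exprn_ge0// normc_ge0. Qed.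

Lemma fourth_le t : (fourth t <= einf_l4 (fun k => window (N k)) a t)%E.
Proof.
have [Ls ls] := schrodinger_lim t.
rewrite /fourth; under eq_integral do rewrite (exprM _ 2 2).
apply: le_trans (fatou_normc 2 (fun k => cmeasurable_tpoly _ _) (L2_measurable Ls) ls) _.
by under eq_fun do rewrite integral_normc4_tpoly.
Qed.

Lemma W_le B (j : R) : 0 < B -> (forall s, uniq s -> wq (kern B) s a <= j) ->
  (W B u <= (pi *+ 2 * B * j)%:E)%E.
Proof.
move=> B0 aj; apply: (@le_trans _ _ (\int[mu]_(t in `[0%R, B]) einf_l4 (fun k => window (N k)) a t)%E).
  by apply: ge0_le_integral_any => t _; [exact: fourth_ge0|exact: fourth_le].
by apply: (integral_einf_l4_le (k0 := 0)) => // k _; apply: aj; exact: window_uniq.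
Qed.

(** Writes the partial sum P as v - (v - P). The remainder v - P is an almost everywhere limit of
    shell polynomials, so Fatou's lemma bounds its fourth-power integral. *)
Lemma l4_window_le M e t : 0 < e -> ((l4 (window (N M)) a t)%:E <=
  ((1 + e) ^+ 3)%:E * fourth t + ((1 + e^-1) ^+ 3)%:E * einf_l4 (fun k => shell N M (k + M)) a t)%E.
Proof.
move=> e0; have i0 : 0 < e^-1 by rewrite invr_gt0.
have [Ls ls] := schrodinger_lim t; have ms := L2_measurable Ls.
set P := partial (evolve t a) N M; set v := schrodinger t u.
have mP k : cmeasurable (fun x => partial (evolve t a) N (k + M) x - P x).
  by apply: cmeasurableB; exact: cmeasurable_tpoly.
have mvP : cmeasurable (fun x => v x - P x) by apply: cmeasurableB => //; exact: cmeasurable_tpoly.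
have le1 : (\int[mu]_(x in D) (normc (v x - P x) ^+ 4)%:E <= einf_l4 (fun k => shell N M (k + M)) a t)%E.
  under eq_integral do rewrite (exprM _ 2 2).
  apply: le_trans (fatou_normc 2 mP mvP (ae_limB P (ae_lim_shift M ls))) _.
  rewrite le_eqVlt; apply/orP; left; apply/eqP.
  congr limn_einf; apply/funext => k; rewrite -integral_normc4_tpoly.
  by apply: eq_integral => x _; rewrite -partialB// leq_addl.
have m4 w : cmeasurable w -> measurable_fun D (fun x => (normc (w x) ^+ 4)%:E).
  by move=> mw; apply/measurable_EFinP; apply: measurable_funTS; exact: measurable_normc4.
have n4 (w : R -> R[i]) x : (0 <= (normc (w x) ^+ 4)%:E)%E by rewrite lee_fin exprn_ge0// normc_ge0.
apply: (@le_trans _ _ (((1 + e) ^+ 3)%:E * fourth t +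
    ((1 + e^-1) ^+ 3)%:E * \int[mu]_(x in D) (normc (v x - P x) ^+ 4)%:E)%E); last first.
  by rewrite leeD2l// lee_wpmul2l// lee_fin exprn_ge0//; lra.
have k0 : 0 <= (1 + e) ^+ 3 by rewrite exprn_ge0//; lra.
have k1 : 0 <= (1 + e^-1) ^+ 3 by rewrite exprn_ge0//; lra.
have z (k : R) w : 0 <= k -> cmeasurable w ->
    (k%:E * \int[mu]_(x in D) (normc (w x) ^+ 4)%:E = \int[mu]_(x in D) (k%:E * (normc (w x) ^+ 4)%:E))%E.
  by move=> kk mw; rewrite ge0_integralZl//; exact: m4.
rewrite /fourth !z//.
rewrite -ge0_integralD; last 5 first.
- exact: mD.
- by move=> x _; apply: mule_ge0; rewrite lee_fin//; apply/exprn_ge0/normc_ge0.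
- by apply: measurable_funeM; exact: m4.
- by move=> x _; apply: mule_ge0; rewrite lee_fin//; apply/exprn_ge0/normc_ge0.
- by apply: measurable_funeM; exact: m4.
have -> : (l4 (window (N M)) a t)%:E = (\int[mu]_(x in D) (normc (P x) ^+ 4)%:E)%E.
  by rewrite -integral_normc4_tpoly; apply: eq_integral => x _; rewrite -exprM.
apply: ge0_le_integral_any => x _; first exact: (n4 P).
rewrite -!EFinM -EFinD lee_fin; apply: fourth_power_le => //; first exact: normc_ge0.
rewrite (_ : normc (P x) = normc (v x + - (v x - P x))); last by rewrite opprB addrC subrK.
by rewrite -[X in _ <= _ + X]normcN; exact: le_normcD.
Qed.

(** Here [W] must be bounded below. The measurable [g], built with [minorant], lies below the
    fourth-power integral and still satisfies l4 <= k g + d H, so linearity of the integral applies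
    to g and H. *)
Lemma le_W M (e B c : R) : 0 < B -> 0 < e -> 0 <= c ->
  (forall s, uniq s -> wq (kern B) s a <= c * mass s (md a) ^+ 2) ->
  ((pi *+ 2 * B * wq (kern B) (window (N M)) a)%:E <= ((1 + e) ^+ 3)%:E * W B u +
    ((1 + e^-1) ^+ 3 * (pi *+ 2 * B * (c * (4 ^+ M)^-1 ^+ 2)))%:E)%E.
Proof.
move=> B0 e0 c0 wc.
have i0 : 0 < e^-1 by rewrite invr_gt0.
set k := (1 + e) ^+ 3; set d := (1 + e^-1) ^+ 3.
have k0 : 0 < k by rewrite exprn_gt0//; lra.
have d0 : 0 < d by rewrite exprn_gt0//; lra.
pose H t := einf_l4 (fun k => shell N M (k + M)) a t.
have H0 t : (0 <= H t)%E by exact: einf_l4_ge0.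
pose g t := minorant k d (l4 (window (N M)) a t) (H t).
have g0 t : (0 <= g t)%E by rewrite /g /minorant le_max lexx.
pose I := `[0%R, B]%classic : set R.
have mI : measurable I by exact: measurable_itv.
have mH : measurable_fun I H by exact: measurable_einf_l4.
have mg : measurable_fun I g.
  apply: measurable_maxe; first exact: measurable_cst.
  apply: measurable_funeM; apply: emeasurable_funB; first exact: measurable_l4.
  exact: measurable_funeM.
have IH : (\int[mu]_(t in I) H t <= (pi *+ 2 * B * (c * (4 ^+ M)^-1 ^+ 2))%:E)%E.
  apply: (integral_einf_l4_le (k0 := 0)) => // j _.
  apply: le_trans (wc _ (shell_uniq _ _ _)) _; rewrite ler_wpM2l//.
  have ms := mass_shell tail M (j + M).
  rewrite ler_sqr ?nnegrE ?invr_ge0 ?exprn_ge0//.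
  by apply: sumr_ge0 => n _; exact: sqr_ge0.
have Ig : (\int[mu]_(t in I) g t <= W B u)%E.
  apply: ge0_le_integral_any => t _; first exact: g0.
  by apply: minorant_le => //; [exact: fourth_ge0|exact: l4_window_le].
rewrite -integral_l4//.
apply: (@le_trans _ _ (\int[mu]_(t in I) (k%:E * g t + d%:E * H t))%E).
  apply: ge0_le_integral_any => t _; first by rewrite lee_fin l4_ge0.
  exact: le_minorant.
have m1 : measurable_fun I (fun t => k%:E * g t)%E by exact: measurable_funeM.
have m2 : measurable_fun I (fun t => d%:E * H t)%E by exact: measurable_funeM.
rewrite ge0_integralD//; first last.
- by move=> t _; rewrite mule_ge0// lee_fin ltW.
- by move=> t _; rewrite mule_ge0// lee_fin ltW.
rewrite !ge0_integralZl// ?lee_fin ?(ltW k0) ?(ltW d0)// (EFinM d).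
by apply: leeD; apply: lee_wpmul2l => //; rewrite lee_fin ltW.
Qed.

End Evolution.
End TimeIntegrals.

(** * Certified numerics *)

Section BallArithmetic.
Local Open Scope Z_scope.

Definition prec : Z := 2 ^ 56.

(* [(a, b, e)] stands for a ball of radius [e / prec] around [(a + i b) / prec] *)
Definition cball : Type := (Z * Z * Z)%type.

Definition bmul (t u : cball) : cball :=
  let: (a, b, e) := t in let: (c, d, f) := u in
  (Z.shiftr (a * c - b * d) 56, Z.shiftr (a * d + b * c) 56, e + f + Z.shiftr (e * f) 56 + 3).

(* [1 + i 2^-26] lies within [2^-52] of [cis (2^-26)], so this is a ball around [cis (1 / 64)]. *)
Definition bstep : cball := iter 20%nat (fun t => bmul t t) (prec, 2 ^ 30, 2 ^ 4).

Fixpoint bpow (t : cball) (k : positive) : cball :=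
  match k with
  | xH => t
  | xO k' => bpow (bmul t t) k'
  | xI k' => bmul t (bpow (bmul t t) k')
  end.

(** A lower bound, in units of 1 / prec, for the sum of the c sin (m y) / (2 m), with [cur]
    enclosing cis (m y): b - e lies below the sine, and integer division rounds down. *)
Fixpoint bsin (cs : seq nat) (m : Z) (cur t : cball) : Z :=
  if cs is c :: cs' then
    let: (a, b, e) := cur in
    Z.of_nat c * (b - e) / (2 * m) + bsin cs' (m + 1) (bmul cur t) t
  else 0.

(** The entry of rank m, counted from 1, is the multiplicity of the frequency 2 m. The list stops at
    m = 42 = 6 * 7, the largest |p q| possible with |p| + |q| <= 13. *)
Definition freq_mult : seq nat :=
  [:: 48; 88; 80; 112; 64; 128; 48; 104; 64; 80; 16; 112; 0; 40; 48; 56; 0; 64; 0; 56;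
      32; 8; 0; 56; 16; 0; 16; 24; 0; 32; 0; 16; 0; 0; 16; 16; 0; 0; 0; 8; 0; 8]%N.

(** The point is x = k / 128: [t] encloses cis (2 x), and 14 x in units of 2^-56 is 14 k 2^49. *)
Definition prim_lb (k : positive) : Z :=
  let t := bpow bstep k in bsin freq_mult 1 t t - 14 * Zpos k * 2 ^ 49.

(** The spacing is uneven because a point with a large margin controls a wide interval. *)
Definition grid : seq positive :=
 [:: 151; 159; 166; 173; 179; 184; 188; 192; 195; 199; 206; 214; 222; 228; 234; 239; 244; 249;
  253; 257; 260; 263; 266; 269; 273; 277; 281; 284; 287; 289; 291; 293; 295; 296; 297; 298; 299;
  300; 301; 303; 305; 307; 309; 310; 311; 312]%positive.

(* [x] and [hi] are in units of 1/32768; a point [k / 128] controls the interval on which the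
   Lipschitz constant 1470 of [prim] cannot absorb its margin. *)
Fixpoint covers (g : seq positive) (c x hi : Z) : bool :=
  if g is k :: g' then
    let r := (prim_lb k + c) * 256 / (1471 * 2 ^ 49) in
    (256 * Zpos k - r <=? x) && covers g' c (256 * Zpos k + r) hi
  else hi <=? x.

Lemma covers_cons k g c x hi : covers (k :: g) c x hi ->
  let r := (prim_lb k + c) * 256 / (1471 * 2 ^ 49) in
  256 * Zpos k - r <= x /\ covers g c (256 * Zpos k + r) hi.
Proof. by move=> /andP[/Z.leb_le]. Qed.

(** The end points are 1.295 - 19/128 and 2.59 - 19/128 in units of 1/32768, rounded outward. *)
Lemma grid_covers : covers grid (prim_lb 19) 37570 80010.
Proof. by vm_compute. Qed.

End BallArithmetic.

Fixpoint spread (cs : seq nat) (m : nat) : seq nat :=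
  if cs is c :: cs' then nseq c (2 * m)%N ++ spread cs' m.+1 else [::].

Lemma freq_multE : sort leq nonres_freqs = spread freq_mult 1.
Proof. by vm_compute. Qed.


(** * Soundness of the ball arithmetic and positivity of the chirp excess *)

Section Soundness.
Variable R : realType.

Definition zR (z : Z) : R := (int_of_Z z)%:~R.

Lemma zRD a b : zR (Z.add a b) = zR a + zR b.
Proof. by rewrite /zR -rmorphD; congr (_%:~R); lia. Qed.

Lemma zRB a b : zR (Z.sub a b) = zR a - zR b.
Proof. by rewrite /zR -rmorphB; congr (_%:~R); lia. Qed.

Lemma zRM a b : zR (Z.mul a b) = zR a * zR b.
Proof. by rewrite /zR -rmorphM; congr (_%:~R); lia. Qed.

Lemma ler_zR a b : Z.le a b -> zR a <= zR b.
Proof. by move=> ab; rewrite /zR ler_int; lia. Qed.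

Lemma zR_nat n : zR (Z.of_nat n) = n%:R.
Proof. by rewrite /zR pmulrn; congr (_%:~R); lia. Qed.

Lemma zR_pos k : zR (Zpos k) = (Pos.to_nat k)%:R.
Proof. by rewrite -zR_nat positive_nat_Z. Qed.

Lemma zR_pow2 n : zR (Z.pow 2 (Z.of_nat n)) = 2 ^+ n.
Proof.
elim: n => [|n IH]; first by rewrite expr0 [LHS]/(1%:~R).
by rewrite Nat2Z.inj_succ Z.pow_succ_r ?zRM ?IH ?exprS//; lia.
Qed.

Local Notation pR := (2 ^+ 56 : R).

Lemma pR_gt0 : 0 < pR. Proof. by rewrite exprn_gt0. Qed.

Lemma zR_shift z : zR (Z.shiftr z 56) * pR <= zR z /\ zR z <= (zR (Z.shiftr z 56) + 1) * pR.
Proof.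
rewrite Z.shiftr_div_pow2; last by lia.
rewrite -(zR_pow2 56) -[1]/(zR 1) -zRD -!zRM.
have := Z.div_mod z (Z.pow 2 (Z.of_nat 56)) ltac:(by []).
have := Z.mod_pos_bound z (Z.pow 2 (Z.of_nat 56)) ltac:(by []).
rewrite -[Z.pow 2 56]/(Z.pow 2 (Z.of_nat 56)).
by set m := Z.modulo _ _; set d := Z.div _ _; set p := Z.pow _ _; split; apply: ler_zR; nia.
Qed.

Definition center (t : cball) : R[i] := (zR t.1.1 / pR) +i* (zR t.1.2 / pR).

Definition encl (z : R[i]) (t : cball) := normc z = 1 /\ normc (z - center t) * pR <= zR t.2.

Lemma normc_le_ReIm (z : R[i]) : normc z <= `|complex.Re z| + `|complex.Im z|.
Proof.
rewrite -(@ler_pXn2r _ 2) ?nnegrE ?normc_ge0 ?addr_ge0// sqr_normc_ReIm sqrrD.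
by rewrite !real_normK ?num_real// addrAC lerDl mulrn_wge0// mulr_ge0.
Qed.

(** As |z| = |w| = 1, the error of the product of centers is at most |w - u| + |z - t| |u| with |u|
    <= 1 + |u - w|, that is e + f + e f / prec in units of 1 / prec. The extra 3 pays for three
    roundings: one per coordinate and one in e f. *)
Lemma bmul_encl z w t u : encl z t -> encl w u -> encl (z * w) (bmul t u).
Proof.
case: t u => [[a b] e] [[c d] f] [nz Hz] [nw Hw]; split; first by rewrite normcM nz nw mul1r.
have p0 := pR_gt0.
rewrite /= in Hz Hw *; set T := center _.
set t := center (a, b, e) in Hz; set u := center (c, d, f) in Hw.
set E := zR e in Hz; set F := zR f in Hw.
have tu : normc (t * u - T) * pR <= 2.
  have [r1 r2] := zR_shift (Z.sub (Z.mul a c) (Z.mul b d)).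
  have [i1 i2] := zR_shift (Z.add (Z.mul a d) (Z.mul b c)).
  rewrite zRB !zRM in r1 r2; rewrite zRD !zRM in i1 i2.
  apply: le_trans (ler_wpM2r (ltW p0) (normc_le_ReIm _)) _.
  rewrite /T /center /= mulrDl.
  set x := zR _ in r1 r2 *; set y := zR (Z.shiftr _ _) in i1 i2 *.
  have bnd (v k : R) : k * pR <= v -> v <= (k + 1) * pR -> `|v / pR / pR - k / pR| * pR <= 1.
    move=> h1 h2; rewrite ger0_norm.
      rewrite mulrBl !divfK ?gt_eqF// lerBlDl ler_pdivrMr// addrC//.
    by rewrite subr_ge0 ler_pM2r ?invr_gt0// ler_pdivlMr.
  rewrite [leRHS](_ : 2 = 1 + 1)//.
  apply: lerD.
    have -> : zR a / pR * (zR c / pR) - zR b / pR * (zR d / pR) + - (x / pR) =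
      (zR a * zR c - zR b * zR d) / pR / pR - x / pR by field.
    exact: bnd.
  have -> : zR a / pR * (zR d / pR) + zR b / pR * (zR c / pR) + - (y / pR) =
    (zR a * zR d + zR b * zR c) / pR / pR - y / pR by field.
  exact: bnd.
have nu : normc u * pR <= pR + F.
  have -> : u = w + (u - w) by rewrite addrC subrK.
  apply: le_trans (ler_wpM2r (ltW p0) (le_normcD _ _)) _.
  by rewrite nw mulrDl mul1r lerD2l -normcN opprB.
have -> : z * w - T = z * (w - u) + ((z - t) * u + (t * u - T)) by ring.
apply: le_trans (ler_wpM2r (ltW p0) (le_normcD _ _)) _.
rewrite normcM nz mul1r mulrDl.
apply: le_trans (lerD Hw (ler_wpM2r (ltW p0) (le_normcD _ _))) _.
rewrite mulrDl normcM.
have [g1 g2] := zR_shift (Z.mul e f); rewrite zRM -/E -/F in g1 g2.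
rewrite !zRD -/E -/F; set G := zR _ in g1 g2 *.
have F0 : 0 <= F by apply: le_trans Hw; rewrite mulr_ge0 ?normc_ge0 ?ltW.
have : normc (z - t) * normc u * pR <= E + G + 1.
  rewrite -(ler_pM2r p0).
  have -> : normc (z - t) * normc u * pR * pR = (normc (z - t) * pR) * (normc u * pR) by ring.
  apply: le_trans (ler_pM _ _ Hz nu) _; rewrite ?mulr_ge0 ?normc_ge0 ?(ltW p0)//.
  by rewrite mulrDr -addrA (mulrDl E) lerD2l.
by rewrite -[zR 3]/(3); lra.
Qed.

Lemma iter_sqr_encl n (x : R) t : encl (cis x) t -> encl (cis (x *+ (2 ^ n))) (iter n (fun t => bmul t t) t).
Proof.
move=> H; elim: n => [|n IH] //=.
by rewrite expnS mul2n -addnn mulrnDr cisD; apply: bmul_encl.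
Qed.

Lemma bstep_encl : encl (cis (1 / 64)) bstep.
Proof.
have h0 : 0 <= (2 ^+ 26)^-1 :> R by rewrite invr_ge0 exprn_ge0.
have -> : 1 / 64 = (2 ^+ 26)^-1 *+ (2 ^ 20) :> R.
  rewrite -[RHS]mulr_natr natrX (_ : 64 = 2 ^+ 6 :> R); last by rewrite -natrX.
  by rewrite (_ : 26 = 20 + 6)%N// exprD; field.
apply: iter_sqr_encl; set h := (_^-1); split; first exact: normc_cis.
have -> : center (prec, Z.pow 2 30, Z.pow 2 4) = 1 +i* h.
  rewrite /center /= (zR_pow2 56) (zR_pow2 30) divff ?gt_eqF ?pR_gt0//.
  by congr (_ +i* _); rewrite /h (_ : 56 = 30 + 26)%N// exprD; field.
rewrite (zR_pow2 4) -ler_pdivlMr ?pR_gt0//.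
apply: le_trans (normc_le_ReIm _) _; rewrite /=.
have s := sin_sub_id h0; have c := cos_ge h; have c' := cos_le1 h.
have hc : `|cos h - 1| <= h ^+ 2 / 2 by rewrite distrC ger0_norm ?subr_ge0//; lra.
have h2 : h ^+ 2 = 2 ^+ 4 / pR.
  by rewrite /h exprVn -exprM (_ : 56 = 4 + 26 * 2)%N// exprD; field.
have h1 : h <= 1 by rewrite invf_le1 ?exprn_gt0// exprn_ege1//; lra.
have : h ^+ 3 / 2 <= h ^+ 2 / 2 by rewrite ler_pM2r ?invr_gt0// ler_wiXn2l.
rewrite -h2; lra.
Qed.

Lemma bpow_encl (x : R) t k : encl (cis x) t -> encl (cis (x *+ Pos.to_nat k)) (bpow t k).
Proof.
elim: k x t => [k IH|k IH|] x t H /=.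
- rewrite Pos2Nat.inj_xI mulrS cisD; apply: bmul_encl => //.
  by rewrite multE mulrnA; apply: IH; rewrite mulr2n cisD; apply: bmul_encl.
- by rewrite Pos2Nat.inj_xO multE mulrnA; apply: IH; rewrite mulr2n cisD; apply: bmul_encl.
- by rewrite Pos2Nat.inj_1.
Qed.

Fixpoint sinsum (cs : seq nat) (m : nat) (y : R) : R :=
  if cs is c :: cs' then c%:R * (sin (m%:R * y) / (2 * m%:R)) + sinsum cs' m.+1 y else 0.

Lemma bsin_le cs m y cur t : (0 < m)%N -> encl (cis (m%:R * y)) cur -> encl (cis y) t ->
  zR (bsin cs (Z.of_nat m) cur t) <= pR * sinsum cs m y.
Proof.
elim: cs m cur => [|c cs IH] m cur m0 Hc Ht; first by rewrite mulr0 [leLHS]/(0%:~R).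
rewrite /bsin -/bsin; case: cur Hc => [[a b] e] Hc.
rewrite zRD mulrDr; apply: lerD; last first.
  have -> : Z.add (Z.of_nat m) 1 = Z.of_nat m.+1 by lia.
  by apply: IH => //; rewrite -natr1 mulrDl mul1r cisD; apply: bmul_encl.
have m0' : 0 < m%:R :> R by rewrite ltr0n.
have Hd : zR (Z.div (Z.mul (Z.of_nat c) (Z.sub b e)) (Z.mul 2 (Z.of_nat m))) * (2 * m%:R) <=
   c%:R * (zR b - zR e).
  rewrite -[2]/(zR 2) -!zR_nat -zRB -!zRM; apply: ler_zR.
  have := Z.mul_div_le (Z.mul (Z.of_nat c) (Z.sub b e)) (Z.mul 2 (Z.of_nat m)) ltac:(lia).
  lia.
have hs : zR b - zR e <= pR * sin (m%:R * y).
  have [_ H] := Hc; have p0 := pR_gt0.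
  have := le_trans (ler_wpM2r (ltW p0) (abs_Im_le _)) H; rewrite /= -normrN opprB.
  move=> /(le_trans (ler_wpM2r (ltW p0) (ler_norm _))).
  rewrite mulrBl divfK ?gt_eqF// [pR * _]mulrC; lra.
have {Hd} : zR (Z.div (Z.mul (Z.of_nat c) (Z.sub b e)) (Z.mul 2 (Z.of_nat m))) * (2 * m%:R) <=
   c%:R * (pR * sin (m%:R * y)) by apply: le_trans Hd _; rewrite ler_wpM2l.
rewrite -ler_pdivlMr ?mulr_gt0// => /le_trans; apply.
by rewrite le_eqVlt; apply/orP; left; apply/eqP; field; rewrite gt_eqF.
Qed.

Lemma prim_sinsum x : prim x = sinsum freq_mult 1 (2 * x) - 14 * x.
Proof.
rewrite /prim; congr (_ - _).
rewrite -(perm_big _ (permEl (perm_sort leq nonres_freqs))) freq_multE.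
have [y ey] : exists y, y = 2 * x by exists (2 * x).
rewrite -ey; elim: freq_mult 1%N => [|c cs IH] m /=; first by rewrite big_nil.
rewrite big_cat /= IH; congr (_ + _).
rewrite big_nseq iter_addr_0 /osc mulr_natl; congr (_ *+ _).
have -> : (2 * m)%N%:~R = 2 * m%:R :> R by rewrite -natrM.
by rewrite ey; congr (sin _ / _); ring.
Qed.

Lemma zR_pow49 : zR (Z.pow 2 49) = 2 ^+ 49. Proof. exact: (zR_pow2 49). Qed.

Lemma prim_lb_le k : zR (prim_lb k) <= pR * prim ((Pos.to_nat k)%:R / 128).
Proof.
set x := (_ / _).
have : encl (cis (2 * x)) (bpow bstep k).
  have -> : 2 * x = (1 / 64) *+ Pos.to_nat k by rewrite /x -mulr_natr; field.
  exact/bpow_encl/bstep_encl.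
rewrite /prim_lb; move: (bpow bstep k) => T e.
rewrite zRB prim_sinsum mulrBr; apply: lerB.
  have e1 : encl (cis (1%:R * (2 * x))) T by rewrite mul1r.
  exact: (bsin_le freq_mult (ltn0Sn 0) e1 e).
rewrite (zRM (Z.mul 14 (Zpos k))) (zRM 14) zR_pow49 (zR_pos k) -[zR 14]/(14) /x.
have e7 : 2 ^+ 7 = 128 :> R by rewrite -natrX.
have -> : pR = 2 ^+ 49 * 128 by rewrite -e7 -exprD.
rewrite le_eqVlt; apply/orP; left; apply/eqP; by move: (2 ^+ 49) => z; field.
Qed.

Lemma primN (x : R) : prim (- x) = - prim x.
Proof.
rewrite /prim mulrN opprB opprK addrC; congr (_ + _); rewrite -sumrN.
by apply: eq_bigr => w _; rewrite /osc mulrN sinN mulNr.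
Qed.

(** Each [osc] is 1-Lipschitz; the box has 1456 nonresonant quadruples, and the linear term adds
    14. *)
Lemma prim_lipschitz (x y : R) : `|prim x - prim y| <= 1470 * `|x - y|.
Proof.
have -> : prim x - prim y = \sum_(w <- nonres_freqs) (osc x w - osc y w) - 14 * (x - y).
  by rewrite sumrB /prim; ring.
apply: le_trans (ler_normB _ _) _; rewrite normrM (ger0_norm (ler0n _ 14)).
have -> : 1470 = 1456 + 14 :> R by ring.
rewrite (mulrDl 1456 14) lerD2r; apply: le_trans (ler_norm_sum _ _ _) _.
have sz : size nonres_freqs = 1456%N by vm_compute.
rewrite -[1456]/(1456%N%:R) -sz.
rewrite mulr_natl -iter_addr_0 -count_predT -big_const_seq; apply: ler_sum => w _.
rewrite /osc -mulrBl normrM normfV; have [->|w0] := eqVneq w 0%N.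
  by rewrite !mul0r sin0 subrr normr0 mul0r.
have w1 : 0 < `|w%:~R : R| by rewrite normr_gt0 intr_eq0 eqz_nat.
rewrite (ler_pdivrMr _ _ w1); apply: le_trans (sin_lipschitz _ _) _.
by rewrite -mulrBr normrM mulrC.
Qed.

(** Since [prim] is odd, the claim is that prim y + prim (19 / 128) is positive. Within r / 32768 of
    k / 128 the Lipschitz loss is at most 1470/1471 of the certified margin, so something positive
    remains. *)
Lemma covers_prim g x hi (y : R) : covers g (prim_lb 19) x hi ->
  zR x <= 128 * 256 * y -> 128 * 256 * y < zR hi -> prim (- (19 / 128)) < prim y.
Proof.
have p0 := pR_gt0.
elim: g x => [|k g IH] x.
  by move=> /Z.leb_le/ler_zR hx xy yh; have := le_lt_trans (le_trans hx xy) yh; rewrite ltxx.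
move=> /covers_cons; set r := Z.div _ _; cbv zeta => -[/ler_zR hl cov] xy yh.
have [hy|] := lerP (zR (Z.add (Z.mul 256 (Zpos k)) r)) (128 * 256 * y); first exact: (IH _ cov).
rewrite zRD zRM (zR_pos k) -[zR 256]/(256) => hu.
rewrite zRB zRM (zR_pos k) -[zR 256]/(256) in hl.
set K : R := (Pos.to_nat k)%:R in hl hu.
have yk : `|y - K / 128| * (128 * 256) <= zR r.
  have U0 : 0 <= 128 * 256 :> R by apply: mulr_ge0; exact: ler0n.
  by rewrite -[X in _ * X <= _](ger0_norm U0) -normrM ler_norml; apply/andP; split; lra.
have hr : zR r * (1471 * 2 ^+ 49) <= (zR (prim_lb k) + zR (prim_lb 19)) * 256.
  rewrite -zR_pow49 -[1471]/(zR 1471) -[256]/(zR 256) -zRD -!(zRM _ _); apply: ler_zR.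
  rewrite Z.mul_comm; exact: Z.mul_div_le.
have h1 := prim_lb_le k; have h2 := prim_lb_le 19; rewrite -/K in h1.
have e19 : (Pos.to_nat 19)%:R = 19 :> R by [].
rewrite e19 in h2.
have lip := le_trans (ler_norm _) (prim_lipschitz (K / 128) y).
rewrite primN; move: h1 h2 lip; rewrite distrC; set PK := prim _; set P19 := prim (19 / 128).
move: yk; set d := `|_|; set Py := prim y => yk h1 h2 lip.
have e7 : 2 ^+ 7 = 128 :> R by rewrite -natrX.
have e49 : pR = 2 ^+ 49 * 128 by rewrite -e7 -exprD.
have q0 : 0 < 2 ^+ 49 :> R by rewrite exprn_gt0.
rewrite e49 in h1 h2; clear p0 e49 IH cov; move: (2 ^+ 49) q0 h1 h2 hr => q q0 h1 h2 hr.
(* y lies in an interval of radius r around the grid point, half-open on the right, so r is positive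
   without consulting the table. *)
have r0 : 0 < zR r.
  by move: (le_lt_trans (le_trans hl xy) hu); clear; move: (256 * K) (zR r) => z w; lra.
clear hl xy hu yh; move: (zR r) (zR (prim_lb k)) (zR (prim_lb 19)) r0 yk hr h1 h2 => w L1 L2 r0 yk hr h1 h2.
have S1 : q * (w * 1471) <= q * (128 * 256 * (PK + P19)) by lra.
have S2 : w * 1471 <= 128 * 256 * (PK + P19) by rewrite -(ler_pM2l q0).
lra.
Qed.

Lemma dyadic_multiple (c B : R) : 0 < B -> B < 2 * c -> exists n, c <= 2 ^+ n * B < 2 * c.
Proof.
move=> B0 Bc.
have [n0 Hn0] : exists n, c <= 2 ^+ n * B.
  pose n := Num.truncn (c / B).
  have h : c / B < n.+1%:R by rewrite /n truncnS_gt.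
  exists n.+1; rewrite -(ler_pdivrMr _ _ B0); apply: le_trans (ltW h) _.
  by rewrite -natrX ler_nat ltnW// ltn_expl.
case: (ex_minnP (ex_intro (fun n => c <= 2 ^+ n * B) n0 Hn0)) => -[|n] h1 h2.
  by exists 0%N; rewrite h1 expr0 mul1r.
exists n.+1; rewrite h1 exprS -mulrA /= ltr_pM2l//.
by rewrite ltNge; apply/negP => /h2; rewrite ltnn.
Qed.

(** The increment over [s, s + 2 B] is the sum of the increments over its two halves, so one half
    has a positive one. The descent starts from the multiple 2^n B in [1.295, 2.59). *)
Lemma prim_shift_gt (B : R) : 0 < B -> B < 259 / 100 -> exists s, prim s < prim (s + B).
Proof.
move=> B0 Bm; have e : 259 / 100 = 2 * (259 / 200) :> R by field.
rewrite e in Bm; have [n] := dyadic_multiple B0 Bm; rewrite -e; clear e.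
elim: n B B0 {Bm} => [|n IH] B B0.
  (* One shift serves the whole range [1.295, 2.59) of B. *)
  rewrite (expr0 2) (mul1r B) => /andP[h1 h2]; exists (- (19 / 128)).
  apply: (covers_prim grid_covers).
    rewrite -[Zpos 37570]/(Z.mul 130 289) zRM -[zR 130]/(130) -[zR 289]/(289); lra.
  rewrite -[Zpos 80010]/(Z.mul 630 127) zRM -[zR 630]/(630) -[zR 127]/(127); lra.
rewrite exprSr -mulrA => hn.
have B2 : 0 < 2 * B by rewrite mulr_gt0.
have [s hs] := IH (2 * B) B2 hn.
have [lt|ge] := ltP (prim s) (prim (s + B)); first by exists s.
by exists (s + B); apply: le_lt_trans ge _; rewrite -addrA -mulr2n -mulr_natl.
Qed.

End Soundness.

(** * The maximizer among square-integrable functions *)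

Section Final.
Variables (R : realType) (B : R).
Hypothesis B0 : 0 < B.
Notation mu := (@lebesgue_measure R).
Notation D := (torus R).
Notation j := (wq_sup (kern B)).
Hypothesis j2 : 2 < j.

Let p2 : 0 < pi *+ 2 :> R := pi2_gt0 R.
Let j0 : 0 < j. Proof. by apply: lt_trans j2. Qed.

Let mD : measurable D := @measurable_torus R.

Lemma wq_kern_le s (a : int -> R[i]) : uniq s -> wq (kern B) s a <= j * mass s (md a) ^+ 2.
Proof.
apply: (@wq_le_sup R (kern B) B^-1); [exact: kern0|by rewrite invr_gt0|].
by move=> p q; exact: normc_kern_le.
Qed.

Lemma wq_kern_le_mass s (a : int -> R[i]) C : uniq s -> mass s (md a) <= C -> wq (kern B) s a <= j * C ^+ 2.
Proof.
move=> us aC; apply: le_trans (wq_kern_le a us) _; rewrite ler_wpM2l ?(ltW j0)//.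
by rewrite ler_sqr ?nnegrE ?mass_ge0// (le_trans (mass_ge0 s (md a)) aC).
Qed.

(** Unit L^2 norm means coefficient mass 1 / (2 pi). As [wq] is quadratic in the mass, the extremal
    value is 2 pi B times j / (2 pi)^2. *)
Lemma max_valueE : pi *+ 2 * B * (j * (pi *+ 2)^-1 ^+ 2) = B * j / (pi *+ 2).
Proof. by move: (pi *+ 2) (lt0r_neq0 p2) => q q0; field. Qed.

Lemma W_unit_le (u : R -> R[i]) : L2 u -> L2norm u = 1 -> (W B u <= (B * j / (pi *+ 2))%:E)%E.
Proof.
move=> Lu u1; have aC s : uniq s -> mass s (md (fourier u)) <= (pi *+ 2)^-1.
  move=> us; have := bessel Lu us; rewrite -L2norm_sqr u1 expr1n.
  by rewrite mulrC -ler_pdivlMr// mul1r.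
have [N [N1 N2 N3]] := fast_tails aC.
rewrite -max_valueE; apply: (W_le (fun=> erefl) aC N1 N2 N3 B0) => s us.
exact: wq_kern_le_mass (aC s us).
Qed.

Lemma le_of_all_gap (x y c : R) : 0 < c -> (forall e, 0 < e -> c * (x - e) <= y) -> c * x <= y.
Proof.
move=> c0 H; apply/ler_addgt0Pl => e e0; have := H (e / c); rewrite divr_gt0// => /(_ isT).
by rewrite mulrBr mulrCA divff ?gt_eqF// mulr1 lerBlDl.
Qed.

Lemma W_unit_attained : exists u0 : R -> R[i],
  [/\ L2 u0, L2norm u0 = 1 & ((B * j / (pi *+ 2))%:E <= W B u0)%E].
Proof.
have Bi : 0 < B^-1 by rewrite invr_gt0.
have [al [al1 alj]] := wq_maximizer (kern0 B) Bi (fun p q => normc_kern_le B0) j2.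
pose c := Num.sqrt (pi *+ 2)^-1 : R.
have c2 : c ^+ 2 = (pi *+ 2)^-1 by rewrite sqr_sqrtr// invr_ge0 ltW.
pose a n := c%:C * al n.
have aE s : mass s (md a) = (pi *+ 2)^-1 * mass s (md al) by rewrite massZ c2.
have wE s : wq (kern B) s a = (pi *+ 2)^-1 ^+ 2 * wq (kern B) s al.
  by rewrite wqZ (exprM _ 2 2) c2.
have aC s : uniq s -> mass s (md a) <= (pi *+ 2)^-1.
  by move=> us; rewrite aE ler_piMr ?al1// invr_ge0 ltW.
have [N [N1 N2 N3]] := fast_tails aC.
have [u0 [Lu ua lu]] := riesz_fischer aC N1 N2 N3.
have I1 : \int[mu]_(x in D) (normc (u0 x) ^+ 2) <= 1.
  have := fatou_partial aC (L2_measurable Lu) lu; rewrite divff ?gt_eqF//.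
  have /integrable_fin_num h := integrable_normc2 Lu.
  by rewrite -[X in (X <= _)%E]fineK; [rewrite lee_fin|exact: h].
have I0 : 0 <= \int[mu]_(x in D) (normc (u0 x) ^+ 2) by apply: Rintegral_ge0 => x _; exact: sqr_ge0.
(* No mass is lost: on a suitable window j - e <= wq <= j m^2, and Bessel's inequality bounds the
   window mass m of [al] by the squared norm of [u0]. *)
have I2 : 1 <= \int[mu]_(x in D) (normc (u0 x) ^+ 2).
  set I := \int[mu]_(x in D) _ in I0 *.
  suff : 1 * j <= j * I ^+ 2.
    by rewrite mulrC ler_pM2l// -[X in X <= _](expr1n _ 2) ler_sqr ?nnegrE.
  apply: le_of_all_gap => // e e0; rewrite mul1r.
  have [M0 /(_ _ (leqnn _)) h] := alj e e0; apply: le_trans h _.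
  apply: wq_kern_le_mass; first exact: window_uniq.
  have := bessel Lu (window_uniq M0); rewrite (_ : md (fourier u0) = md a); last first.
    by apply/funext => n; rewrite /md ua.
  by rewrite aE mulrA divff ?gt_eqF// mul1r.
have n1 : L2norm u0 = 1.
  by rewrite /L2norm (_ : \int[mu]_(x in D) _ = 1) ?sqrtr1//; apply: le_anti; rewrite I1 I2.
exists u0; split => //.
have W0 : (0 <= W B u0)%E.
  by apply: integral_ge0 => t _; apply: integral_ge0 => x _; rewrite lee_fin exprn_ge0// normc_ge0.
have Wfin : W B u0 \is a fin_num.
  by rewrite ge0_fin_numE// (le_lt_trans (W_unit_le Lu n1))// ltry.
rewrite -(fineK Wfin) lee_fin; set w := fine _.
rewrite (_ : B * j / (pi *+ 2) = B / (pi *+ 2) * j); last by rewrite mulrAC.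
apply: le_of_all_gap => [|e e0]; first exact: divr_gt0.
have [M0 HM] := alj e e0.
(* With e = y = 2^-M the squared tail is 4^(-2M) = y^4, so the factor (1 + y^-1)^3 leaves (1 + y)^3
   y, which tends to 0. *)
pose y M := 2^-1 ^+ M : R.
have y0 M : 0 < y M by rewrite exprn_gt0// invr_gt0.
have cy : y @ \oo --> 0 by apply: cvg_expr; rewrite ger0_norm ?invr_ge0// invf_lt1// ltr1n.
pose K := pi *+ 2 * B * j.
have step M : (M0 <= M)%N -> B / (pi *+ 2) * (j - e) <= (1 + y M) ^+ 3 * w + (1 + y M) ^+ 3 * y M * K.
  move=> MM; have := le_W ua aC N1 N2 N3 M B0 (y0 M) (ltW j0) (fun s => @wq_kern_le s a).
  rewrite -[W B u0](fineK Wfin) -/w -EFinM -EFinD lee_fin wE.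
  have -> : (4 ^+ M)^-1 = y M ^+ 2 :> R.
    by rewrite /y -exprM mulnC exprM -exprVn; congr (_ ^+ _); field.
  have -> : (1 + (y M)^-1) ^+ 3 * (pi *+ 2 * B * (j * (y M ^+ 2) ^+ 2)) = (1 + y M) ^+ 3 * y M * K.
    by rewrite /K; field; rewrite gt_eqF.
  apply: le_trans.
  rewrite (_ : pi *+ 2 * B * _ = B / (pi *+ 2) * wq (kern B) (window (N M)) al); last first.
    by move: (pi *+ 2) (lt0r_neq0 p2) => q q0; field.
  by rewrite ler_pM2l ?divr_gt0// HM// (leq_trans MM).
have c1 : (fun M => 1 + y M) @ \oo --> (1 + 0 : R) by apply: cvgD; [exact: cvg_cst|exact: cy].
have c3 : (fun M => (1 + y M) ^+ 3) @ \oo --> ((1 + 0) ^+ 3 : R)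
  by exact: (cvgM c1 (cvgM c1 c1)).
have cw : (fun M => (1 + y M) ^+ 3 * w + (1 + y M) ^+ 3 * y M * K) @ \oo -->
    ((1 + 0) ^+ 3 * w + (1 + 0) ^+ 3 * 0 * K : R).
  exact: (cvgD (cvgM c3 (cvg_cst w)) (cvgM (cvgM c3 cy) (cvg_cst K))).
rewrite addr0 expr1n mul1r mulr0 mul0r addr0 in cw.
apply: ler_cvg_to (cvg_cst _) cw _.
by exists M0 => // M /= MM; exact: step.
Qed.

End Final.

Theorem corollary5p4 (R : realType) :
  exists B4 : R, `|B4 - 260%:R / 100%:R| <= 1 / 100%:R /\
    forall B : R, 0 < B -> B < B4 ->
      exists u0 : R -> R[i], [/\ L2 u0, L2norm u0 = 1 & W B u0 = J1 B].
Proof.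
(* The upper end of the range covered by the numerical check, at distance exactly 1/100 from
   2.60. *)
exists (259%:R / 100%:R); split.
  by rewrite ler_norml; apply/andP; split; lra.
move=> B B0 B4; have [s hs] := prim_shift_gt B0 B4; have j2 := wq_chirp_gt B0 hs.
have [u0 [Lu n1 Wu]] := W_unit_attained B0 j2.
exists u0; split => //; apply/eqP; rewrite eq_le; apply/andP; split.
  by apply: ereal_sup_ubound; exists u0.
apply: ge_ereal_sup => _ [u [Lu' nu] <-].
exact: le_trans (W_unit_le B0 j2 Lu' nu) Wu.
Qed.
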